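(* Let $f\colon X\to Y$ be a schematic morphism between finite spaces and $\Gamma\colon X\to X\times Y$ its graph. For any quasi-coherent module $\mathcal M$ on $X$, $\mathbb R\Gamma_*\mathcal M$ and $\mathbb Rf_*\mathcal M$ are quasi-coherent (i.e. $R^i\Gamma_*\mathcal M$ and $R^if_*\mathcal M$ are quasi-coherent for every $i\ge0$).
   Context: All rings are commutative with unit. A ringed finite space is a ringed space $(X,\mathcal O)$ with $X$ a finite topological space; morphisms are morphisms of ringed spaces. For $p\in X$, $U_p$ is the smallest open subset containing $p$; $p\le q$ means $q\in U_p$. The stalk is $\mathcal O_p=\mathcal O(U_p)$, with restriction morphisms $\mathcal O_p\to\mathcal O_q$ for $p\le q$. A finite space is a ringed finite space all of whose restriction morphisms are flat. An $\mathcal O$-module is quasi-coherent if it is locally a cokernel of a morphism between free modules of arbitrary rank. All spaces and morphisms are over a fixed commutative base ring $k$ (i.e. over the one-point ringed space $( *,k)$; $k=\mathbb Z$ imposes no restriction). $X\times Y=X\times_kY$ is the product topological space with $\mathcal O_{(x,y)}=\mathcal O_x\otimes_k\mathcal O_y$. A morphism $f\colon X\to Y$ of finite spaces is schematic if $R^i\Gamma_*\mathcal O_X$ is quasi-coherent for all $i\ge0$, where $\Gamma\colon X\to X\times Y$ is the graph of $f$ (the morphism with components $\mathrm{Id}_X$ and $f$). *)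

(* Defs.v *)
From HB Require Import structures.
From mathcomp Require Import all_boot all_order all_algebra.
From mathcomp Require Import finmap boolp classical_sets functions cardinality topology.

Set Implicit Arguments.
Unset Strict Implicit.
Unset Printing Implicit Defensive.

Import GRing.Theory.
Local Open Scope quotient_scope.
Local Open Scope classical_set_scope.
Local Open Scope ring_scope.

(* [M (x) N / (c m (x) n = m (x) c n)] for abelian groups [M], [N] on which a
   type [K] of scalars acts. Both the tensor product of modules over a
   commutative ring and the tensor product of algebras are instances. Elements
   are classes of formal sums [sum_i m_i (x) n_i]; two formal sums are
   identified when no balanced biadditive map separates them, that is, when
   they agree in the universal such group. *)
Section Tensor.
Variables (K : Type) (M N : zmodType) (aM : K -> M -> M) (aN : K -> N -> N).

Definition balanced (P : zmodType) (phi : M -> N -> P) : Prop :=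
  [/\ forall m m' n, phi (m + m') n = phi m n + phi m' n,
      forall m n n', phi m (n + n') = phi m n + phi m n' &
      forall c m n, phi (aM c m) n = phi m (aN c n)].

Definition tsum (P : zmodType) (phi : M -> N -> P) (s : seq (M * N)) : P :=
  \sum_(x <- s) phi x.1 x.2.

Definition tensor_rel (s t : seq (M * N)) : bool :=
  `[< forall (P : zmodType) (phi : M -> N -> P),
        balanced phi -> tsum phi s = tsum phi t >].

Lemma tensor_rel_equiv : equiv_class_of tensor_rel.
Proof.
split.
- by move=> s; apply/asboolP.
- by move=> s t; apply/asboolP/asboolP => h P phi hphi; rewrite h.
- move=> s t u /asboolP h1 /asboolP h2; apply/asboolP => P phi hphi.
  by rewrite h1 // h2.
Qed.

Canonical tensor_equiv := EquivRelPack tensor_rel_equiv.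

Definition tensor := {eq_quot tensor_equiv}.

HB.instance Definition _ := Choice.on tensor.
HB.instance Definition _ := EqQuotient.on tensor.

Definition tclass (s : seq (M * N)) : tensor := \pi_tensor s.
Definition pure (m : M) (n : N) : tensor := tclass [:: (m, n)].
Definition tlift (P : zmodType) (phi : M -> N -> P) (x : tensor) : P :=
  tsum phi (repr x).

Lemma tlift_class (P : zmodType) (phi : M -> N -> P) s :
  balanced phi -> tlift phi (tclass s) = tsum phi s.
Proof.
move=> hphi; have /eqmodP/asboolP h : repr (tclass s) = s %[mod tensor].
  by rewrite reprK.
exact: h.
Qed.

Lemma tlift_pure (P : zmodType) (phi : M -> N -> P) m n :
  balanced phi -> tlift phi (pure m n) = phi m n.
Proof. by move=> hphi; rewrite tlift_class // /tsum big_seq1. Qed.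

Lemma eq_tlift (P : zmodType) (phi psi : M -> N -> P) x :
  (forall m n, phi m n = psi m n) -> tlift phi x = tlift psi x.
Proof. by move=> h; apply: eq_bigr. Qed.

Lemma tensor_ext (x y : tensor) :
  (forall (P : zmodType) (phi : M -> N -> P),
     balanced phi -> tlift phi x = tlift phi y) -> x = y.
Proof.
move=> h; rewrite -[x]reprK -[y]reprK; apply/eqmodP/asboolP => P phi hphi.
exact: h.
Qed.

Lemma balanced0l (P : zmodType) (phi : M -> N -> P) n :
  balanced phi -> phi 0 n = 0.
Proof.
by case=> hD _ _; apply: (addrI (phi 0 n)); rewrite -hD !addr0.
Qed.

Lemma balancedN (P : zmodType) (phi : M -> N -> P) m n :
  balanced phi -> phi (- m) n = - phi m n.
Proof.
move=> hphi; apply/eqP; rewrite -addr_eq0; case: (hphi) => <- _ _.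
by rewrite addNr balanced0l.
Qed.

Definition tensor_zero : tensor := tclass [::].
Definition tensor_add (x y : tensor) : tensor := tclass (repr x ++ repr y).
Definition tensor_opp (x : tensor) : tensor :=
  tclass [seq (- z.1, z.2) | z <- repr x].

Section Lift.
Variables (P : zmodType) (phi : M -> N -> P).
Hypothesis hphi : balanced phi.

Lemma tlift0 : tlift phi tensor_zero = 0.
Proof. by rewrite tlift_class // /tsum big_nil. Qed.

Lemma tliftD x y : tlift phi (tensor_add x y) = tlift phi x + tlift phi y.
Proof. by rewrite tlift_class // /tsum big_cat. Qed.

Lemma tliftN x : tlift phi (tensor_opp x) = - tlift phi x.
Proof.
rewrite tlift_class // /tlift /tsum big_map -sumrN.
by apply: eq_bigr => z _; rewrite /= balancedN.
Qed.

End Lift.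

Let addA : associative tensor_add.
Proof. by move=> x y z; apply: tensor_ext => P f hf; rewrite !tliftD // addrA. Qed.
Let addC : commutative tensor_add.
Proof. by move=> x y; apply: tensor_ext => P f hf; rewrite !tliftD // addrC. Qed.
Let add0 : left_id tensor_zero tensor_add.
Proof.
by move=> x; apply: tensor_ext => P f hf; rewrite tliftD // tlift0 // add0r.
Qed.
Let addN : left_inverse tensor_zero tensor_opp tensor_add.
Proof.
move=> x; apply: tensor_ext => P f hf.
by rewrite tliftD // tlift0 // tliftN // addNr.
Qed.

HB.instance Definition _ :=
  GRing.isZmodule.Build tensor addA addC add0 addN.

Lemma tensorE (x : tensor) : x = \sum_(z <- repr x) pure z.1 z.2.
Proof.
apply: tensor_ext => P phi hphi; rewrite {1}/tlift /tsum.
elim: (repr x) => [|z s IHs]; first by rewrite !big_nil tlift0.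
by rewrite !big_cons tliftD // tlift_pure // IHs.
Qed.

Lemma balanced_pure : balanced pure.
Proof.
split=> *; apply: tensor_ext => P phi hphi; rewrite ?tliftD // !tlift_pure //;
by case: hphi.
Qed.

End Tensor.

Section TensorAlgebra.
Variables (k A B : comPzRingType).
Variables (phi : {rmorphism k -> A}) (psi : {rmorphism k -> B}).

Definition tensor_alg : Type :=
  @tensor k A B (fun c a => phi c * a) (fun c b => psi c * b).

HB.instance Definition _ := GRing.Zmodule.on tensor_alg.

Definition tpure (a : A) (b : B) : tensor_alg := pure _ _ a b.

Definition tensor_one : tensor_alg := tpure 1 1.
Definition tensor_mul (x y : tensor_alg) : tensor_alg :=
  tlift (fun a b => tlift (fun a' b' => tpure (a * a') (b * b')) y) x.

Local Notation bal f :=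
  (balanced (fun c a => phi c * a) (fun c b => psi c * b) f).

Lemma balanced_mul (P : zmodType) (f : A -> B -> P) a b : bal f ->
  bal (fun a' b' => f (a * a') (b * b')).
Proof.
case=> h1 h2 h3; split=> [m m' n|m n n'|c m n].
- by rewrite mulrDr h1.
- by rewrite mulrDr h2.
- by rewrite mulrCA h3 mulrCA.
Qed.

Lemma balanced_mul_lift (P : zmodType) (f : A -> B -> P) (y : tensor_alg) :
  bal f -> bal (fun a b => tlift (fun a' b' => f (a * a') (b * b')) y).
Proof.
case=> h1 h2 h3; split=> [m m' n|m n n'|c m n]; rewrite /tlift /tsum.
- by rewrite -big_split; apply: eq_bigr => z _; rewrite mulrDl h1.
- by rewrite -big_split; apply: eq_bigr => z _; rewrite mulrDl h2.
- by apply: eq_bigr => z _; rewrite -mulrA h3 mulrA.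
Qed.

Lemma tlift_additive (P : zmodType) (f : A -> B -> P) (I : Type) (s : seq I)
    (F : I -> tensor_alg) : bal f ->
  tlift f (\sum_(i <- s) F i) = \sum_(i <- s) tlift f (F i).
Proof.
move=> hf; elim: s => [|i s IHs]; first by rewrite !big_nil tlift0.
by rewrite !big_cons tliftD // IHs.
Qed.

Lemma tlift_mul (P : zmodType) (f : A -> B -> P) (x y : tensor_alg) : bal f ->
  tlift f (tensor_mul x y) =
  tlift (fun a b => tlift (fun a' b' => f (a * a') (b * b')) y) x.
Proof.
move=> hf; rewrite /tensor_mul {2}/tlift /tsum tlift_additive //.
apply: eq_bigr => z _; rewrite {2}/tlift /tsum tlift_additive //.
by apply: eq_bigr => z' _; rewrite tlift_pure.
Qed.

Let mulA : associative tensor_mul.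
Proof.
move=> x y z; apply: tensor_ext => P f hf; rewrite !tlift_mul //; last first.
  exact: balanced_mul_lift.
apply: eq_tlift => a b; rewrite tlift_mul; last exact: balanced_mul.
by do 2![apply: eq_tlift => ? ?]; rewrite !mulrA.
Qed.
Let mulC : commutative tensor_mul.
Proof.
move=> x y; apply: tensor_ext => P f hf; rewrite !tlift_mul //.
rewrite /tlift /tsum exchange_big; apply: eq_bigr => z _.
by apply: eq_bigr => z' _; rewrite mulrC (mulrC z'.2).
Qed.
Let mul1 : left_id tensor_one tensor_mul.
Proof.
move=> x; apply: tensor_ext => P f hf; rewrite tlift_mul // tlift_pure.
  by apply: eq_tlift => a b; rewrite !mul1r.
exact: balanced_mul_lift.
Qed.
Let mulD : left_distributive tensor_mul +%R.
Proof.
move=> x y z; apply: tensor_ext => P f hf.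
by rewrite tliftD // !tlift_mul // tliftD //; apply: balanced_mul_lift.
Qed.

HB.instance Definition _ :=
  GRing.Zmodule_isComPzRing.Build tensor_alg mulA mulC mul1 mulD.

Lemma balanced_tpure : bal tpure.
Proof. exact: balanced_pure. Qed.

Lemma tpureM a b a' b' : tpure a b * tpure a' b' = tpure (a * a') (b * b').
Proof.
apply: tensor_ext => P f hf; rewrite tlift_mul // !tlift_pure //.
  exact: balanced_mul.
exact: balanced_mul_lift.
Qed.

Section AlgebraLift.
Variables (C : comPzRingType) (f : {rmorphism A -> C}) (g : {rmorphism B -> C}).
Hypothesis fg : forall c, f (phi c) = g (psi c).

Definition alg_lift (x : tensor_alg) : C := tlift (fun a b => f a * g b) x.

Lemma balanced_alg : bal (fun a b => f a * g b).
Proof.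
split=> *; rewrite ?rmorphD ?mulrDl ?mulrDr // !rmorphM /= fg.
by rewrite mulrCA mulrA.
Qed.

Lemma alg_lift_additive : zmod_morphism alg_lift.
Proof.
have h := balanced_alg; move=> x y.
by rewrite /alg_lift tliftD // tliftN.
Qed.

Lemma alg_lift_multiplicative : monoid_morphism alg_lift.
Proof.
have h := balanced_alg; split=> [|x y].
  by rewrite /alg_lift tlift_pure // !rmorph1 mulr1.
rewrite /alg_lift tlift_mul // /tlift /tsum mulr_suml.
apply: eq_bigr => z _; rewrite mulr_sumr; apply: eq_bigr => z' _.
by rewrite !rmorphM mulrACA.
Qed.

Definition alg_lift_rmorphism : {rmorphism tensor_alg -> C} :=
  HB.pack alg_lift
    (GRing.isZmodMorphism.Build _ _ alg_lift alg_lift_additive)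
    (GRing.isMonoidMorphism.Build _ _ alg_lift alg_lift_multiplicative).

Lemma alg_lift_pure a b : alg_lift_rmorphism (tpure a b) = f a * g b.
Proof. exact/tlift_pure/balanced_alg. Qed.

End AlgebraLift.

Lemma tensor_alg_ext (C : comPzRingType) (f g : {rmorphism tensor_alg -> C}) :
  (forall a b, f (tpure a b) = g (tpure a b)) -> f =1 g.
Proof.
move=> h x; rewrite (tensorE x) !rmorph_sum; apply: eq_bigr => z _.
exact: h.
Qed.

Definition tensor_inl_fun (a : A) : tensor_alg := tpure a 1.
Definition tensor_inr_fun (b : B) : tensor_alg := tpure 1 b.

Lemma tensor_inl_additive : zmod_morphism tensor_inl_fun.
Proof.
move=> a a'; apply: tensor_ext => P f hf.
rewrite tliftD // tliftN // !tlift_pure //.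
by case: (hf) => -> _ _; rewrite (balancedN _ _ hf).
Qed.
Lemma tensor_inl_multiplicative : monoid_morphism tensor_inl_fun.
Proof. by split=> // a a'; rewrite [RHS]tpureM mulr1. Qed.
Lemma tensor_inr_additive : zmod_morphism tensor_inr_fun.
Proof.
move=> b b'; case: balanced_tpure => _ h _.
by apply/eqP; rewrite eq_sym subr_eq -h subrK.
Qed.
Lemma tensor_inr_multiplicative : monoid_morphism tensor_inr_fun.
Proof. by split=> // b b'; rewrite [RHS]tpureM mulr1. Qed.

Definition tensor_inl : {rmorphism A -> tensor_alg} :=
  HB.pack tensor_inl_fun
    (GRing.isZmodMorphism.Build _ _ tensor_inl_fun tensor_inl_additive)
    (GRing.isMonoidMorphism.Build _ _ tensor_inl_fun tensor_inl_multiplicative).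
Definition tensor_inr : {rmorphism B -> tensor_alg} :=
  HB.pack tensor_inr_fun
    (GRing.isZmodMorphism.Build _ _ tensor_inr_fun tensor_inr_additive)
    (GRing.isMonoidMorphism.Build _ _ tensor_inr_fun tensor_inr_multiplicative).

Lemma tensor_inlr c : tensor_inl (phi c) = tensor_inr (psi c).
Proof.
case: balanced_tpure => _ _ h.
by rewrite /= /tensor_inl_fun -[phi c]mulr1 h mulr1.
Qed.

End TensorAlgebra.

(* Flatness of [B] as an [A]-module: [B (x)_A -] preserves injections. *)
Definition flat (A B : comPzRingType) (phi : {rmorphism A -> B}) : Prop :=
  forall (N N' : lmodType A) (u : {linear N -> N'}), injective u ->
    injective (tlift (fun b n => pure _ _ b (u n))
      : tensor (fun a b => phi a * b) (fun a (n : N) => a *: n) ->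
        tensor (fun a b => phi a * b) (fun a (n : N') => a *: n)).

Section MinimalOpen.
Variable X : topologicalType.

(* The set [U_p]: the intersection of all open sets around [p], which is itself
   open when [X] is finite. *)
Definition minopen (p : X) : set X :=
  [set q | forall V : set X, open V -> V p -> V q].

Definition spec_le (p q : X) : Prop := minopen p q.

Lemma spec_le_refl p : spec_le p p.
Proof. by []. Qed.

Lemma spec_le_trans q p r : spec_le p q -> spec_le q r -> spec_le p r.
Proof. by move=> pq qr V oV Vp; apply: qr => //; apply: pq. Qed.

Lemma open_minopen p : finite_set [set: X] -> open (minopen p).
Proof.
move=> /finite_fsetP[D XD]; rewrite openE => q pq; rewrite /interior.
have H (x : X) : exists V : set X, [/\ open V, V q & V x -> minopen q x].
  case: (pselect (minopen q x)) => [qx|].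
    by exists setT; split => //; exact: openT.
  by move=> /existsNP[V /not_implyP[oV /not_implyP[Vq Vx]]]; exists V.
have [W HW] := choice H.
have : nbhs q (\bigcap_(x in [set` D]) W x).
  apply: filter_bigI => x _; case: (HW x) => oW Wq _.
  exact: open_nbhs_nbhs.
apply: filterS => x Wx; apply: (spec_le_trans pq).
by case: (HW x) => _ _; apply; apply: Wx; rewrite -XD.
Qed.

Lemma open_upclosed (V : set X) : finite_set [set: X] ->
  open V <-> forall p q, spec_le p q -> V p -> V q.
Proof.
move=> finX; split=> [oV p q pq Vp|h]; first exact: pq.
rewrite openE => p Vp; rewrite /interior.
apply: (@filterS _ _ _ (minopen p)) => [q pq|]; first exact: h Vp.
by apply: open_nbhs_nbhs; split=> //; exact: open_minopen.
Qed.

End MinimalOpen.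

Lemma continuous_spec_le (X Y : topologicalType) (f : X -> Y) (p q : X) :
  continuous f -> spec_le p q -> spec_le (f p) (f q).
Proof.
move=> /continuousP cf pq V oV Vp; apply: (pq (f @^-1` V)) => //.
exact: cf.
Qed.

Lemma continuous_fst (X Y : topologicalType) : continuous (@fst X Y).
Proof. by move=> x; exact: cvg_fst. Qed.

Lemma continuous_snd (X Y : topologicalType) : continuous (@snd X Y).
Proof. by move=> x; exact: cvg_snd. Qed.

(* A ringed finite space over [k]. A sheaf on a finite space is determined by
   its stalks [O_p = O(U_p)] and the restrictions [O_p -> O_q] for [q \in U_p];
   its sections on an open set [U] are the families in [prod_(p in U) O_p]
   compatible with the restrictions, and any functorial system of stalks
   arises in this way. *)
Record ringed_fspace (k : comPzRingType) := RingedFspace {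
  pts :> topologicalType;
  pts_finite : finite_set [set: pts];
  stalk : pts -> comPzRingType;
  res : forall p q : pts, spec_le p q -> {rmorphism stalk p -> stalk q};
  res_id : forall (p : pts) (h : spec_le p p) a, res h a = a;
  res_comp : forall (p q r : pts) (hpq : spec_le p q) (hqr : spec_le q r)
    (hpr : spec_le p r) a, res hqr (res hpq a) = res hpr a;
  scal : forall p : pts, {rmorphism k -> stalk p};
  res_scal : forall (p q : pts) (h : spec_le p q) c,
    res h (scal p c) = scal q c
}.

Definition finite_space (k : comPzRingType) (X : ringed_fspace k) : Prop :=
  forall (p q : X) (h : spec_le p q), flat (res h).

(* Morphisms of ringed spaces over [k], the map [O_Y -> f_* O_X] being given in
   its adjoint form [f^-1 O_Y -> O_X]. *)
Record fmorphism (k : comPzRingType) (X Y : ringed_fspace k) := Fmorphism {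
  fmap :> X -> Y;
  fmap_continuous : continuous fmap;
  fsharp : forall x : X, {rmorphism stalk (fmap x) -> stalk x};
  fsharp_res : forall (x x' : X) (h : spec_le x x')
    (h' : spec_le (fmap x) (fmap x')) b,
    fsharp x' (res h' b) = res h (fsharp x b);
  fsharp_scal : forall (x : X) c, fsharp x (scal (fmap x) c) = scal x c
}.

Section Product.
Variables (k : comPzRingType) (X Y : ringed_fspace k).

Definition prod_stalk (z : X * Y) : comPzRingType :=
  tensor_alg (scal z.1) (scal z.2).

Lemma prod_le1 (z z' : X * Y) : spec_le z z' -> spec_le z.1 z'.1.
Proof. exact: (continuous_spec_le (@continuous_fst X Y)). Qed.

Lemma prod_le2 (z z' : X * Y) : spec_le z z' -> spec_le z.2 z'.2.
Proof. exact: (continuous_spec_le (@continuous_snd X Y)). Qed.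

Lemma prod_res_compat (z z' : X * Y) (h : spec_le z z') (c : k) :
  (tensor_inl (scal z'.1) (scal z'.2) \o res (prod_le1 h)) (scal z.1 c) =
  (tensor_inr (scal z'.1) (scal z'.2) \o res (prod_le2 h)) (scal z.2 c).
Proof.
by rewrite !compE (res_scal (prod_le1 h)) (res_scal (prod_le2 h)) tensor_inlr.
Qed.

Definition prod_res (z z' : X * Y) (h : spec_le z z') :
  {rmorphism prod_stalk z -> prod_stalk z'} :=
  alg_lift_rmorphism (prod_res_compat h).

Lemma prod_res_pure z z' (h : spec_le z z') a b :
  prod_res h (tpure _ _ a b) =
  tpure _ _ (res (prod_le1 h) a) (res (prod_le2 h) b).
Proof. by rewrite alg_lift_pure [LHS]tpureM mulr1 mul1r. Qed.

Lemma prod_res_id z (h : spec_le z z) t : prod_res h t = t.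
Proof.
rewrite -[RHS]/((idfun : {rmorphism _ -> _}) t); apply: tensor_alg_ext => a b.
by rewrite prod_res_pure !res_id.
Qed.

Lemma prod_res_comp z1 z2 z3 (h12 : spec_le z1 z2) (h23 : spec_le z2 z3)
    (h13 : spec_le z1 z3) t :
  prod_res h23 (prod_res h12 t) = prod_res h13 t.
Proof.
apply: (tensor_alg_ext (f := (prod_res h23 \o prod_res h12)%FUN)) => a b.
transitivity (prod_res h23 (prod_res h12 (tpure _ _ a b))); first by [].
by rewrite !prod_res_pure (res_comp _ _ (prod_le1 h13))
  (res_comp _ _ (prod_le2 h13)).
Qed.

Definition prod_scal (z : X * Y) : {rmorphism k -> prod_stalk z} :=
  (tensor_inl (scal z.1) (scal z.2) \o scal z.1)%FUN.

Lemma prod_res_scal z z' (h : spec_le z z') c :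
  prod_res h (prod_scal z c) = prod_scal z' c.
Proof. by rewrite /= [LHS]prod_res_pure res_scal rmorph1. Qed.

Lemma prod_finite : finite_set [set: X * Y].
Proof. by rewrite -setXTT; apply: finite_setX; exact: pts_finite. Qed.

Definition fprod : ringed_fspace k :=
  RingedFspace prod_finite prod_res_id prod_res_comp prod_res_scal.

End Product.

Section Graph.
Variables (k : comPzRingType) (X Y : ringed_fspace k) (f : fmorphism X Y).

Definition graph_map (x : X) : fprod X Y := (x, f x).

Lemma graph_continuous : continuous graph_map.
Proof. by move=> x; apply: cvg_pair; [exact: cvg_id | exact: fmap_continuous]. Qed.

Lemma graph_compat x c :
  (idfun : {rmorphism stalk x -> stalk x}) (scal x c) = fsharp f x (scal (f x) c).
Proof. by rewrite fsharp_scal. Qed.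

Definition graph_sharp (x : X) :
    {rmorphism stalk (graph_map x) -> stalk x} :=
  alg_lift_rmorphism (graph_compat x).

Lemma graph_sharp_pure x a b :
  graph_sharp x (tpure _ _ a b) = a * fsharp f x b.
Proof. by rewrite alg_lift_pure. Qed.

Lemma graph_sharp_res (x x' : X) (h : spec_le x x')
    (h' : spec_le (graph_map x) (graph_map x')) t :
  graph_sharp x' (res h' t) = res h (graph_sharp x t).
Proof.
apply: (tensor_alg_ext (f := (graph_sharp x' \o prod_res h')%FUN)
  (g := (res h \o graph_sharp x)%FUN)) => a b.
transitivity (graph_sharp x' (prod_res h' (tpure _ _ a b))); first by [].
transitivity (res h (graph_sharp x (tpure _ _ a b))); last by [].
rewrite prod_res_pure !graph_sharp_pure.
by rewrite rmorphM -(fsharp_res h (prod_le2 h')) (Prop_irrelevance (prod_le1 h') h).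
Qed.

Lemma graph_sharp_scal x c : graph_sharp x (scal (graph_map x) c) = scal x c.
Proof. by rewrite [LHS]graph_sharp_pure rmorph1 mulr1. Qed.

Definition graph : fmorphism X (fprod X Y) :=
  Fmorphism graph_continuous graph_sharp_res graph_sharp_scal.

End Graph.

Record omod (k : comPzRingType) (X : ringed_fspace k) := Omod {
  mstalk :> forall p : X, lmodType (stalk p);
  mres : forall p q : X, spec_le p q -> {additive mstalk p -> mstalk q};
  mres_scale : forall (p q : X) (h : spec_le p q) a (m : mstalk p),
    mres h (a *: m) = res h a *: mres h m;
  mres_id : forall (p : X) (h : spec_le p p) m, mres h m = m;
  mres_comp : forall (p q r : X) (hpq : spec_le p q) (hqr : spec_le q r)
    (hpr : spec_le p r) m, mres hqr (mres hpq m) = mres hpr m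
}.

(* A morphism of [O_U]-modules from the restriction of [M] to that of [N]. *)
Record local_hom (k : comPzRingType) (X : ringed_fspace k) (U : set X)
    (M N : omod X) := LocalHom {
  lhom :> forall p : X, U p -> {linear M p -> N p};
  lhom_res : forall (p q : X) (Up : U p) (Uq : U q) (h : spec_le p q) m,
    lhom Uq (mres M h m) = mres N h (lhom Up m)
}.

Record mhom (k : comPzRingType) (X : ringed_fspace k) (M N : omod X) := Mhom {
  mmap :> forall p : X, {linear M p -> N p};
  mmap_res : forall (p q : X) (h : spec_le p q) m,
    mmap q (mres M h m) = mres N h (mmap p m)
}.

Section StructureSheaf.
Variables (k : comPzRingType) (X : ringed_fspace k).

Definition regular_stalk (p : X) : lmodType (stalk p) := (stalk p)^o.

Definition regular_res (p q : X) (h : spec_le p q) :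
  {additive regular_stalk p -> regular_stalk q} := res h.

Lemma regular_res_scale (p q : X) (h : spec_le p q) a (m : regular_stalk p) :
  regular_res h (a *: m) = res h a *: regular_res h m.
Proof. exact: rmorphM. Qed.

Definition structure_sheaf : omod X :=
  @Omod k X regular_stalk regular_res regular_res_scale (@res_id k X) (@res_comp k X).

End StructureSheaf.

(* The direct sum [R^(I)], as the finitely supported functions [I -> R]. *)
Section FreeModule.
Variables (I : Type) (R : comPzRingType).

Record finsupp := Finsupp {
  fsval :> I -> R;
  fsfin : finite_set [set i | fsval i != 0]
}.

Lemma finsupp_ext (f g : finsupp) : f =1 g -> f = g.
Proof.
case: f g => [f hf] [g hg] /= /funext fg; move: hf hg.
by rewrite fg => hf hg; rewrite (Prop_irrelevance hf hg).
Qed.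

HB.instance Definition _ := gen_eqMixin finsupp.
HB.instance Definition _ := gen_choiceMixin finsupp.

Lemma fs_zero_subproof : finite_set [set i : I | (0 : R) != 0].
Proof. by rewrite eqxx; apply: (sub_finite_set _ (finite_set0 I)). Qed.
Lemma fs_add_subproof (f g : finsupp) : finite_set [set i | f i + g i != 0].
Proof.
apply: sub_finite_set (_ : finite_set ([set i | f i != 0] `|` [set i | g i != 0])).
  move=> i /=; case: (eqVneq (f i) 0) => [->|]; last by left.
  by rewrite add0r; right.
by rewrite finite_setU; split; apply: fsfin.
Qed.
Lemma fs_opp_subproof (f : finsupp) : finite_set [set i | - f i != 0].
Proof. by apply: sub_finite_set (fsfin f) => i /=; rewrite oppr_eq0. Qed.
Lemma fs_scale_subproof a (f : finsupp) : finite_set [set i | a * f i != 0].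
Proof.
apply: sub_finite_set (fsfin f) => i /=.
by apply: contra_neq => ->; rewrite mulr0.
Qed.

Definition fs_zero := Finsupp fs_zero_subproof.
Definition fs_add f g := Finsupp (fs_add_subproof f g).
Definition fs_opp f := Finsupp (fs_opp_subproof f).
Definition fs_scale a f := Finsupp (fs_scale_subproof a f).

Let addA : associative fs_add.
Proof. by move=> f g h; apply: finsupp_ext => i /=; rewrite addrA. Qed.
Let addC : commutative fs_add.
Proof. by move=> f g; apply: finsupp_ext => i /=; rewrite addrC. Qed.
Let add0 : left_id fs_zero fs_add.
Proof. by move=> f; apply: finsupp_ext => i /=; rewrite add0r. Qed.
Let addN : left_inverse fs_zero fs_opp fs_add.
Proof. by move=> f; apply: finsupp_ext => i /=; rewrite addNr. Qed.

HB.instance Definition _ := GRing.isZmodule.Build finsupp addA addC add0 addN.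

Let scaleA a b f : fs_scale a (fs_scale b f) = fs_scale (a * b) f.
Proof. by apply: finsupp_ext => i /=; rewrite mulrA. Qed.
Let scale1 : left_id 1 fs_scale.
Proof. by move=> f; apply: finsupp_ext => i /=; rewrite mul1r. Qed.
Let scaleDr : right_distributive fs_scale +%R.
Proof. by move=> a f g; apply: finsupp_ext => i /=; rewrite mulrDr. Qed.
Let scaleDl f : {morph fs_scale^~ f : a b / a + b}.
Proof. by move=> a b; apply: finsupp_ext => i /=; rewrite mulrDl. Qed.

HB.instance Definition _ :=
  GRing.Zmodule_isLmodule.Build R finsupp scaleA scale1 scaleDr scaleDl.

End FreeModule.

Section FiniteSupportMap.
Variables (I : Type) (R S : comPzRingType) (phi : {rmorphism R -> S}).

Lemma fs_map_subproof (f : finsupp I R) : finite_set [set i | phi (f i) != 0].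
Proof.
apply: sub_finite_set (fsfin f) => i /=.
by apply: contra_neq => ->; rewrite rmorph0.
Qed.

Definition fs_map (f : finsupp I R) : finsupp I S := Finsupp (fs_map_subproof f).

Lemma fs_map_additive : zmod_morphism fs_map.
Proof. by move=> f g; apply: finsupp_ext => i /=; rewrite rmorphB. Qed.

HB.instance Definition _ :=
  GRing.isZmodMorphism.Build (finsupp I R) (finsupp I S) fs_map fs_map_additive.

End FiniteSupportMap.

Section FreeSheaf.
Variables (k : comPzRingType) (X : ringed_fspace k) (I : Type).

Definition free_stalk (p : X) : lmodType (stalk p) := finsupp I (stalk p).

Definition free_res (p q : X) (h : spec_le p q) :
  {additive free_stalk p -> free_stalk q} := @fs_map I _ _ (res h).

Lemma free_res_scale (p q : X) (h : spec_le p q) a (m : free_stalk p) :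
  free_res h (a *: m) = res h a *: free_res h m.
Proof. by apply: finsupp_ext => i /=; rewrite rmorphM. Qed.

Lemma free_res_id (p : X) (h : spec_le p p) m : free_res h m = m.
Proof. by apply: finsupp_ext => i /=; rewrite res_id. Qed.

Lemma free_res_comp (p q r : X) (hpq : spec_le p q) (hqr : spec_le q r)
  (hpr : spec_le p r) m : free_res hqr (free_res hpq m) = free_res hpr m.
Proof. by apply: finsupp_ext => i /=; rewrite (res_comp _ _ hpr). Qed.

Definition free_sheaf : omod X :=
  Omod free_res_scale free_res_id free_res_comp.

End FreeSheaf.

(* Around each point there is an open set [U] with an exact sequence
   [O_U^(J) -> O_U^(I) -> M|_U -> 0]. *)
Definition quasi_coherent (k : comPzRingType) (X : ringed_fspace k)
    (M : omod X) : Prop :=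
  forall p : X, exists U : set X, [/\ open U, U p &
    exists (J I : Type) (a : local_hom U (free_sheaf X J) (free_sheaf X I))
      (b : local_hom U (free_sheaf X I) M),
      forall (q : X) (Uq : U q),
        (forall m : M q, exists x, b q Uq x = m) /\
        (forall x, b q Uq x = 0 <-> exists y, a q Uq y = x)].

Section Sections.
Variables (k : comPzRingType) (X : ringed_fspace k).
Variables (M : omod X) (U : set X).

Record sections := Sections {
  sec :> forall p : X, U p -> M p;
  sec_res : forall (p q : X) (Up : U p) (Uq : U q) (h : spec_le p q),
    mres M h (sec Up) = sec Uq
}.

Lemma sections_ext (s t : sections) :
  (forall p (Up : U p), s p Up = t p Up) -> s = t.
Proof.
case: s t => [s hs] [t ht] /= st.
have {}st : s = t by apply: functional_extensionality_dep => p; apply: functional_extensionality_dep => Up.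
by move: hs ht; rewrite st => hs ht; rewrite (Prop_irrelevance hs ht).
Qed.

HB.instance Definition _ := gen_eqMixin sections.
HB.instance Definition _ := gen_choiceMixin sections.

Program Definition sec_zero := @Sections (fun p _ => 0) _.
Next Obligation. by move=> *; rewrite raddf0. Qed.
Program Definition sec_add (s t : sections) :=
  @Sections (fun p Up => s p Up + t p Up) _.
Next Obligation. by move=> s t p q Up Uq h; rewrite raddfD !(sec_res _ _ Uq). Qed.
Program Definition sec_opp (s : sections) := @Sections (fun p Up => - s p Up) _.
Next Obligation. by move=> s p q Up Uq h; rewrite raddfN (sec_res _ _ Uq). Qed.

Let addA : associative sec_add.
Proof. by move=> r s t; apply: sections_ext => p Up /=; rewrite addrA. Qed.
Let addC : commutative sec_add.
Proof. by move=> s t; apply: sections_ext => p Up /=; rewrite addrC. Qed.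
Let add0 : left_id sec_zero sec_add.
Proof. by move=> s; apply: sections_ext => p Up /=; rewrite add0r. Qed.
Let addN : left_inverse sec_zero sec_opp sec_add.
Proof. by move=> s; apply: sections_ext => p Up /=; rewrite addNr. Qed.

HB.instance Definition _ := GRing.isZmodule.Build sections addA addC add0 addN.

End Sections.

Section PushStalk.
Variables (k : comPzRingType) (X Y : ringed_fspace k) (f : fmorphism X Y).
Variables (M : omod X) (y : Y).

(* [(f_* M)_y = M (f^-1 U_y)], on which [b : O_y] acts at [x] through the image
   of [b] in [O_x]. *)
Definition push_stalk : Type := sections M (f @^-1` (minopen y)).

HB.instance Definition _ := GRing.Zmodule.on push_stalk.

Program Definition push_scale (b : stalk y) (s : push_stalk) : push_stalk :=
  @Sections k X M (f @^-1` (minopen y))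
    (fun x h => fsharp f x (res (h : spec_le y (f x)) b) *: s x h) _.
Next Obligation.
move=> b s x x' yx yx' xx' /=.
rewrite mres_scale (sec_res _ _ yx').
have xx'f : spec_le (f x) (f x').
  exact: continuous_spec_le (@fmap_continuous _ _ _ f) xx'.
by rewrite -(fsharp_res xx' xx'f) (res_comp _ _ yx').
Qed.

Let scaleA a b s : push_scale a (push_scale b s) = push_scale (a * b) s.
Proof. by apply: sections_ext => x h /=; rewrite scalerA !rmorphM. Qed.
Let scale1 : left_id 1 push_scale.
Proof. by move=> s; apply: sections_ext => x h /=; rewrite !rmorph1 scale1r. Qed.
Let scaleDr : right_distributive push_scale +%R.
Proof. by move=> a s t; apply: sections_ext => x h /=; rewrite scalerDr. Qed.
Let scaleDl s : {morph push_scale^~ s : a b / a + b}.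
Proof. by move=> a b; apply: sections_ext => x h /=; rewrite !rmorphD scalerDl. Qed.

HB.instance Definition _ := GRing.Zmodule_isLmodule.Build (stalk y) push_stalk
  scaleA scale1 scaleDr scaleDl.

End PushStalk.

Section Pushforward.
Variables (k : comPzRingType) (X Y : ringed_fspace k) (f : fmorphism X Y).

Section Module.
Variable M : omod X.

Program Definition push_res_fun (y y' : Y) (h : spec_le y y')
    (s : push_stalk f M y) : push_stalk f M y' :=
  @Sections k X M (f @^-1` (minopen y'))
    (fun x y'x => s x (spec_le_trans h y'x)) _.
Next Obligation. by move=> *; apply: sec_res. Qed.

Lemma push_res_additive (y y' : Y) (h : spec_le y y') :
  zmod_morphism (push_res_fun h).
Proof. by move=> s t; apply: sections_ext. Qed.

HB.instance Definition _ (y y' : Y) (h : spec_le y y') :=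
  GRing.isZmodMorphism.Build (push_stalk f M y) (push_stalk f M y')
    (push_res_fun h) (push_res_additive h).

Definition push_res (y y' : Y) (h : spec_le y y') :
  {additive push_stalk f M y -> push_stalk f M y'} := push_res_fun h.

Lemma push_res_scale (y y' : Y) (h : spec_le y y') b (s : push_stalk f M y) :
  push_res h (b *: s) = res h b *: push_res h s.
Proof.
apply: sections_ext => x y'x /=.
by rewrite (res_comp _ _ (spec_le_trans h y'x)).
Qed.

Lemma push_res_id (y : Y) (h : spec_le y y) s : push_res h s = s.
Proof.
apply: sections_ext => x yx /=; congr (sec s _); exact: Prop_irrelevance.
Qed.

Lemma push_res_comp (y1 y2 y3 : Y) (h12 : spec_le y1 y2) (h23 : spec_le y2 y3)
  (h13 : spec_le y1 y3) s : push_res h23 (push_res h12 s) = push_res h13 s.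
Proof.
apply: sections_ext => x yx /=; congr (sec s _); exact: Prop_irrelevance.
Qed.

Definition push : omod Y := Omod push_res_scale push_res_id push_res_comp.

End Module.

Section Morphism.
Variables (M N : omod X) (u : mhom M N).

Program Definition push_hom_fun (y : Y) (s : push M y) : push N y :=
  @Sections k X N (f @^-1` (minopen y)) (fun x yx => u x (sec s yx)) _.
Next Obligation. by move=> y s x x' yx yx' h; rewrite -mmap_res (sec_res _ _ yx'). Qed.

Lemma push_hom_linear (y : Y) : linear (@push_hom_fun y).
Proof. by move=> b s t; apply: sections_ext => x yx /=; rewrite linearP. Qed.

HB.instance Definition _ (y : Y) :=
  GRing.isLinear.Build _ _ _ _ (@push_hom_fun y) (@push_hom_linear y).

Definition push_hom_map (y : Y) : {linear push M y -> push N y} :=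
  @push_hom_fun y.

Lemma push_hom_res (y y' : Y) (h : spec_le y y') s :
  push_hom_map y' (mres (push M) h s) = mres (push N) h (push_hom_map y s).
Proof. exact: sections_ext. Qed.

Definition push_hom : mhom (push M) (push N) := Mhom push_hom_res.

End Morphism.
End Pushforward.

(* [ker v / im u] for [C -u-> D -v-> E]. The condition [v \o u = 0] is not
   recorded: in general this is [ker v / (ker v :&: im u)]. *)
Section Homology.
Variables (R : comPzRingType) (C D E : lmodType R).
Variables (u : {linear C -> D}) (v : {linear D -> E}).

Record cycle := Cycle { cval :> D; cvalP : v cval = 0 }.

Lemma cycle_ext (z w : cycle) : z = w :> D -> z = w.
Proof.
case: z w => [z hz] [w hw] /= zw; move: hz hw; rewrite zw => hz hw.
by rewrite (Prop_irrelevance hz hw).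
Qed.

HB.instance Definition _ := gen_eqMixin cycle.
HB.instance Definition _ := gen_choiceMixin cycle.

Program Definition cyc_zero := @Cycle 0 _.
Next Obligation. by rewrite raddf0. Qed.
Program Definition cyc_add (z w : cycle) := @Cycle (cval z + cval w) _.
Next Obligation. by move=> z w; rewrite linearD /= !cvalP addr0. Qed.
Program Definition cyc_opp (z : cycle) := @Cycle (- cval z) _.
Next Obligation. by move=> z; rewrite linearN /= cvalP oppr0. Qed.
Program Definition cyc_scale (a : R) (z : cycle) := @Cycle (a *: cval z) _.
Next Obligation. by move=> a z; rewrite linearZ /= cvalP scaler0. Qed.

Definition hom_rel (z w : cycle) : bool := `[< exists c, u c = cval z - cval w >].

Lemma hom_rel_equiv : equiv_class_of hom_rel.
Proof.
split.
- by move=> z; apply/asboolP; exists 0; rewrite raddf0 subrr.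
- by move=> z w; apply/asboolP/asboolP => -[c hc];
    exists (- c); rewrite linearN /= hc opprB.
- move=> w z t /asboolP[c hc] /asboolP[d hd]; apply/asboolP; exists (c + d).
  by rewrite linearD /= hc hd addrA subrK.
Qed.

Canonical hom_equiv := EquivRelPack hom_rel_equiv.

Definition homology := {eq_quot hom_equiv}.

HB.instance Definition _ := Choice.on homology.
HB.instance Definition _ := EqQuotient.on homology.

Definition hclass (z : cycle) : homology := \pi_homology z.

Lemma hclassP (z w : cycle) :
  hclass z = hclass w <-> exists c, u c = cval z - cval w.
Proof. by split=> [/eqmodP/asboolP|?]; last exact/eqmodP/asboolP. Qed.

Lemma hclass_repr (x : homology) : hclass (repr x) = x.
Proof. exact: reprK. Qed.

Definition hom_zero : homology := hclass cyc_zero.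
Definition hom_add (x y : homology) : homology := hclass (cyc_add (repr x) (repr y)).
Definition hom_opp (x : homology) : homology := hclass (cyc_opp (repr x)).
Definition hom_scale (a : R) (x : homology) : homology :=
  hclass (cyc_scale a (repr x)).

Lemma hclassD z w : hom_add (hclass z) (hclass w) = hclass (cyc_add z w).
Proof.
have /hclassP[c hc] := hclass_repr (hclass z).
have /hclassP[d hd] := hclass_repr (hclass w).
by apply/hclassP; exists (c + d); rewrite linearD /= hc hd /= opprD addrACA.
Qed.

Lemma hclassN z : hom_opp (hclass z) = hclass (cyc_opp z).
Proof.
have /hclassP[c hc] := hclass_repr (hclass z).
by apply/hclassP; exists (- c); rewrite linearN /= hc /= opprD.
Qed.

Lemma hclassZ a z : hom_scale a (hclass z) = hclass (cyc_scale a z).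
Proof.
have /hclassP[c hc] := hclass_repr (hclass z).
by apply/hclassP; exists (a *: c); rewrite linearZ /= hc /= scalerBr.
Qed.

Lemma homologyW (P : homology -> Prop) : (forall z, P (hclass z)) -> forall x, P x.
Proof. by move=> h x; rewrite -(hclass_repr x). Qed.

Let addA : associative hom_add.
Proof.
elim/homologyW=> x; elim/homologyW=> y; elim/homologyW=> z.
by rewrite !hclassD; congr hclass; apply: cycle_ext; rewrite /= addrA.
Qed.
Let addC : commutative hom_add.
Proof.
elim/homologyW=> x; elim/homologyW=> y.
by rewrite !hclassD; congr hclass; apply: cycle_ext; rewrite /= addrC.
Qed.
Let add0 : left_id hom_zero hom_add.
Proof.
elim/homologyW=> x.
by rewrite hclassD; congr hclass; apply: cycle_ext; rewrite /= add0r.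
Qed.
Let addN : left_inverse hom_zero hom_opp hom_add.
Proof.
elim/homologyW=> x.
by rewrite hclassN hclassD; congr hclass; apply: cycle_ext; rewrite /= addNr.
Qed.

HB.instance Definition _ := GRing.isZmodule.Build homology addA addC add0 addN.

Let scaleA a b x : hom_scale a (hom_scale b x) = hom_scale (a * b) x.
Proof.
elim/homologyW: x => x.
by rewrite !hclassZ; congr hclass; apply: cycle_ext; rewrite /= scalerA.
Qed.
Let scale1 : left_id 1 hom_scale.
Proof.
elim/homologyW=> x.
by rewrite hclassZ; congr hclass; apply: cycle_ext; rewrite /= scale1r.
Qed.
Let scaleDr : right_distributive hom_scale +%R.
Proof.
move=> a; elim/homologyW=> x; elim/homologyW=> y.
rewrite [_ + _]hclassD !hclassZ [RHS]hclassD.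
by congr hclass; apply: cycle_ext; rewrite /= scalerDr.
Qed.
Let scaleDl x : {morph hom_scale^~ x : a b / a + b}.
Proof.
elim/homologyW: x => x a b; rewrite !hclassZ [RHS]hclassD.
by congr hclass; apply: cycle_ext; rewrite /= scalerDl.
Qed.

HB.instance Definition _ := GRing.Zmodule_isLmodule.Build R homology
  scaleA scale1 scaleDr scaleDl.

End Homology.

Section Cohomology.
Variables (k : comPzRingType) (X : ringed_fspace k) (C D E : omod X).
Variables (u : mhom C D) (v : mhom D E).

Definition coh_stalk (p : X) : lmodType (stalk p) := homology (u p) (v p).

Program Definition cycle_res (p q : X) (h : spec_le p q) (z : cycle (v p)) :
  cycle (v q) := @Cycle _ _ _ (v q) (mres D h (cval z)) _.
Next Obligation. by move=> p q h z; rewrite mmap_res cvalP raddf0. Qed.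

Definition coh_res_fun (p q : X) (h : spec_le p q) (x : homology (u p) (v p)) :
  homology (u q) (v q) := hclass (u q) (cycle_res h (repr x)).

Lemma coh_res_class (p q : X) (h : spec_le p q) (z : cycle (v p)) :
  coh_res_fun h (hclass (u p) z) = hclass (u q) (cycle_res h z).
Proof.
have /hclassP[c hc] := hclass_repr (hclass (u p) z).
by apply/hclassP; exists (mres C h c); rewrite mmap_res hc raddfB.
Qed.

Lemma coh_res_additive (p q : X) (h : spec_le p q) :
  zmod_morphism (coh_res_fun h).
Proof.
elim/homologyW=> x; elim/homologyW=> y.
rewrite [- hclass _ y]hclassN [_ + _]hclassD !coh_res_class.
rewrite [- _]hclassN [RHS]hclassD.
by congr hclass; apply: cycle_ext; rewrite /= raddfB.
Qed.

HB.instance Definition _ (p q : X) (h : spec_le p q) :=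
  GRing.isZmodMorphism.Build _ _ (coh_res_fun h) (coh_res_additive h).

Definition coh_res (p q : X) (h : spec_le p q) :
  {additive coh_stalk p -> coh_stalk q} := coh_res_fun h.

Lemma coh_res_scale (p q : X) (h : spec_le p q) a (x : coh_stalk p) :
  coh_res h (a *: x) = res h a *: coh_res h x.
Proof.
elim/homologyW: x => x.
rewrite [_ *: _]hclassZ /= !coh_res_class [RHS]hclassZ.
by congr hclass; apply: cycle_ext; rewrite /= mres_scale.
Qed.

Lemma coh_res_id (p : X) (h : spec_le p p) x : coh_res h x = x.
Proof.
elim/homologyW: x => x; rewrite /= coh_res_class.
by congr hclass; apply: cycle_ext; rewrite /= mres_id.
Qed.

Lemma coh_res_comp (p q r : X) (hpq : spec_le p q) (hqr : spec_le q r)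
  (hpr : spec_le p r) x : coh_res hqr (coh_res hpq x) = coh_res hpr x.
Proof.
elim/homologyW: x => x; rewrite /= !coh_res_class.
by congr hclass; apply: cycle_ext; rewrite /= (mres_comp _ _ hpr).
Qed.

Definition cohomology : omod X := Omod coh_res_scale coh_res_id coh_res_comp.

End Cohomology.

Section DerivedPushforward.
Variable k : comPzRingType.

Program Definition zero_hom (X : ringed_fspace k) (M N : omod X) : mhom M N :=
  @Mhom k X M N (fun p => \0%R) _.
Next Obligation. by move=> *; rewrite raddf0. Qed.

Definition injective_omod (X : ringed_fspace k) (J : omod X) : Prop :=
  forall (A B : omod X) (i : mhom A B) (g : mhom A J),
    (forall p, injective (i p)) ->
    exists h : mhom B J, forall p a, h p (i p a) = g p a.

Record injective_resolution (X : ringed_fspace k) (M : omod X) := InjRes {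
  ires :> nat -> omod X;
  idiff : forall n, mhom (ires n) (ires n.+1);
  iaug : mhom M (ires 0);
  ires_injective : forall n, injective_omod (ires n);
  iaug_injective : forall p, injective (iaug p);
  iaug_exact : forall p x, idiff 0 p x = 0 <-> exists m, iaug p m = x;
  idiff_exact : forall n p x,
    idiff n.+1 p x = 0 <-> exists y, idiff n p y = x
}.

Variables (X Y : ringed_fspace k) (f : fmorphism X Y).

(* [R^i f_* M = H^i (f_* J)] for an injective resolution [M -> J]. *)
Definition higher_direct_image (M : omod X) (J : injective_resolution M)
    (i : nat) : omod Y :=
  match i with
  | 0 => cohomology (zero_hom (push f (J 0)) (push f (J 0)))
                    (push_hom f (idiff J 0))
  | j.+1 => cohomology (push_hom f (idiff J j)) (push_hom f (idiff J j.+1))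
  end.

(* The module [R^i f_* M] is determined by [M] up to isomorphism, so its
   properties are expressed on all injective resolutions of [M] (there are
   enough injective modules on a ringed space). *)
Definition derived_push_qc (M : omod X) : Prop :=
  forall (J : injective_resolution M) (i : nat),
    quasi_coherent (higher_direct_image J i).

End DerivedPushforward.

Definition schematic (k : comPzRingType) (X Y : ringed_fspace k)
    (f : fmorphism X Y) : Prop :=
  derived_push_qc (graph f) (structure_sheaf X).

(* Main.v *)
(* On a finite space all restrictions are flat, so the cohomology sheaves of a
   complex of modules [K] are all quasi-coherent iff every
   [O_y' (x)_(O_y) K_y -> K_y'] with [y <= y'] is a quasi-isomorphism, that is,
   has an acyclic cone. [R f_*] is computed by a functorial Godement resolution
   [gr M] of finite length, which a Mayer-Vietoris argument compares with any
   injective resolution.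

   For [V' <= V <= U_x] and [R -> R'] flat, the cone [T M] of
   [R' (x)_R Gamma(V, gr M) -> Gamma(V', gr M)] is an exact functor of [M]
   vanishing in high degrees. If [T O] is acyclic then so is [T O^(I)], and
   descending induction along free presentations over [U_x] shows that [T M] is
   acyclic for every quasi-coherent [M]. Taking [V = U_x :&: f^-1 U_y] and
   [R = O_x (x)_k O_y] gives the statement on the graph, since [f] is schematic.
   When only [y] varies, [R -> R'] is the base change of [O_y -> O_y'], so the
   cone over [O_y] is acyclic on each [U_x :&: f^-1 U_y]; Mayer-Vietoris over the
   open subsets of [X] extends this to [f^-1 U_y], which is the statement on
   [f]. *)
From HB Require Import structures.
From mathcomp Require Import all_boot all_order all_algebra.
From mathcomp Require Import boolp classical_sets functions cardinality topology.
Require Import Defs.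

Set Implicit Arguments.
Unset Strict Implicit.
Unset Printing Implicit Defensive.

Import Order.TTheory GRing.Theory Num.Theory.
Local Open Scope classical_set_scope.
Local Open Scope ring_scope.

(** * Base change along a ring morphism *)

(** All arguments are chases with elements of complexes, without spectral sequences or derived
    categories. Four obstacles shape them. Quasi-coherence of [R^i f_*] is a condition on every
    injective resolution, so a hypothesis of this kind yields information only once such a
    resolution has been built. Injective resolutions are not functorial on the nose, while an
    induction along presentations calls for an exact functor into complexes; the Godement resolution
    is one, and a single chain map relates it to an injective one. The spaces may fail to be T0: in
    a product over all points, equivalent points would stay alive in every degree and the resolution
    would not be finite, hence products over one representative per class. Presentations live on
    some [U_x] and have infinite rank. In general [f^-1 U_y] lies in no [U_x], whereas inverse
    images of minimal open sets under the graph do. Infinite direct sums are treated by truncation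
    to finitely many coordinates, since a section over a finite space involves only finitely
    many. *)

Lemma lin_factor (R : comPzRingType) (B C D : lmodType R)
    (p : {linear B -> C}) (g : {linear B -> D}) :
  (forall c, exists b, p b = c) -> (forall b, p b = 0 -> g b = 0) ->
  exists h : {linear C -> D}, forall b, h (p b) = g b.
Proof.
move=> /choice[s ps] pg.
have E b : g (s (p b)) = g b.
  by apply/subr0_eq; rewrite -raddfB; apply: pg; rewrite raddfB /= ps subrr.
have lin : linear (g \o s).
  move=> a c c' /=; rewrite -linearP; apply/subr0_eq; rewrite -raddfB.
  by apply: pg; rewrite raddfB /= linearP /= !ps subrr.
exists (HB.pack_for {linear C -> D} (g \o s)
  (GRing.isLinear.Build _ _ _ _ _ lin)) => b /=.
exact: E.
Qed.

Section BaseChange.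
Variables (A B : comPzRingType) (phi : {rmorphism A -> B}).

Section Module.
Variable N : lmodType A.

Definition bc : Type :=
  tensor (fun a b => phi a * b) (fun a (n : N) => a *: n).

HB.instance Definition _ := GRing.Zmodule.on bc.

Definition bcp (b : B) (n : N) : bc := pure _ _ b n.

Local Notation bal f :=
  (balanced (fun a b => phi a * b) (fun a (n : N) => a *: n) f).

Lemma bal_bcp : bal bcp. Proof. exact: balanced_pure. Qed.

Lemma bcpDl b b' n : bcp (b + b') n = bcp b n + bcp b' n.
Proof. by case: bal_bcp. Qed.
Lemma bcpDr b n n' : bcp b (n + n') = bcp b n + bcp b n'.
Proof. by case: bal_bcp. Qed.
Lemma bcpZ a b n : bcp (phi a * b) n = bcp b (a *: n).
Proof. by case: bal_bcp. Qed.
Lemma bcp0 b : bcp b 0 = 0.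
Proof. by apply: (addrI (bcp b 0)); rewrite -bcpDr !addr0. Qed.

Lemma bc_ind (P : bc -> Prop) : P 0 -> (forall x y, P x -> P y -> P (x + y)) ->
  (forall b n, P (bcp b n)) -> forall x, P x.
Proof.
move=> P0 PD Pp x; rewrite (tensorE x).
by elim: (repr x) => [|z s IHs]; rewrite ?big_nil // big_cons; apply: PD.
Qed.

Lemma bc_lift (P : zmodType) (f : B -> N -> P) : bal f ->
  exists h : {additive bc -> P}, forall b n, h (bcp b n) = f b n.
Proof.
move=> hf; have add : zmod_morphism (tlift f : bc -> P).
  by move=> x y; rewrite tliftD // tliftN.
exists (HB.pack_for {additive bc -> P} (tlift f : bc -> P)
  (GRing.isZmodMorphism.Build _ _ _ add)) => b n /=.
exact: tlift_pure.
Qed.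

Definition bc_scale (c : B) (x : bc) : bc := tlift (fun b n => bcp (c * b) n) x.

Lemma bal_scale c : bal (fun b n => bcp (c * b) n).
Proof.
split=> *; rewrite ?mulrDr ?bcpDl ?bcpDr //.
by rewrite mulrCA bcpZ.
Qed.

Lemma bc_scale_pure c b n : bc_scale c (bcp b n) = bcp (c * b) n.
Proof. exact/tlift_pure/bal_scale. Qed.

Lemma bc_scaleD c x y : bc_scale c (x + y) = bc_scale c x + bc_scale c y.
Proof. exact/tliftD/bal_scale. Qed.

Lemma bc_scale0 c : bc_scale c 0 = 0.
Proof. exact/tlift0/bal_scale. Qed.

Let scaleA a b x : bc_scale a (bc_scale b x) = bc_scale (a * b) x.
Proof.
elim/bc_ind: x => [|x y hx hy|c n]; first by rewrite !bc_scale0.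
  by rewrite !bc_scaleD hx hy.
by rewrite !bc_scale_pure mulrA.
Qed.
Let scale1 : left_id 1 bc_scale.
Proof.
elim/bc_ind => [|x y hx hy|c n]; first by rewrite !bc_scale0.
  by rewrite !bc_scaleD hx hy.
by rewrite !bc_scale_pure mul1r.
Qed.
Let scaleDr : right_distributive bc_scale +%R.
Proof. exact: bc_scaleD. Qed.
Let scaleDl x : {morph bc_scale^~ x : a b / a + b}.
Proof.
move=> a b; elim/bc_ind: x => [|x y hx hy|c n]; first by rewrite !bc_scale0 addr0.
  by rewrite !bc_scaleD hx hy addrACA.
by rewrite !bc_scale_pure mulrDl bcpDl.
Qed.

HB.instance Definition _ := GRing.Zmodule_isLmodule.Build B bc
  scaleA scale1 scaleDr scaleDl.

Lemma bcpZl c b n : c *: bcp b n = bcp (c * b) n.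
Proof. exact: bc_scale_pure. Qed.

End Module.

Section Map.
Variables (N N' : lmodType A) (u : {linear N -> N'}).

Definition bcm (x : bc N) : bc N' := tlift (fun b n => bcp b (u n)) x.

Lemma bal_bcm :
  balanced (fun a b => phi a * b) (fun a (n : N) => a *: n)
    (fun b n => bcp b (u n)).
Proof.
split=> *; rewrite ?bcpDl ?raddfD ?bcpDr //.
by rewrite linearZ /= -bcpZ.
Qed.

Lemma bcm_pure b n : bcm (bcp b n) = bcp b (u n).
Proof. exact/tlift_pure/bal_bcm. Qed.

Lemma bcmD x y : bcm (x + y) = bcm x + bcm y.
Proof. exact/tliftD/bal_bcm. Qed.

Lemma bcm0 : bcm 0 = 0.
Proof. exact/tlift0/bal_bcm. Qed.

Lemma bcm_linear : linear bcm.
Proof.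
move=> a x y; rewrite bcmD; congr (_ + _).
elim/bc_ind: x => [|x x' hx hx'|c n].
- by rewrite scaler0 bcm0 scaler0.
- by rewrite scalerDr !bcmD hx hx' scalerDr.
- by rewrite bcpZl !bcm_pure bcpZl.
Qed.

HB.instance Definition _ := GRing.isLinear.Build _ _ _ _ bcm bcm_linear.

End Map.

Section Ext.
Variables (N : lmodType A) (P : lmodType B) (g : {additive N -> P}).
Hypothesis gZ : forall a n, g (a *: n) = phi a *: g n.

Lemma bc_ext : exists h : {linear bc N -> P}, forall b n, h (bcp b n) = b *: g n.
Proof.
have [h hp] : exists h : {additive bc N -> P}, forall b n, h (bcp b n) = b *: g n.
  apply: bc_lift; split=> [b b' n|b n n'|a b n].
  - by rewrite scalerDl.
  - by rewrite raddfD scalerDr.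
  - by rewrite gZ scalerA mulrC.
have hZ a (x : bc N) : h (a *: x) = a *: h x.
  elim/bc_ind: x => [|x x' hx hx'|c n].
  - by rewrite scaler0 raddf0 scaler0.
  - by rewrite scalerDr !raddfD /= hx hx'.
  - by rewrite bcpZl !hp scalerA.
have lin : linear h by move=> a x y; rewrite raddfD /= hZ.
by exists (HB.pack_for {linear bc N -> P} (h : bc N -> P)
  (GRing.isLinear.Build _ _ _ _ _ lin)).
Qed.

End Ext.

Lemma bcm_comp (N1 N2 N3 : lmodType A) (u : {linear N1 -> N2})
    (v : {linear N2 -> N3}) (w : {linear N1 -> N3}) :
  (forall n, w n = v (u n)) -> forall x, bcm w x = bcm v (bcm u x).
Proof.
move=> h; elim/bc_ind => [|x y hx hy|b n]; rewrite ?raddf0 ?raddfD /= ?hx ?hy //.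
by rewrite !bcm_pure h.
Qed.

Lemma bcm_add (N1 N2 : lmodType A) (u v w : {linear N1 -> N2}) :
  (forall n, w n = u n + v n) -> forall x, bcm w x = bcm u x + bcm v x.
Proof.
move=> h; elim/bc_ind => [|x y hx hy|b n]; rewrite ?raddf0 ?raddfD /= ?addr0 //.
  by rewrite hx hy addrACA.
by rewrite !bcm_pure h bcpDr.
Qed.

Lemma bcm_id (N : lmodType A) (u : {linear N -> N}) :
  (forall n, u n = n) -> forall x, bcm u x = x.
Proof.
move=> h; elim/bc_ind => [|x y hx hy|b n]; rewrite ?raddf0 ?raddfD /= ?hx ?hy //.
by rewrite bcm_pure h.
Qed.

Lemma bcm_zero (N1 N2 : lmodType A) (w : {linear N1 -> N2}) :
  (forall n, w n = 0) -> forall x, bcm w x = 0.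
Proof.
move=> h; elim/bc_ind => [|x y hx hy|b n]; rewrite ?raddf0 ?raddfD /= ?hx ?hy ?addr0 //.
by rewrite bcm_pure h bcp0.
Qed.

Lemma bcm_surj (N1 N2 : lmodType A) (u : {linear N1 -> N2}) :
  (forall y, exists x, u x = y) -> forall y, exists x, bcm u x = y.
Proof.
move=> hu; elim/bc_ind => [|_ _ [x <-] [y <-]|b n]; first by exists 0; rewrite raddf0.
  by exists (x + y); rewrite raddfD.
by have [m <-] := hu n; exists (bcp b m); rewrite bcm_pure.
Qed.

End BaseChange.

Arguments bcm {A B} phi {N N'} u x.
Arguments bcp {A B} phi {N} b n.

(** * Cokernels and exactness of base change *)

Section Cokernel.
Variables (R : comPzRingType) (C D : lmodType R) (u : {linear C -> D}).

Definition coker : lmodType R := homology u (\0%R : {linear D -> D}).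

Definition coker_cycle (d : D) : Defs.cycle (\0%R : {linear D -> D}) :=
  @Defs.Cycle R D D \0%R d erefl.

Definition coker_fun (d : D) : coker := hclass u (coker_cycle d).

Lemma coker_linear : linear coker_fun.
Proof.
move=> a d d'; rewrite [a *: coker_fun d]hclassZ [RHS]hclassD.
by congr hclass; apply: cycle_ext.
Qed.

HB.instance Definition _ := GRing.isLinear.Build _ _ _ _ coker_fun coker_linear.

Definition coker_map : {linear D -> coker} := coker_fun.

Lemma coker_map_surj (x : coker) : exists d, coker_map d = x.
Proof.
elim/homologyW: x => z; exists (cval z).
by congr hclass; apply: cycle_ext.
Qed.

Lemma coker_map_eq0 d : coker_map d = 0 <-> exists c, u c = d.
Proof.
split=> [/hclassP[c hc]|[c hc]]; first by exists c; rewrite hc /= subr0.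
by apply/hclassP; exists c; rewrite hc /= subr0.
Qed.

End Cokernel.

Section Exactness.
Variables (A B : comPzRingType) (phi : {rmorphism A -> B}).

(** An inverse of [coker (B (x) u) -> B (x) Q] is built on pure tensors by lifting along [p]: two
    lifts differ by some [u c], whose pure tensors die in the cokernel. *)
Lemma bc_right_exact (C D Q : lmodType A) (u : {linear C -> D})
    (p : {linear D -> Q}) :
  (forall q, exists d, p d = q) -> (forall d, p d = 0 -> exists c, u c = d) ->
  forall z : bc phi D, bcm phi p z = 0 -> exists w, bcm phi u w = z.
Proof.
move=> /choice[s ps] pu z.
pose cl : {linear bc phi D -> coker (bcm phi u)} := coker_map (bcm phi u).
have clE b d d' : p d = p d' -> cl (bcp phi b d) = cl (bcp phi b d').
  move=> dd'; have /pu[c uc] : p (d - d') = 0 by rewrite raddfB /= dd' subrr.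
  have -> : d = d' + u c by rewrite uc addrC subrK.
  rewrite bcpDr raddfD /= -[RHS]addr0; congr (_ + _).
  by apply/coker_map_eq0; exists (bcp phi b c); rewrite /= bcm_pure.
have [h hE] : exists h : {additive bc phi Q -> coker (bcm phi u)},
    forall b q, h (bcp phi b q) = cl (bcp phi b (s q)).
  apply: bc_lift; split=> [b b' q|b q q'|a b q].
  - by rewrite bcpDl raddfD.
  - by rewrite -raddfD -bcpDr; apply: clE; rewrite raddfD /= !ps.
  - by rewrite bcpZ; apply: clE; rewrite linearZ /= !ps.
have hz : forall x, h (bcm phi p x) = cl x.
  move=> x; elim/bc_ind: x => [|x y hx hy|b d]; first by rewrite !raddf0.
    by rewrite !raddfD /= hx hy.
  by rewrite bcm_pure hE; apply: clE; rewrite ps.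
by move=> pz; apply/coker_map_eq0; rewrite -/cl -hz pz raddf0.
Qed.

Hypothesis flat_phi : flat phi.

Lemma flat_inj (N N' : lmodType A) (u : {linear N -> N'}) :
  (forall n, u n = 0 -> n = 0) -> forall z : bc phi N, bcm phi u z = 0 -> z = 0.
Proof.
move=> hu z uz; have inj : injective u.
  by move=> x y xy; apply/subr0_eq/hu; rewrite raddfB /= xy subrr.
have bci : injective (bcm phi u) := flat_phi inj.
by apply: bci; rewrite uz raddf0.
Qed.

(** The map [v] factors as [D -> coker u -> E] with injective second map. Flatness keeps that map
    injective, and right exactness gives the kernel of the first one after base change. *)
Lemma flat_exact (C D E : lmodType A) (u : {linear C -> D}) (v : {linear D -> E}) :
  (forall d, v d = 0 <-> exists c, u c = d) ->
  forall z : bc phi D, bcm phi v z = 0 -> exists w, bcm phi u w = z.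
Proof.
move=> huv z vz; apply: (bc_right_exact (p := coker_map u)).
- exact: coker_map_surj.
- by move=> d /coker_map_eq0.
have [v' v'E] : exists v' : {linear coker u -> E}, forall d, v' (coker_map u d) = v d.
  apply: lin_factor; first exact: coker_map_surj.
  by move=> d /coker_map_eq0 /huv.
have inj n : v' n = 0 -> n = 0.
  by have [d <-] := coker_map_surj n; rewrite v'E => /huv /coker_map_eq0.
by apply: (flat_inj inj); rewrite -(bcm_comp (w := v)).
Qed.

Section MayerVietoris.
Variables (MW MU MV MI : lmodType A).
Variables (a : {linear MW -> MU}) (b : {linear MW -> MV}).
Variables (c : {linear MU -> MI}) (d : {linear MV -> MI}).
Hypothesis sep : forall w, a w = 0 -> b w = 0 -> w = 0.
Hypothesis comm : forall w, c (a w) = d (b w).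
Hypothesis glue : forall x y, c x = d y -> exists w, a w = x /\ b w = y.

Let ab (w : MW) : (MU * MV)%type := (a w, b w).
Let ab_linear : linear ab.
Proof. by move=> r x y; rewrite /ab !linearP. Qed.
HB.instance Definition _ := GRing.isLinear.Build _ _ _ _ ab ab_linear.
Let cd (x : (MU * MV)%type) : MI := c x.1 - d x.2.
Let cd_linear : linear cd.
Proof.
by move=> r x y; rewrite /cd /= (linearP c) (linearP d) /= opprD addrACA scalerBr.
Qed.
HB.instance Definition _ := GRing.isLinear.Build _ _ _ _ cd cd_linear.
Let i1 (x : MU) : (MU * MV)%type := (x, 0).
Let i1_linear : linear i1.
Proof. by move=> r x y; apply/pair_equal_spec; rewrite /= scaler0 addr0. Qed.
HB.instance Definition _ := GRing.isLinear.Build _ _ _ _ i1 i1_linear.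
Let i2 (x : MV) : (MU * MV)%type := (0, x).
Let i2_linear : linear i2.
Proof. by move=> r x y; apply/pair_equal_spec; rewrite /= scaler0 addr0. Qed.
HB.instance Definition _ := GRing.isLinear.Build _ _ _ _ i2 i2_linear.

Lemma bc_sep (w : bc phi MW) : bcm phi a w = 0 -> bcm phi b w = 0 -> w = 0.
Proof.
move=> aw bw; apply: (flat_inj (u := ab)).
  by move=> x [ax bx]; apply: sep.
have -> : forall w, bcm phi ab w = bcm phi i1 (bcm phi a w) + bcm phi i2 (bcm phi b w).
  elim/bc_ind => [|x y hx hy|r m]; first by rewrite !raddf0 addr0.
    by rewrite !raddfD /= hx hy addrACA.
  rewrite !bcm_pure -bcpDr; congr (bcp _ _ _).
  by apply/pair_equal_spec; rewrite /= addr0 add0r.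
by rewrite aw bw !raddf0 addr0.
Qed.

(** Gluing is exactness of [0 -> MW -> MU x MV -> MI] with maps [ab] and [cd], which flat base
    change preserves. The injections [i1], [i2] and the two projections stand in for the splitting
    of [bc] over a product. *)
Lemma bc_glue (x : bc phi MU) (y : bc phi MV) : bcm phi c x = bcm phi d y ->
  exists w, bcm phi a w = x /\ bcm phi b w = y.
Proof.
move=> xy.
have [w hw] : exists w, bcm phi ab w = bcm phi i1 x + bcm phi i2 y.
  apply: (flat_exact (v := cd)) => [[m n]|].
    split=> [/subr0_eq /glue[w [/= aw bw]]|[w [<- <-]]]; first by exists w; rewrite /ab aw bw.
    by suff: c (a w) - d (b w) = 0 by []; rewrite comm subrr.
  have E1 : bcm phi cd (bcm phi i1 x) = bcm phi c x.
    by rewrite -(bcm_comp (w := c)) // => n; suff: c n = c n - d 0 by []; rewrite raddf0 subr0.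
  have E2 : bcm phi cd (bcm phi i2 y) + bcm phi d y = 0.
    elim/bc_ind: y {xy} => [|y y' hy hy'|r m]; first by rewrite !raddf0 addr0.
      by rewrite !raddfD /= addrACA hy hy' addr0.
    suff: bcp phi r (c 0 - d m) + bcp phi r (d m) = 0 by rewrite !bcm_pure.
    by rewrite raddf0 sub0r -bcpDr addNr; exact: bcp0.
  by rewrite raddfD /= E1 xy addrC.
have E1 w' : bcm phi a w' = bcm phi fst (bcm phi ab w') by exact: bcm_comp.
have E2 w' : bcm phi b w' = bcm phi snd (bcm phi ab w') by exact: bcm_comp.
exists w; rewrite E1 E2 hw !raddfD /=.
rewrite -(bcm_comp (w := idfun)) // -[X in _ + X](bcm_comp (w := \0%R)) //.
rewrite -[X in _ /\ X + _ = _](bcm_comp (w := \0%R)) //.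
rewrite -[X in _ /\ _ + X = _](bcm_comp (w := idfun)) //.
by rewrite !bcm_id // !bcm_zero // addr0 add0r.
Qed.

End MayerVietoris.
End Exactness.

(** * Stability of flatness under composition and pushout *)

Section Composition.
Variables (A B C : comPzRingType) (phi : {rmorphism A -> B}) (psi : {rmorphism B -> C}).
Variables (theta : {rmorphism A -> C}) (thetaE : forall a, theta a = psi (phi a)).

(** Through [G], natural in [M], the module [C (x)_A M] is a retract of [C (x)_B (B (x)_A M)], and
    injectivity is tested after this embedding. *)
Lemma flat_comp : flat phi -> flat psi -> flat theta.
Proof.
move=> fphi fpsi N N' u inj.
have mk (M : lmodType A) : exists (G : {additive bc theta M -> bc psi (bc phi M)})
    (F : {additive bc psi (bc phi M) -> bc theta M}),
    (forall c n, G (bcp theta c n) = bcp psi c (bcp phi 1 n)) /\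
    (forall x, F (G x) = x).
  have [G GE] : exists G : {additive bc theta M -> bc psi (bc phi M)},
      forall c n, G (bcp theta c n) = bcp psi c (bcp phi 1 n).
    apply: bc_lift; split=> [c c' n|c n n'|a c n].
    - by rewrite bcpDl.
    - by rewrite !bcpDr.
    - by rewrite thetaE bcpZ bcpZl bcpZ.
  have [g gE] : exists g : {additive bc phi M -> bc theta M},
      forall b n, g (bcp phi b n) = bcp theta (psi b) n.
    apply: bc_lift; split=> [b b' n|b n n'|a b n].
    - by rewrite raddfD bcpDl.
    - by rewrite bcpDr.
    - by rewrite rmorphM -thetaE bcpZ.
  have gZ b x : g (b *: x) = psi b *: g x.
    elim/bc_ind: x => [|x y hx hy|b' n]; first by rewrite !(scaler0, raddf0).
      by rewrite !(scalerDr, raddfD) /= hx hy.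
    by rewrite bcpZl !gE bcpZl rmorphM.
  have [F FE] := bc_ext gZ.
  exists G, F; split=> // x; elim/bc_ind: x => [|x y hx hy|c n].
  - by rewrite !raddf0.
  - by rewrite !raddfD /= hx hy.
  - by rewrite GE /= FE gE bcpZl rmorph1 mulr1.
have [G [F [GE FG]]] := mk N; have [G' [F' [GE' FG']]] := mk N'.
suff bci : injective (bcm theta u) by exact: bci.
suff ker0 x : bcm theta u x = 0 -> x = 0.
  by move=> x y xy; apply/subr0_eq/ker0; rewrite raddfB /= xy subrr.
move=> ux.
suff Gx : G x = 0 by rewrite -[x]FG Gx raddf0.
apply: (flat_inj fpsi (u := bcm phi u)).
  by apply: (flat_inj fphi) => n un; apply: inj; rewrite un raddf0.
have -> : bcm psi (bcm phi u) (G x) = G' (bcm theta u x); last by rewrite ux raddf0.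
elim/bc_ind: x {ux} => [|x y hx hy|c n]; first by rewrite !raddf0.
  by rewrite !raddfD /= hx hy.
by rewrite GE !bcm_pure GE' /= bcm_pure.
Qed.

End Composition.

(** An alias of [N], so that the [A]-module structure put on it does not compete with the one over
    [S]. *)
Definition rs (A S : comPzRingType) (alpha : {rmorphism A -> S})
  (N : lmodType S) : Type := N.

Section RestrictScalars.
Variables (A S : comPzRingType) (alpha : {rmorphism A -> S}) (N : lmodType S).
Local Notation rs := (rs alpha N).

HB.instance Definition _ := GRing.Zmodule.copy rs N.

Definition rs_scale (a : A) (n : rs) : rs := alpha a *: (n : N).

Let scaleA a b x : rs_scale a (rs_scale b x) = rs_scale (a * b) x.
Proof. by rewrite /rs_scale rmorphM scalerA. Qed.
Let scale1 : left_id 1 rs_scale.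
Proof. by move=> x; rewrite /rs_scale rmorph1 scale1r. Qed.
Let scaleDr : right_distributive rs_scale +%R.
Proof. by move=> a x y; rewrite /rs_scale scalerDr. Qed.
Let scaleDl x : {morph rs_scale^~ x : a b / a + b}.
Proof. by move=> a b; rewrite /rs_scale rmorphD scalerDl. Qed.

HB.instance Definition _ := GRing.Zmodule_isLmodule.Build A rs
  scaleA scale1 scaleDr scaleDl.

End RestrictScalars.

(* [T = B (x)_A S], expressed by its universal property. *)
Definition pushout_square (A B S T : comPzRingType) (phi : {rmorphism A -> B})
    (alpha : {rmorphism A -> S}) (beta : {rmorphism B -> T})
    (psi : {rmorphism S -> T}) : Prop :=
  [/\ forall a, beta (phi a) = psi (alpha a),
      forall (P : T -> Prop), (forall x y, P x -> P y -> P (x + y)) -> P 0 ->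
        (forall b s, P (beta b * psi s)) -> forall t, P t &
      forall (P : zmodType) (f : B -> S -> P),
        (forall b b' s, f (b + b') s = f b s + f b' s) ->
        (forall b s s', f b (s + s') = f b s + f b s') ->
        (forall a b s, f (phi a * b) s = f b (alpha a * s)) ->
        exists h : {additive T -> P}, forall b s, h (beta b * psi s) = f b s].

Section Pushout.
Variables (A B S T : comPzRingType) (phi : {rmorphism A -> B})
  (alpha : {rmorphism A -> S}) (beta : {rmorphism B -> T})
  (psi : {rmorphism S -> T}).
Hypothesis po : pushout_square phi alpha beta psi.

(** Associativity of the tensor product: [T (x)_S N = (B (x)_A S) (x)_S N = B (x)_A N], where [M] is
    a copy of [N] over [A]. The inverse sends the tensor of [beta b * psi s] and [n] to that of [b]
    and [s *: n]. *)
Lemma pushout_bc (M : lmodType A) (N : lmodType S) (i : {additive M -> N})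
    (j : N -> M) :
  (forall a m, i (a *: m) = alpha a *: i m) -> cancel i j -> cancel j i ->
  exists (G : {additive bc phi M -> bc psi N}) (F : {additive bc psi N -> bc phi M}),
    [/\ forall b m, G (bcp phi b m) = bcp psi (beta b) (i m),
        cancel G F & cancel F G].
Proof.
case: po => comm gen univ iZ ij ji.
have jD : forall x y, j (x + y) = j x + j y.
  by move=> x y; apply: (can_inj ij); rewrite raddfD /= !ji.
have jZ a x : j (alpha a *: x) = a *: j x.
  by apply: (can_inj ij); rewrite iZ !ji.
have [G GE] : exists G : {additive bc phi M -> bc psi N},
    forall b m, G (bcp phi b m) = bcp psi (beta b) (i m).
  apply: bc_lift; split=> [b b' n|b n n'|a b n].
  - by rewrite raddfD bcpDl.
  - by rewrite raddfD bcpDr.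
  - by rewrite rmorphM comm bcpZ iZ.
have hn n : exists h : {additive T -> bc phi M},
    forall b s, h (beta b * psi s) = bcp phi b (j (s *: n)).
  apply: univ => [b b' s|b s s'|a b s]; first by rewrite bcpDl.
    by rewrite scalerDl jD bcpDr.
  by rewrite bcpZ -jZ scalerA.
have [h hE] := choice hn.
have [F FE] : exists F : {additive bc psi N -> bc phi M},
    forall t n, F (bcp psi t n) = h n t.
  apply: bc_lift; split=> [t t' n|t n n'|s t n]; first by rewrite raddfD.
    elim/gen: t => [x y hx hy||b s]; last by rewrite !hE scalerDr jD bcpDr.
      by rewrite !raddfD /= hx hy addrACA.
    by rewrite !raddf0 addr0.
  elim/gen: t => [x y hx hy||b s']; last by rewrite mulrCA -rmorphM !hE scalerA mulrC.
    by rewrite mulrDr !raddfD /= hx hy.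
  by rewrite mulr0 !raddf0.
exists G, F; split=> //.
  move=> x; elim/bc_ind: x => [|x y hx hy|b m]; first by rewrite !raddf0.
    by rewrite !raddfD /= hx hy.
  by rewrite GE FE -[beta b]mulr1 -(rmorph1 psi) hE scale1r ij.
move=> x; elim/bc_ind: x => [|x y hx hy|t n]; first by rewrite !raddf0.
  by rewrite !raddfD /= hx hy.
rewrite FE; elim/gen: t => [x y hx hy||b s].
- by rewrite !raddfD /= hx hy bcpDl.
- by rewrite !raddf0; apply: (addrI (bcp psi 0 n)); rewrite -bcpDl !addr0.
- by rewrite hE GE ji mulrC -bcpZ mulrC.
Qed.

(** By [pushout_bc], tensoring with [T] over [S] is tensoring with [B] over [A] after restriction of
    scalars, which preserves injections. *)
Lemma flat_pushout : flat phi -> flat psi.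
Proof.
move=> fphi N N' u inj.
have mk (M : lmodType S) := @pushout_bc (rs alpha M) M idfun id
  (fun _ _ => erefl) (fun _ => erefl) (fun _ => erefl).
have [G [F [GE GF FG]]] := mk N; have [G' [F' [GE' GF' FG']]] := mk N'.
have ulin : linear (u : rs alpha N -> rs alpha N').
  by move=> a x y; rewrite linearP.
pose ru : {linear rs alpha N -> rs alpha N'} := HB.pack_for
  {linear rs alpha N -> rs alpha N'} (u : rs alpha N -> rs alpha N')
  (GRing.isLinear.Build _ _ _ _ _ ulin).
suff bci : injective (bcm psi u) by exact: bci.
suff ker0 x : bcm psi u x = 0 -> x = 0.
  by move=> x y xy; apply/subr0_eq/ker0; rewrite raddfB /= xy subrr.
move=> ux.
suff Fx : F x = 0 by rewrite -[x]FG Fx raddf0.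
apply: (flat_inj fphi (u := ru)); first by move=> n un; apply: inj; rewrite un raddf0.
have GG z : G' (bcm phi ru z) = bcm psi u (G z).
  elim/bc_ind: z => [|y z hy hz|c n]; first by rewrite !raddf0.
    by rewrite !raddfD /= hy hz.
  by rewrite GE !bcm_pure GE'.
by apply: (can_inj GF'); rewrite GG FG ux raddf0.
Qed.

End Pushout.

(** * Free modules and submodules *)

Section FreeModuleTheory.
Variables (I : Type) (R : comPzRingType).

Lemma fs_delta_subproof (i : I) :
  finite_set [set j | (if `[< j = i >] then 1 else 0 : R) != 0].
Proof.
apply: sub_finite_set (finite_set1 (i : {classic I})) => j /=.
by case: asboolP => // _; rewrite eqxx.
Qed.

Definition fs_delta (i : I) : finsupp I R := Finsupp (fs_delta_subproof i).

Lemma fs_support (f : finsupp I R) :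
  exists2 s : seq {classic I}, uniq s & forall i, f i != 0 -> (i : {classic I}) \in s.
Proof.
have /finite_seqP[s sE] := fsfin f : finite_set (_ : set {classic I}).
exists (undup s); first exact: undup_uniq.
by move=> i fi; rewrite mem_undup; have : [set` s] i by rewrite -sE.
Qed.

Lemma fs_ind (P : finsupp I R -> Prop) : P 0 ->
  (forall f g, P f -> P g -> P (f + g)) -> (forall a i, P (a *: fs_delta i)) ->
  forall f, P f.
Proof.
move=> P0 PD Pd f; have [s _ sf] := fs_support f.
elim: s f sf => [|i s IHs] f sf.
  suff -> : f = 0 by [].
  by apply: finsupp_ext => j /=; apply/eqP; apply: contraT => /sf.
have -> : f = (f - f i *: fs_delta i) + f i *: fs_delta i by rewrite subrK.
apply: PD => //; apply: IHs => j /=; case: asboolP => [->|ji].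
  by rewrite mulr1 subrr eqxx.
rewrite mulr0 subr0 => /sf; rewrite inE => /orP[/eqP //|//].
Qed.

(** The value at [f] is a sum over a chosen finite list containing the support. [SE] makes it
    independent of the list, so that linearity can be checked on one list covering two supports. *)
Lemma fs_lift (N : lmodType R) (g : I -> N) :
  exists h : {linear finsupp I R -> N}, forall i, h (fs_delta i) = g i.
Proof.
have /choice[s sP] : forall f : finsupp I R, exists s : seq {classic I},
    uniq s /\ forall i, f i != 0 -> (i : {classic I}) \in s.
  by move=> f; have [s] := fs_support f; exists s.
pose S (f : finsupp I R) (t : seq {classic I}) := \sum_(i <- t) f i *: g i.
have SE (f : finsupp I R) (t : seq {classic I}) : uniq t ->
    (forall i, f i != 0 -> (i : {classic I}) \in t) ->
    S f t = S f (s f).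
  suff h (t1 t2 : seq {classic I}) : uniq t1 -> uniq t2 -> {subset t1 <= t2} ->
      (forall i, f i != 0 -> (i : {classic I}) \in t1) -> S f t1 = S f t2.
    move=> ut ft; have [us fs] := sP f.
    pose u := undup (t ++ s f).
    transitivity (S f u).
      by apply: h; rewrite ?undup_uniq // => i it; rewrite mem_undup mem_cat it.
    symmetry; apply: h; rewrite ?undup_uniq // => i it.
    by rewrite mem_undup mem_cat it orbT.
  move=> u1 u2 t12 f1; rewrite /S.
  have pe : perm_eq t1 [seq i <- t2 | i \in t1].
    apply: uniq_perm; rewrite ?filter_uniq // => i; rewrite mem_filter.
    by case: (boolP (i \in t1)) => // /t12 ->.
  rewrite (perm_big _ pe) /= big_filter big_mkcond; apply: eq_bigr => i _; case: ifPn => // it1.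
  have /eqP -> : f i == 0 by apply: contraNT it1; exact: f1.
  by rewrite scale0r.
have lin : linear (fun f => S f (s f)).
  move=> a f f'; pose t := undup (s f ++ s f').
  have tin i : (i \in s f) || (i \in s f') -> i \in t by rewrite mem_undup mem_cat.
  have ft i : f i != 0 -> (i : {classic I}) \in t.
    by move=> fi; apply: tin; rewrite (sP f).2.
  have ft' i : f' i != 0 -> (i : {classic I}) \in t.
    by move=> fi; apply: tin; rewrite (sP f').2 ?orbT.
  rewrite -!(SE _ t) ?undup_uniq // /S.
    rewrite scaler_sumr -big_split; apply: eq_bigr => i _ /=.
    by rewrite scalerDl scalerA.
  move=> i /=; apply: contraR => it.
  have /eqP -> : f i == 0 by apply: contraNT it; exact: ft.
  have /eqP -> : f' i == 0 by apply: contraNT it; exact: ft'.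
  by rewrite mulr0 addr0.
exists (HB.pack_for {linear finsupp I R -> N} (fun f => S f (s f))
  (GRing.isLinear.Build _ _ _ _ _ lin)) => i /=.
rewrite -(SE _ [:: (i : {classic I})]) //.
  by rewrite /S big_seq1 /=; case: asboolP => // _; rewrite scale1r.
by move=> j /=; rewrite inE; case: asboolP => [->|]; rewrite eqxx.
Qed.

End FreeModuleTheory.

Lemma fs_map_delta (I : Type) (R S : comPzRingType) (phi : {rmorphism R -> S})
  (a : R) (i : I) : fs_map phi (a *: fs_delta R i) = phi a *: fs_delta S i.
Proof.
apply: finsupp_ext => j /=; rewrite rmorphM.
by case: asboolP => _; rewrite ?rmorph1 ?rmorph0.
Qed.

Record smod (R : comPzRingType) (V : lmodType R) := Smod {
  smem :> V -> Prop;
  smem0 : smem 0;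
  smemL : forall a x y, smem x -> smem y -> smem (a *: x + y)
}.

Section Submodule.
Variables (R : comPzRingType) (V : lmodType R) (S : smod V).

Record subm := Subm { smval :> V; smvalP : S smval }.

Lemma subm_ext (x y : subm) : x = y :> V -> x = y.
Proof.
case: x y => [x hx] [y hy] /= xy; move: hx hy; rewrite xy => hx hy.
by rewrite (Prop_irrelevance hx hy).
Qed.

HB.instance Definition _ := gen_eqMixin subm.
HB.instance Definition _ := gen_choiceMixin subm.

Lemma smemD x y : S x -> S y -> S (x + y).
Proof. by move=> Sx Sy; rewrite -[x]scale1r; apply: smemL. Qed.
Lemma smemZ a x : S x -> S (a *: x).
Proof. by move=> Sx; rewrite -[_ *: _]addr0; apply: smemL => //; exact: smem0. Qed.
Lemma smemN x : S x -> S (- x).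
Proof. by move=> Sx; rewrite -scaleN1r; apply: smemZ. Qed.

Definition subm_zero := Subm (smem0 S).
Definition subm_add (x y : subm) := Subm (smemD (smvalP x) (smvalP y)).
Definition subm_opp (x : subm) := Subm (smemN (smvalP x)).
Definition subm_scale a (x : subm) := Subm (smemZ a (smvalP x)).

Let addA : associative subm_add.
Proof. by move=> x y z; apply: subm_ext; rewrite /= addrA. Qed.
Let addC : commutative subm_add.
Proof. by move=> x y; apply: subm_ext; rewrite /= addrC. Qed.
Let add0 : left_id subm_zero subm_add.
Proof. by move=> x; apply: subm_ext; rewrite /= add0r. Qed.
Let addN : left_inverse subm_zero subm_opp subm_add.
Proof. by move=> x; apply: subm_ext; rewrite /= addNr. Qed.

HB.instance Definition _ := GRing.isZmodule.Build subm addA addC add0 addN.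

Let scaleA a b x : subm_scale a (subm_scale b x) = subm_scale (a * b) x.
Proof. by apply: subm_ext; rewrite /= scalerA. Qed.
Let scale1 : left_id 1 subm_scale.
Proof. by move=> x; apply: subm_ext; rewrite /= scale1r. Qed.
Let scaleDr : right_distributive subm_scale +%R.
Proof. by move=> a x y; apply: subm_ext; rewrite /= scalerDr. Qed.
Let scaleDl x : {morph subm_scale^~ x : a b / a + b}.
Proof. by move=> a b; apply: subm_ext; rewrite /= scalerDl. Qed.

HB.instance Definition _ := GRing.Zmodule_isLmodule.Build R subm
  scaleA scale1 scaleDr scaleDl.

Lemma smval_linear : linear smval. Proof. by []. Qed.
HB.instance Definition _ := GRing.isLinear.Build _ _ _ _ smval smval_linear.
Definition subm_incl : {linear subm -> V} := smval.

End Submodule.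

Section SubSheaf.
Variables (k : comPzRingType) (X : ringed_fspace k) (N : omod X).
Variable S : forall p : X, smod (N p).
Hypothesis S_res : forall (p q : X) (h : spec_le p q) x, S p x -> S q (mres N h x).

Definition subm_res_fun (p q : X) (h : spec_le p q) (x : subm (S p)) : subm (S q) :=
  Subm (S_res h (smvalP x)).

Lemma subm_res_additive (p q : X) (h : spec_le p q) : zmod_morphism (subm_res_fun h).
Proof. by move=> x y; apply: subm_ext; rewrite /= raddfB. Qed.

HB.instance Definition _ (p q : X) (h : spec_le p q) :=
  GRing.isZmodMorphism.Build _ _ (subm_res_fun h) (subm_res_additive h).

Program Definition subsheaf : omod X :=
  @Omod k X (fun p => subm (S p)) (fun p q h => subm_res_fun h) _ _ _.
Next Obligation. by move=> p q h a x; apply: subm_ext; rewrite /= mres_scale. Qed.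
Next Obligation. by move=> p h x; apply: subm_ext; rewrite /= mres_id. Qed.
Next Obligation.
by move=> p q r hpq hqr hpr x; apply: subm_ext; rewrite /= (mres_comp _ _ hpr).
Qed.

Program Definition subsheaf_incl : mhom subsheaf N :=
  @Mhom k X subsheaf N (fun p => subm_incl (S p)) _.
Next Obligation. by []. Qed.

End SubSheaf.

(** * Quasi-coherence as a base change condition *)

Section QuasiCoherence.
Variables (k : comPzRingType) (X : ringed_fspace k).

Definition bcres (M : omod X) (p q : X) (h : spec_le p q) :
    {linear bc (res h) (M p) -> M q} :=
  sval (cid (bc_ext (mres_scale (o := M) h))).

Lemma bcresE (M : omod X) (p q : X) (h : spec_le p q) b m :
  bcres M h (bcp (res h) b m) = b *: mres M h m.
Proof. exact: (svalP (cid (bc_ext (mres_scale (o := M) h)))). Qed.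

(** Bijectivity of [O_q (x)_(O_p) M_p -> M_q] is the form that quasi-coherence takes on a finite
    space. In the applications [W] is upward closed, so that [q] lies in it along with [p]. *)
Definition qc_on (W : set X) (M : omod X) : Prop :=
  forall (p q : X) (h : spec_le p q), W p ->
    (forall z, bcres M h z = 0 -> z = 0) /\ (forall m, exists z, bcres M h z = m).

Lemma free_bcres (I : Type) (p q : X) (h : spec_le p q) :
  (forall z, bcres (free_sheaf X I) h z = 0 -> z = 0) /\
  (forall m, exists z, bcres (free_sheaf X I) h z = m).
Proof.
split=> [z|].
  have [g gE] := fs_lift (N := bc (res h) (free_sheaf X I p))
    (fun i => bcp (res h) 1 (fs_delta (stalk p) i : free_sheaf X I p)).
  have gK : g (bcres (free_sheaf X I) h z) = z.
    elim/bc_ind: z => [|x y hx hy|b f]; first by rewrite !raddf0.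
      by rewrite !raddfD /= hx hy.
    rewrite bcresE linearZ /=; elim/fs_ind: f => [|f f' hf hf'|a i].
    - by rewrite !raddf0 bcp0.
    - by rewrite !raddfD /= hf hf' bcpDr.
    - by rewrite fs_map_delta linearZ /= gE -bcpZ !bcpZl mulr1 mulrC.
  by move=> z0; rewrite -gK z0 raddf0.
move=> m; elim/fs_ind: m => [|_ _ [f <-] [g <-]|a i]; first by exists 0; rewrite raddf0.
  by exists (f + g); rewrite raddfD.
exists (bcp (res h) a (1 *: fs_delta _ i)).
by rewrite bcresE [mres _ _ _]fs_map_delta rmorph1 scale1r.
Qed.

Lemma qc_on_free (W : set X) (I : Type) : qc_on W (free_sheaf X I).
Proof. by move=> p q h _; exact: free_bcres. Qed.

Lemma lhom_bcres (U : set X) (M N : omod X) (u : local_hom U M N) (p q : X)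
    (h : spec_le p q) (Up : U p) (Uq : U q) z :
  u q Uq (bcres M h z) = bcres N h (bcm (res h) (u p Up) z).
Proof.
elim/bc_ind: z => [|x y hx hy|b m]; first by rewrite !raddf0.
  by rewrite !raddfD /= hx hy.
by rewrite bcresE linearZ /= bcm_pure bcresE (lhom_res u Up Uq).
Qed.

(** The presentation at [p], tensored with [O_q], maps to the one at [q]. The maps between the free
    terms are bijective, hence so is the map between the cokernels. *)
Lemma presentation_qc (U : set X) (J I : Type) (M : omod X)
    (a : local_hom U (free_sheaf X J) (free_sheaf X I))
    (b : local_hom U (free_sheaf X I) M) :
  (forall p q, spec_le p q -> U p -> U q) ->
  (forall (q : X) (Uq : U q), (forall m : M q, exists x, b q Uq x = m) /\
     (forall x, b q Uq x = 0 <-> exists y, a q Uq y = x)) -> qc_on U M.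
Proof.
move=> up ex p q h Up; have Uq := up _ _ h Up.
have [bp_surj bp_ex] := ex p Up; have [bq_surj bq_ex] := ex q Uq.
have [inj_I surj_I] := free_bcres I h; have [_ surj_J] := free_bcres J h.
split=> [z|m].
  have [y <-] := bcm_surj bp_surj z; rewrite -(lhom_bcres b Up Uq) => /bq_ex[w].
  have [v <-] := surj_J w; rewrite (lhom_bcres a Up Uq) => avy.
  have <- : bcm (res h) (a p Up) v = y.
    by apply/subr0_eq/inj_I; rewrite raddfB /= avy subrr.
  have := bcm_comp (phi := res h) (u := a p Up) (v := b p Up) (w := \0%R) _ v.
  move=> <-; first exact: bcm_zero.
  by move=> n; symmetry; apply/bp_ex; exists n.
have [x <-] := bq_surj m; have [y <-] := surj_I x.
by exists (bcm (res h) (b p Up) y); rewrite -(lhom_bcres b Up Uq).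
Qed.

Lemma quasi_coherent_qc (M : omod X) : quasi_coherent M -> qc_on setT M.
Proof.
move=> qc p q h _; have [U [oU Up [J [I [a [b ex]]]]]] := qc p.
apply: (presentation_qc _ ex) => // x y xy; apply: xy; exact: oU.
Qed.

End QuasiCoherence.

(** * Presentations over minimal open sets *)

Section Presentation.
Variables (k : comPzRingType) (X : ringed_fspace k) (M : omod X) (p : X).

Let I : Type := M p.

Let gen_map (q : X) (h : minopen p q) : {linear free_sheaf X I q -> M q} :=
  sval (cid (fs_lift (fun m : I => mres M (h : spec_le p q) m))).

Let gen_mapE (q : X) (h : minopen p q) m : gen_map h (fs_delta _ m) = mres M h m.
Proof. exact: (svalP (cid (fs_lift (fun m : I => mres M (h : spec_le p q) m)))). Qed.

Let gen_map_res (q r : X) (hq : minopen p q) (hr : minopen p r) (h : spec_le q r) m :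
  gen_map hr (mres (free_sheaf X I) h m) = mres M h (gen_map hq m).
Proof.
elim/fs_ind: m => [|f g hf hg|a i]; first by rewrite !raddf0.
  by rewrite !raddfD /= hf hg.
rewrite [mres (free_sheaf _ _) _ _]fs_map_delta !linearZ /= !gen_mapE mres_scale.
by rewrite (mres_comp _ _ hr).
Qed.

Definition gen_hom : local_hom (minopen p) (free_sheaf X I) M := LocalHom gen_map_res.

Lemma gen_hom_surj (q : X) (h : minopen p q) :
  (forall m, exists z, bcres M h z = m) -> forall m, exists x, gen_hom q h x = m.
Proof.
move=> sur m; have [z <-] := sur m.
elim/bc_ind: z => [|z z' [x hx] [y hy]|c n]; first by exists 0; rewrite !raddf0.
  by exists (x + y); rewrite !raddfD /= hx hy.
by exists (c *: fs_delta _ n); rewrite linearZ /= gen_mapE bcresE.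
Qed.

Let J : Type := {x : free_sheaf X I p | gen_hom p (spec_le_refl (p:=p)) x = 0}.

Let rel_map (q : X) (h : minopen p q) : {linear free_sheaf X J q -> free_sheaf X I q} :=
  sval (cid (fs_lift (fun j : J => mres (free_sheaf X I) (h : spec_le p q) (sval j)))).

Let rel_mapE (q : X) (h : minopen p q) j :
  rel_map h (fs_delta _ j) = mres (free_sheaf X I) h (sval j).
Proof.
exact: (svalP (cid (fs_lift
  (fun j : J => mres (free_sheaf X I) (h : spec_le p q) (sval j))))).
Qed.

Let rel_map_res (q r : X) (hq : minopen p q) (hr : minopen p r) (h : spec_le q r) m :
  rel_map hr (mres (free_sheaf X J) h m) = mres (free_sheaf X I) h (rel_map hq m).
Proof.
elim/fs_ind: m => [|f g hf hg|a i]; first by rewrite !raddf0.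
  by rewrite !raddfD /= hf hg.
rewrite [mres (free_sheaf _ J) _ _]fs_map_delta !linearZ /= !rel_mapE.
by rewrite (mres_scale (o := free_sheaf X I)) (mres_comp _ _ hr).
Qed.

Let rel_hom : local_hom (minopen p) (free_sheaf X J) (free_sheaf X I) :=
  LocalHom rel_map_res.

(** Generators are all elements of [M p], relations all elements of the kernel at [p]. Exactness at
    [p] holds by construction; at [q] above [p] the sequence is the base change of the one at [p],
    and the tensor product is right exact. *)
Lemma gen_hom_presentation :
  (forall (q : X) (h : spec_le p q), (forall z, bcres M h z = 0 -> z = 0) /\
     (forall m, exists z, bcres M h z = m)) ->
  exists (J I : Type) (a : local_hom (minopen p) (free_sheaf X J) (free_sheaf X I))
      (b : local_hom (minopen p) (free_sheaf X I) M),
      forall (q : X) (Uq : minopen p q),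
        (forall m : M q, exists x, b q Uq x = m) /\
        (forall x, b q Uq x = 0 <-> exists y, a q Uq y = x).
Proof.
move=> qc; exists J, I, rel_hom, gen_hom => q h; split.
  exact/gen_hom_surj/(qc q h).2.
have pp : minopen p p := spec_le_refl (p:=p).
move=> x; split=> [bx|[y <-]]; last first.
  elim/fs_ind: y => [|f g hf hg|a j]; first by rewrite !raddf0.
    by rewrite !raddfD /= hf hg addr0.
  rewrite !linearZ /= rel_mapE (gen_map_res pp h) -[gen_map pp]/(gen_hom p pp).
  rewrite (Prop_irrelevance pp (spec_le_refl (p:=p))) (svalP j) raddf0.
  exact: scaler0.
have [_ surI] := free_bcres I h.
have [y xy] := surI x; rewrite -xy in bx *.
rewrite (lhom_bcres gen_hom pp h) in bx.
have {}bx := (qc q h).1 _ bx.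
have [w <-] : exists w, bcm (res h) (rel_hom p pp) w = y.
  apply: bc_right_exact bx; first exact/gen_hom_surj/(qc p pp).2.
  move=> d; rewrite (Prop_irrelevance pp (spec_le_refl (p:=p))) => d0.
  exists (fs_delta _ (exist _ d d0 : J)).
  by rewrite rel_mapE mres_id.
by exists (bcres (free_sheaf X J) h w); rewrite (lhom_bcres rel_hom pp h).
Qed.

End Presentation.

Lemma qc_quasi_coherent (k : comPzRingType) (X : ringed_fspace k) (M : omod X) :
  qc_on setT M -> quasi_coherent M.
Proof.
move=> qc p; exists (minopen p); split.
- exact/open_minopen/pts_finite.
- exact: spec_le_refl.
- by apply: gen_hom_presentation => q h; exact: qc.
Qed.

(** * Complexes, cones and Mayer-Vietoris *)

Section UnitZmodule.
Let add (_ _ : unit) := tt.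
Let opp (_ : unit) := tt.
Let addA : associative add. Proof. by []. Qed.
Let addC : commutative add. Proof. by []. Qed.
Let add0 : left_id tt add. Proof. by case. Qed.
Let addN : left_inverse tt opp add. Proof. by []. Qed.
HB.instance Definition _ := GRing.isZmodule.Build unit addA addC add0 addN.
End UnitZmodule.

Record cplx := Cplx {
  cobj :> nat -> zmodType;
  cdiff : forall n, {additive cobj n -> cobj n.+1};
  cdiffK : forall n x, cdiff n.+1 (cdiff n x) = 0
}.

Record cmap (C D : cplx) := Cmap {
  cfun :> forall n, {additive C n -> D n};
  cfun_diff : forall n x, cfun n.+1 (cdiff C n x) = cdiff D n (cfun n x)
}.

Section Boundaries.
Variable C : cplx.

(** Complexes start in degree 0, where the only boundary is zero. *)
Definition bdry (n : nat) : C n -> Prop :=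
  match n with
  | 0 => fun x => x = 0
  | m.+1 => fun x => exists y, cdiff C m y = x
  end.

Definition exact_at (n : nat) : Prop := forall x : C n, cdiff C n x = 0 -> bdry x.

Definition acyclic : Prop := forall n, exact_at n.

Lemma bdryD n (x y : C n) : bdry x -> bdry y -> bdry (x + y).
Proof.
case: n x y => [|n] x y /=; first by move=> -> ->; rewrite addr0.
by move=> [a <-] [b <-]; exists (a + b); rewrite raddfD.
Qed.

Lemma bdry0 n : @bdry n 0.
Proof. by case: n => //= n; exists 0; rewrite raddf0. Qed.

End Boundaries.

Lemma bdry_map (C D : cplx) (f : cmap C D) n (x : C n) : bdry x -> bdry (f n x).
Proof.
case: n x => [|n] x /=; first by move=> ->; rewrite raddf0.
by move=> [y <-]; exists (f n y); rewrite cfun_diff.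
Qed.

(** The hypotheses make [0 -> W -> U x V -> I -> 0] exact in each degree; the proof is the chase
    behind its long exact sequence. *)
Lemma mv_acyclic (W U V I : cplx) (a : cmap W U) (b : cmap W V)
    (c : cmap U I) (d : cmap V I) :
  (forall n x, a n x = 0 -> b n x = 0 -> x = 0) ->
  (forall n x, c n (a n x) = d n (b n x)) ->
  (forall n x y, c n x = d n y -> exists w, a n w = x /\ b n w = y) ->
  (forall n y, exists x, d n x = y) ->
  acyclic U -> acyclic V -> acyclic I -> acyclic W.
Proof.
move=> sep comm glue sur aU aV aI [|n] z dz.
  apply: sep; [apply: (aU 0%N (a _ z)) | apply: (aV 0%N (b _ z))];
    by rewrite -cfun_diff dz raddf0.
have [x xz] : bdry (a n.+1 z) by apply: aU; rewrite -cfun_diff dz raddf0.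
have [y yz] : bdry (b n.+1 z) by apply: aV; rewrite -cfun_diff dz raddf0.
(* The bounding elements [x] and [y] agree in [I] only up to a cycle. That cycle is the boundary of
   some [t], and a lift [v] of [t] along [d] corrects [y] by a coboundary without changing its
   differential. In degree 0 the cycle is already zero. *)
have [y' yz' xy] : exists2 y', cdiff V n y' = b n.+1 z & c n x = d n y'.
  have t0 : cdiff I n (c n x - d n y) = 0.
    by rewrite raddfB /= -!cfun_diff xz yz comm subrr.
  have := aI n _ t0; case: n z dz x xz y yz {t0} => [|n] z dz x xz y yz /=.
    by move=> /subr0_eq ->; exists y.
  move=> [t ht]; have [v vt] := sur n t.
  exists (y + cdiff V n v); first by rewrite raddfD /= cdiffK addr0.
  by rewrite raddfD /= cfun_diff vt ht addrC subrK.
have [w [wx wy]] := glue n x y' xy; exists w.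
apply/subr0_eq/sep; rewrite raddfB /= cfun_diff.
  by rewrite wx xz subrr.
by rewrite wy yz' subrr.
Qed.

(** In the long exact sequence, [H^n M] sits between [H^n L] and [H^(n+1) K]. The element [k]
    represents the image of [z] under the connecting map. *)
Lemma ses_exact_at (K L M : cplx) (i : cmap K L) (p : cmap L M) n :
  (forall n x, i n x = 0 -> x = 0) -> (forall n y, exists x, p n x = y) ->
  (forall n x, p n x = 0 <-> exists y, i n y = x) ->
  exact_at L n -> exact_at K n.+1 -> exact_at M n.
Proof.
move=> inj sur ex eL eK z dz; have [l lz] := sur n z.
have /ex[k hk] : p n.+1 (cdiff L n l) = 0 by rewrite cfun_diff lz dz.
have /eK[k' hk'] : cdiff K n.+1 k = 0.
  by apply: inj; rewrite cfun_diff hk cdiffK.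
have pik : p n (i n k') = 0 by apply/ex; exists k'.
rewrite -lz -[p n l]subr0 -pik -raddfB; apply: bdry_map.
by apply: eL; rewrite raddfB /= -cfun_diff hk' hk subrr.
Qed.

Section Shift.

(** Shifted copy of [B] with the zero group in degree 0. The cone built on it has [A^n] and
    [B^(n-1)] in degree [n], so that it too starts in degree 0. *)
Definition sh (B : cplx) (n : nat) : zmodType := if n is m.+1 then B m else unit.

Definition shd (B : cplx) (n : nat) : {additive sh B n -> B n} :=
  match n return {additive sh B n -> B n} with
  | 0 => \0%R
  | m.+1 => cdiff B m
  end.

Lemma shdK (B : cplx) n x : cdiff B n (shd B n x) = 0.
Proof. by case: n x => [|n] x /=; rewrite ?raddf0 // cdiffK. Qed.

Definition shm (A B : cplx) (f : cmap A B) (n : nat) : {additive sh A n -> sh B n} :=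
  match n return {additive sh A n -> sh B n} with
  | 0 => \0%R
  | m.+1 => f m
  end.

Lemma shm_shd (A B : cplx) (f : cmap A B) n x : f n (shd A n x) = shd B n (shm f n x).
Proof. by case: n x => [|n] x /=; rewrite ?raddf0 // cfun_diff. Qed.

End Shift.

Section Cone.
Variables (A B : cplx) (f : cmap A B).

Definition cone_diff n (x : (A n * sh B n)%type) : (A n.+1 * B n)%type :=
  (cdiff A n x.1, f n x.1 - shd B n x.2).

Lemma cone_diff_additive n : zmod_morphism (@cone_diff n).
Proof.
by move=> x y; apply/pair_equal_spec; rewrite /= !raddfB /= addrACA.
Qed.

HB.instance Definition _ n := GRing.isZmodMorphism.Build
  (A n * sh B n)%type (A n.+1 * B n)%type (@cone_diff n) (@cone_diff_additive n).

Program Definition cone : cplx :=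
  @Cplx (fun n => (A n * sh B n)%type) (fun n => @cone_diff n) _.
Next Obligation.
move=> n x; apply/pair_equal_spec; split; first exact: cdiffK.
by rewrite /= cfun_diff raddfB /= shdK subr0 subrr.
Qed.

End Cone.

Section ConeMap.
Variables (A B A' B' : cplx) (f : cmap A B) (f' : cmap A' B').
Variables (i : cmap A A') (j : cmap B B').
Hypothesis comm : forall n x, f' n (i n x) = j n (f n x).

Definition cone_fun n (x : cone f n) : cone f' n := (i n x.1, shm j n x.2).

Lemma cone_fun_additive n : zmod_morphism (@cone_fun n).
Proof. by move=> x y; apply/pair_equal_spec; rewrite /= !raddfB. Qed.

HB.instance Definition _ n := GRing.isZmodMorphism.Build
  (cone f n) (cone f' n) (@cone_fun n) (@cone_fun_additive n).

Program Definition cone_map : cmap (cone f) (cone f') :=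
  @Cmap (cone f) (cone f') (fun n => @cone_fun n) _.
Next Obligation.
move=> n x; apply/pair_equal_spec; split; first exact: cfun_diff.
by rewrite /= raddfB /= shm_shd -comm.
Qed.

End ConeMap.

(** The two clauses are injectivity and surjectivity of [f] on cohomology: acyclic cones are the
    working definition of quasi-isomorphism. *)
Lemma cone_acyclicP (A B : cplx) (f : cmap A B) : acyclic (cone f) <->
  (forall n x, cdiff A n x = 0 -> bdry (f n x) -> bdry x) /\
  (forall n y, cdiff B n y = 0 ->
     exists2 x, cdiff A n x = 0 & bdry (y - f n x)).
Proof.
have shdP n (y : B n) : bdry y <-> exists z, shd B n z = y.
  by case: n y => [|n] y //=; split=> [->|[z <-] //]; exists 0.
split=> [ac|[inj sur]].
  split=> [n x dx /shdP[w hw]|n y dy].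
    have : bdry (C := cone f) (n := n) (x, w).
      by apply: ac; apply/pair_equal_spec; rewrite /= dx hw subrr.
    case: n x w {dx hw} => [|n] x w /=; first by case.
    by move=> [[a b] /pair_equal_spec[<- _]]; exists a.
  have : cdiff (cone f) n.+1 (0, y) = 0.
    by apply/pair_equal_spec; rewrite /= !raddf0 dy subr0.
  move=> /ac [[x w] /pair_equal_spec[/= dx xw]]; exists x => //.
  by apply/shdP; exists (- w); rewrite -xw (raddfN (shd B n)) /= addrAC subrr sub0r.
move=> n [x w] /pair_equal_spec[/= dx /subr0_eq xw].
have : bdry x by apply: inj => //; apply/shdP; exists w.
case: n x w dx xw => [|n] /= x w dx xw; first by move=> ->; case: w {xw}.
move=> [a ax].
have : cdiff B n (f n a - w) = 0 by rewrite raddfB /= -cfun_diff ax xw subrr.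
move=> /sur[b db] /shdP[v hv]; exists (a - b, v); apply/pair_equal_spec => /=.
split; first by rewrite raddfB /= db ax subr0.
by rewrite hv raddfB /= opprB addrA subrK opprB addrC subrK.
Qed.

(** * Induction over the open subsets of a finite space *)

Section Counting.
Variable X : topologicalType.
Hypothesis finX : finite_set [set: X].

Definition points : seq X := sval (cid ((finite_seqP [set: X]).1 finX)).

Lemma mem_points x : x \in points.
Proof.
have E := svalP (cid ((finite_seqP [set: X]).1 finX)).
by have : [set: X] x by []; rewrite E.
Qed.

(** The enumeration [points] may repeat a point. This is harmless for a measure that has to grow
    strictly under strict inclusion and to be bounded by the length of the list. *)
Definition card (U : set X) : nat := count (fun x => `[< U x >]) points.

Lemma card_lt (U V : set X) x : V `<=` U -> U x -> ~ V x -> (card V < card U)%N.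
Proof.
move=> VU Ux Vx; rewrite /card.
have -> : forall s : seq X, count (fun x => `[< U x >]) s =
    (count (fun x => `[< V x >]) s + count (fun x => `[< U x /\ ~ V x >]) s)%N.
  elim=> //= y s ->; rewrite addnACA; congr (_ + _)%N.
  have := VU y; do 3![case: asboolP] => //=; tauto.
rewrite -[X in (X < _)%N]addn0 ltn_add2l -has_count; apply/hasP.
by exists x; [exact: mem_points | apply/asboolP].
Qed.

Lemma card_minopen (p q : X) :
  spec_le p q -> ~ spec_le q p -> (card (minopen q) < card (minopen p))%N.
Proof.
move=> pq qp; apply: (@card_lt _ _ p) => //.
by move=> r; exact: spec_le_trans.
Qed.

Lemma exists_minimal (W : set X) (x0 : X) : W x0 ->
  exists2 x, W x & forall p, W p -> spec_le p x -> spec_le x p.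
Proof.
move=> Wx0; apply: contrapT => no.
have step x : W x -> exists2 p, W p & (card (minopen x) < card (minopen p))%N.
  move=> Wx; apply: contrapT => nop; apply: no; exists x => // p Wp px.
  apply: contrapT => xp; apply: nop; exists p => //; exact: card_minopen.
have big n : exists2 x, W x & (n <= card (minopen x))%N.
  elim: n => [|n [x Wx nx]]; first by exists x0.
  by have [p Wp xp] := step x Wx; exists p => //; exact: leq_ltn_trans xp.
have [x _] := big (size points).+1; rewrite ltnNge => /negP; apply.
exact: count_size.
Qed.

End Counting.

(** The sheaf axioms for two open sets, together with flasqueness in the form of [prs_surj], which
    makes the Mayer-Vietoris sequences exact on the right as well. *)
Record mv_presheaf (X : topologicalType) := MVPresheaf {
  psh :> set X -> cplx;
  prs : forall U V : set X, V `<=` U -> cmap (psh U) (psh V);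
  prs_comp : forall (U V W : set X) (UV : V `<=` U) (VW : W `<=` V) (UW : W `<=` U)
    n x, prs VW n (prs UV n x) = prs UW n x;
  prs_sep : forall (U V : set X) (UW : U `<=` U `|` V) (VW : V `<=` U `|` V) n x,
    open U -> open V -> prs UW n x = 0 -> prs VW n x = 0 -> x = 0;
  prs_glue : forall (U V : set X) (IU : U `&` V `<=` U) (IV : U `&` V `<=` V)
    (UW : U `<=` U `|` V) (VW : V `<=` U `|` V) n x y, open U -> open V ->
    prs IU n x = prs IV n y -> exists w, prs UW n w = x /\ prs VW n w = y;
  prs_surj : forall (U V : set X) (UV : V `<=` U) n y, open U -> open V ->
    exists x, prs UV n x = y
}.

(** Induction on the size of [U]: a minimal point [x] splits it into [minopen x] and a remainder
    [V], and both [V] and its intersection with [minopen x] are smaller than [U]. *)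
Lemma mv_presheaf_acyclic (X : topologicalType) (finX : finite_set [set: X])
    (F : mv_presheaf X) :
  acyclic (F set0) -> (forall p, acyclic (F (minopen p))) ->
  forall U, open U -> acyclic (F U).
Proof.
move=> F0 Fp U oU; move: {2}(card finX U).+1 (ltnSn (card finX U)) => n.
elim: n U oU => // n IHn U oU cU.
have [[x0 Ux0]|] := pselect (exists x, U x); last first.
  move=> no; suff -> : U = set0 by [].
  by apply/seteqP; split => // x Ux; apply: no; exists x.
have [x Ux xmin] := exists_minimal finX Ux0.
(* All points below [x] are removed, not only [x]. By minimality they are the points of [U]
   equivalent to [x], hence lie in [minopen x], and what remains is open. *)
pose V := [set p | U p /\ ~ spec_le p x].
have oV : open V.
  apply/open_upclosed => // p q pq [Up px]; split; first exact: pq.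
  by move=> qx; apply: px; exact: spec_le_trans qx.
have VU : V `<=` U by move=> p [].
have oP := open_minopen x finX.
have PU : minopen x `<=` U by move=> p xp; apply: xp.
have cV : (card finX V < n)%N.
  apply: leq_trans (_ : (card finX V < card finX U)%N) _; last by rewrite -ltnS.
  by apply: (@card_lt _ _ _ _ x) => // -[_]; apply; exact: spec_le_refl.
have aV := IHn V oV cV.
have oI : open (minopen x `&` V) by exact: openI.
have aI : acyclic (F (minopen x `&` V)).
  apply: IHn => //; apply: leq_ltn_trans cV.
  by apply: sub_count => p /asboolP[_ Vp]; apply/asboolP.
have UE : U = minopen x `|` V.
  apply/seteqP; split=> [p Up|p [/PU //|/VU //]].
  by have [px|px] := pselect (spec_le p x); [left; apply: xmin | right].
have PW : minopen x `<=` minopen x `|` V by move=> ?; left.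
have VW : V `<=` minopen x `|` V by move=> ?; right.
have IP : minopen x `&` V `<=` minopen x by move=> ? [].
have IV : minopen x `&` V `<=` V by move=> ? [].
have IW : minopen x `&` V `<=` minopen x `|` V by move=> ? [? _]; left.
rewrite UE; apply: (@mv_acyclic _ _ _ _ (prs F PW) (prs F VW) (prs F IP) (prs F IV)).
- by move=> m z; apply: prs_sep.
- by move=> m z; rewrite !(prs_comp _ _ IW).
- by move=> m y z; apply: prs_glue.
- by move=> m y; apply: prs_surj.
- exact: Fp.
- exact: aV.
- exact: aI.
Qed.

(** * Godement modules and resolutions *)

Definition upset (X : topologicalType) (W : set X) : Prop :=
  forall p q, spec_le p q -> W p -> W q.

Section Homs.
Variables (k : comPzRingType) (X : ringed_fspace k).

Program Definition mhom_comp (A B C : omod X) (v : mhom B C) (u : mhom A B) : mhom A C :=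
  @Mhom k X A C (fun p => (v p \o u p)%FUN) _.
Next Obligation. by move=> A B C v u p q h m /=; rewrite !mmap_res. Qed.

Program Definition mhom_local (W : set X) (A B : omod X) (u : mhom A B) :
  local_hom W A B := @LocalHom k X W A B (fun p _ => u p) _.
Next Obligation. by move=> W A B u p q _ _ h m /=; rewrite mmap_res. Qed.

End Homs.

Section Godement.
Variables (k : comPzRingType) (X : ringed_fspace k) (T : set X).

Section Module.
Variable E : forall x : X, lmodType (stalk x).

(** Stalk at [p] of the product, over [r] in [T], of the skyscraper modules with value [E r] on the
    closure of [r]. [T] is the whole space for injective modules, and a set of representatives for
    the resolution of finite length. *)
Definition god_stalk (p : X) : Type := forall r : X, T r -> spec_le p r -> E r.

Section Stalk.
Variable p : X.
Local Notation G := (god_stalk p).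

Lemma god_ext (s t : G) : (forall r Tr pr, s r Tr pr = t r Tr pr) -> s = t.
Proof.
move=> st; apply: functional_extensionality_dep => r.
by apply: functional_extensionality_dep => Tr; apply: functional_extensionality_dep.
Qed.

HB.instance Definition _ := gen_eqMixin G.
HB.instance Definition _ := gen_choiceMixin G.

Let add0 (s t : G) : G := fun r Tr pr => s r Tr pr + t r Tr pr.
Let opp0 (s : G) : G := fun r Tr pr => - s r Tr pr.
Let zero0 : G := fun r Tr pr => 0.
Let scale0 (a : stalk p) (s : G) : G := fun r Tr pr => res pr a *: s r Tr pr.

Let addA : associative add0.
Proof. by move=> x y z; apply: god_ext => *; rewrite /add0 addrA. Qed.
Let addC : commutative add0.
Proof. by move=> x y; apply: god_ext => *; rewrite /add0 addrC. Qed.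
Let add0r : left_id zero0 add0.
Proof. by move=> x; apply: god_ext => *; rewrite /add0 add0r. Qed.
Let addNr : left_inverse zero0 opp0 add0.
Proof. by move=> x; apply: god_ext => *; rewrite /add0 /opp0 addNr. Qed.

HB.instance Definition _ := GRing.isZmodule.Build G addA addC add0r addNr.

Let scaleA a b x : scale0 a (scale0 b x) = scale0 (a * b) x.
Proof. by apply: god_ext => *; rewrite /scale0 scalerA rmorphM. Qed.
Let scale1 : left_id 1 scale0.
Proof. by move=> x; apply: god_ext => *; rewrite /scale0 rmorph1 scale1r. Qed.
Let scaleDr : right_distributive scale0 +%R.
Proof. by move=> a x y; apply: god_ext => *; rewrite /scale0 scalerDr. Qed.
Let scaleDl x : {morph scale0^~ x : a b / a + b}.
Proof. by move=> a b; apply: god_ext => *; rewrite /scale0 rmorphD scalerDl. Qed.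

HB.instance Definition _ := GRing.Zmodule_isLmodule.Build (stalk p) G
  scaleA scale1 scaleDr scaleDl.

End Stalk.

Definition god_res_fun (p q : X) (h : spec_le p q) (s : god_stalk p) : god_stalk q :=
  fun r Tr qr => s r Tr (spec_le_trans h qr).

Lemma god_res_additive (p q : X) (h : spec_le p q) : zmod_morphism (god_res_fun h).
Proof. by []. Qed.

HB.instance Definition _ (p q : X) (h : spec_le p q) :=
  GRing.isZmodMorphism.Build (god_stalk p) (god_stalk q)
    (god_res_fun h) (god_res_additive h).

Program Definition god : omod X :=
  @Omod k X (fun p => god_stalk p : lmodType (stalk p)) (fun p q h => god_res_fun h) _ _ _.
Next Obligation.
move=> p q h a m; apply: god_ext => r Tr pr.
by rewrite /= /god_res_fun [LHS]/GRing.scale /= [RHS]/GRing.scale /= (res_comp _ _ (spec_le_trans h pr)).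
Qed.
Next Obligation.
move=> p h m; apply: god_ext => r Tr pr; rewrite /= /god_res_fun.
by congr (m r Tr _); exact: Prop_irrelevance.
Qed.
Next Obligation.
move=> p q r hpq hqr hpr m; apply: god_ext => x Tx rx; rewrite /= /god_res_fun.
by congr (m x Tx _); exact: Prop_irrelevance.
Qed.

Lemma god_congr (p r : X) (s : god p) (Tr Tr' : T r) (pr pr' : spec_le p r) :
  s r Tr pr = s r Tr' pr'.
Proof. by rewrite (Prop_irrelevance Tr Tr') (Prop_irrelevance pr pr'). Qed.

Section Embedding.
Variables (M : omod X) (e : forall x, {linear M x -> E x}).

Definition god_emb_fun (p : X) (m : M p) : god p := fun r _ pr => e r (mres M pr m).

Lemma god_emb_linear p : linear (@god_emb_fun p).
Proof.
move=> a x y; apply: god_ext => r Tr pr; rewrite /god_emb_fun.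
by rewrite raddfD /= mres_scale linearP.
Qed.

HB.instance Definition _ p :=
  GRing.isLinear.Build _ _ _ _ (@god_emb_fun p) (@god_emb_linear p).

Program Definition god_emb : mhom M god := @Mhom k X M god (fun p => @god_emb_fun p) _.
Next Obligation.
move=> p q h m; apply: god_ext => r Tr qr.
by rewrite /= /god_res_fun /god_emb_fun (mres_comp _ _ (spec_le_trans h qr)).
Qed.

End Embedding.
End Module.

Definition godm (M : omod X) : omod X := god M.
Definition gemb (M : omod X) : mhom M (godm M) := god_emb (fun x => idfun).

Section Map.
Variables (W : set X) (Wup : upset W) (M N : omod X) (u : local_hom W M N).

Definition god_map_fun (p : X) (Wp : W p) (s : godm M p) : godm N p :=
  fun r Tr pr => u r (Wup pr Wp) (s r Tr pr).

Lemma god_map_linear p (Wp : W p) : linear (god_map_fun Wp).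
Proof. by move=> a x y; apply: god_ext => r Tr pr; rewrite /god_map_fun linearP. Qed.

HB.instance Definition _ p Wp :=
  GRing.isLinear.Build _ _ _ _ (@god_map_fun p Wp) (god_map_linear Wp).

Program Definition god_map : local_hom W (godm M) (godm N) :=
  @LocalHom k X W (godm M) (godm N) (fun p Wp => god_map_fun Wp) _.
Next Obligation.
move=> p q Wp Wq h s; apply: god_ext => r Tr qr.
by rewrite /= /god_res_fun /god_map_fun (Prop_irrelevance (Wup _ Wq) (Wup (spec_le_trans h qr) Wp)).
Qed.

Lemma god_map_emb p (Wp : W p) m : god_map p Wp (gemb M p m) = gemb N p (u p Wp m).
Proof.
by apply: god_ext => r Tr pr; rewrite /= /god_map_fun /god_emb_fun /= (lhom_res u Wp).
Qed.

End Map.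

End Godement.

Section QuotientSheaf.
Variables (k : comPzRingType) (X : ringed_fspace k) (A B : omod X) (u : mhom A B).

Definition qt : omod X := cohomology u (zero_hom B B).

Program Definition qtm : mhom B qt := @Mhom k X B qt (fun p => coker_map (u p)) _.
Next Obligation.
move=> p q h m; rewrite /= coh_res_class; congr hclass; exact: cycle_ext.
Qed.

Lemma qtm_surj p x : exists b, qtm p b = x.
Proof. exact: coker_map_surj. Qed.

Lemma qtm_eq0 p b : qtm p b = 0 <-> exists a, u p a = b.
Proof. exact: coker_map_eq0. Qed.

Lemma qt_desc (W : set X) (C : omod X) (g : local_hom W B C) :
  (forall p Wp a, g p Wp (u p a) = 0) ->
  exists h : local_hom W qt C, forall p Wp b, h p Wp (qtm p b) = g p Wp b.
Proof.
move=> gu; have F p (Wp : W p) : exists h : {linear qt p -> C p},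
    forall b, h (qtm p b) = g p Wp b.
  apply: lin_factor; first exact: qtm_surj.
  by move=> b /qtm_eq0[a <-].
pose h p Wp := sval (cid (F p Wp)).
have hE p Wp b : h p Wp (qtm p b) = g p Wp b := svalP (cid (F p Wp)) b.
have hres p q (Wp : W p) (Wq : W q) (l : spec_le p q) m :
    h q Wq (mres qt l m) = mres C l (h p Wp m).
  have [b <-] := qtm_surj m.
  by rewrite -mmap_res !hE (lhom_res g Wp).
by exists (LocalHom hres).
Qed.

End QuotientSheaf.

Section Resolution.
Variables (k : comPzRingType) (X : ringed_fspace k).
Variables (E : omod X -> omod X) (e : forall M, mhom M (E M)).
Hypothesis e_inj : forall M p m, e M p m = 0 -> m = 0.

Fixpoint syz (n : nat) (M : omod X) : omod X :=
  if n is m.+1 then qt (e (syz m M)) else M.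

Definition rdiff (M : omod X) (n : nat) : mhom (E (syz n M)) (E (syz n.+1 M)) :=
  mhom_comp (e (syz n.+1 M)) (qtm (e (syz n M))).

Lemma rdiff_eq0 M n p x : rdiff M n p x = 0 <-> exists m, e (syz n M) p m = x.
Proof.
split=> [h|h]; first by apply/qtm_eq0; apply: e_inj h.
suff qx : qtm (e (syz n M)) p x = 0.
  transitivity (e (syz n.+1 M) p (qtm (e (syz n M)) p x)); first by [].
  by rewrite qx; exact: raddf0.
exact/qtm_eq0.
Qed.

Lemma rdiff_exact M n p x : rdiff M n.+1 p x = 0 <-> exists y, rdiff M n p y = x.
Proof.
split=> [/rdiff_eq0[m <-]|[y <-]].
  by have [b <-] := qtm_surj m; exists b.
by apply/rdiff_eq0; exists (qtm (e (syz n M)) p y).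
Qed.

End Resolution.

(** * Sections and flasque modules *)

Lemma open_upset (X : topologicalType) (W : set X) : open W -> upset W.
Proof. by move=> oW p q pq; apply: pq. Qed.

Record scplx (k : comPzRingType) (X : ringed_fspace k) := Scplx {
  sobj :> nat -> omod X;
  sdiff : forall n, mhom (sobj n) (sobj n.+1);
  sdiffK : forall n p x, sdiff n.+1 p (sdiff n p x) = 0
}.

(** A ring of scalars for the sections over [V]. One notion covers [k], [O_y] and [O_x (x)_k O_y],
    whose actions on the same sections have to be compared. *)
Record action (k : comPzRingType) (X : ringed_fspace k) (V : set X)
    (R : comPzRingType) := Action {
  act :> forall p, V p -> {rmorphism R -> stalk p};
  act_res : forall p q (Vp : V p) (Vq : V q) (h : spec_le p q) a,
    res h (act Vp a) = act Vq a
}.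

Program Definition act_sub (k : comPzRingType) (X : ringed_fspace k)
    (V V' : set X) (R : comPzRingType) (a : action V R) (s : V' `<=` V) : action V' R :=
  @Action k X V' R (fun p Vp => a p (s p Vp)) _.
Next Obligation. by move=> k X V V' R a s p q Vp Vq h r; exact: act_res. Qed.

Definition asec (k : comPzRingType) (X : ringed_fspace k) (V : set X)
  (R : comPzRingType) (a : action V R) (M : omod X) : Type := sections M V.

Section ActionSections.
Variables (k : comPzRingType) (X : ringed_fspace k).

Section Module.
Variables (V : set X) (R : comPzRingType) (a : action V R) (M : omod X).
Local Notation S := (asec a M).

HB.instance Definition _ := GRing.Zmodule.copy S (sections M V).

Program Definition asec_scale (r : R) (s : S) : S :=
  @Sections k X M V (fun p Vp => a p Vp r *: s p Vp) _.
Next Obligation.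
by move=> r s p q Vp Vq h; rewrite mres_scale (act_res a Vp Vq) (sec_res _ _ Vq).
Qed.

Let scaleA x y s : asec_scale x (asec_scale y s) = asec_scale (x * y) s.
Proof. by apply: sections_ext => p Vp /=; rewrite scalerA rmorphM. Qed.
Let scale1 : left_id 1 asec_scale.
Proof. by move=> s; apply: sections_ext => p Vp /=; rewrite rmorph1 scale1r. Qed.
Let scaleDr : right_distributive asec_scale +%R.
Proof. by move=> x s t; apply: sections_ext => p Vp /=; rewrite scalerDr. Qed.
Let scaleDl s : {morph asec_scale^~ s : x y / x + y}.
Proof. by move=> x y; apply: sections_ext => p Vp /=; rewrite rmorphD scalerDl. Qed.

HB.instance Definition _ := GRing.Zmodule_isLmodule.Build R S
  scaleA scale1 scaleDr scaleDl.

End Module.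

Section Map.
Variables (W V : set X) (VW : V `<=` W) (R : comPzRingType) (a : action V R).
Variables (M N : omod X) (u : local_hom W M N).

Program Definition amap_fun (s : asec a M) : asec a N :=
  @Sections k X N V (fun p Vp => u p (VW Vp) (sec s Vp)) _.
Next Obligation.
by move=> s p q Vp Vq h; rewrite -(lhom_res u (VW Vp) (VW Vq)) (sec_res _ _ Vq).
Qed.

Lemma amap_linear : linear amap_fun.
Proof. by move=> r s t; apply: sections_ext => p Vp /=; rewrite linearP. Qed.

HB.instance Definition _ := GRing.isLinear.Build _ _ _ _ amap_fun amap_linear.
Definition amap : {linear asec a M -> asec a N} := amap_fun.

End Map.

Section Restriction.
Variables (V V' : set X) (VV : V' `<=` V) (R R' : comPzRingType).
Variables (a : action V R) (a' : action V' R') (M : omod X).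

Program Definition asr_fun (s : asec a M) : asec a' M :=
  @Sections k X M V' (fun p Vp => sec s (VV Vp)) _.
Next Obligation. by move=> s p q Vp Vq h; apply: sec_res. Qed.

Lemma asr_additive : zmod_morphism asr_fun.
Proof. by move=> s t; apply: sections_ext. Qed.

HB.instance Definition _ := GRing.isZmodMorphism.Build _ _ asr_fun asr_additive.
Definition asr : {additive asec a M -> asec a' M} := asr_fun.

Lemma asr_scale (phi : {rmorphism R -> R'}) :
  (forall p (Vp : V' p) r, a' p Vp (phi r) = a p (VV Vp) r) ->
  forall r s, asr (r *: s) = phi r *: asr s.
Proof. by move=> h r s; apply: sections_ext => p Vp /=; rewrite h. Qed.

End Restriction.

Section SubRestriction.
Variables (V V' V'' : set X) (R : comPzRingType) (a : action V R).
Variables (s' : V' `<=` V) (s'' : V'' `<=` V) (VV : V'' `<=` V') (M : omod X).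

Lemma sub_res_linear : linear (asr_fun (a := act_sub a s') VV (act_sub a s'') (M := M)).
Proof.
move=> r s t; apply: sections_ext => p Vp /=; congr (a p _ r *: _ + _).
exact: Prop_irrelevance.
Qed.

HB.instance Definition _ := GRing.isLinear.Build _ _ _ _
  (asr_fun (a := act_sub a s') VV (act_sub a s'') (M := M)) sub_res_linear.

Definition sub_res : {linear asec (act_sub a s') M -> asec (act_sub a s'') M} :=
  asr_fun (a := act_sub a s') VV (act_sub a s'') (M := M).

End SubRestriction.

Definition flasque (M : omod X) : Prop :=
  forall (U V : set X) (VU : V `<=` U), open U -> open V ->
  forall t : sections M V, exists s : sections M U,
    forall p Vp, s p (VU p Vp) = t p Vp.

Lemma sec_irr (M : omod X) (V : set X) (s : sections M V) p (h h' : V p) : s p h = s p h'.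
Proof. by rewrite (Prop_irrelevance h h'). Qed.

Section GodSections.
Variables (T : set X) (E : forall x : X, lmodType (stalk x)) (V : set X).
Hypothesis Vup : upset V.

Program Definition god_sec (t : forall r, T r -> V r -> E r) : sections (god T E) V :=
  @Sections k X (god T E) V (fun p Vp r Tr pr => t r Tr (Vup pr Vp)) _.
Next Obligation.
move=> t p q Vp Vq h; apply: god_ext => r Tr qr; rewrite /= /god_res_fun.
by congr (t r Tr _); exact: Prop_irrelevance.
Qed.

(** Compatibility with restriction reduces the component of [s p] at [r] to that of [s r] at [r]
    itself. Sections over [V] are thus families indexed by the points of [T] in [V]. *)
Lemma god_sec_ext (s t : sections (god T E) V) :
  (forall r Tr Vr, s r Vr r Tr (spec_le_refl (p:=r)) = t r Vr r Tr (spec_le_refl (p:=r))) ->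
  s = t.
Proof.
move=> st; apply: sections_ext => p Vp; apply: god_ext => r Tr pr.
have key (x : sections (god T E) V) : x p Vp r Tr pr =
    x r (Vup pr Vp) r Tr (spec_le_refl (p:=r)).
  rewrite -(sec_res x Vp (Vup pr Vp) pr) /= /god_res_fun.
  exact: god_congr.
by rewrite !key st.
Qed.

End GodSections.

(** Sections are arbitrary families, which extend by zero. *)
Lemma god_flasque (T : set X) (E : forall x : X, lmodType (stalk x)) :
  flasque (god T E).
Proof.
move=> U V VU oU oV t.
exists (god_sec (open_upset oU) (fun r Tr Ur =>
  match pselect (V r) with
  | left Vr => t r Vr r Tr (spec_le_refl (p:=r))
  | right _ => 0
  end)) => p Vp; apply: god_ext => r Tr pr /=.
case: pselect => [Vr|[]]; last exact: (open_upset oV) pr Vp.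
rewrite -(sec_res t Vp Vr pr) /= /god_res_fun; exact: god_congr.
Qed.

Section Gluing.
Variables (V0 : set X) (R : comPzRingType) (a : action V0 R) (M : omod X).
Hypothesis oV0 : open V0.
Local Notation A U := (act_sub a (@subIsetr _ U V0)).

(** The ring [R] acts only over [V0], while the induction over open sets takes place on all of [X].
    Intersecting with [V0] keeps the coefficient ring constant as [U] varies. *)
Definition cap_res (U V : set X) (VU : V `<=` U) :
    {linear asec (A U) M -> asec (A V) M} :=
  @sub_res _ _ _ _ a _ _ (setSI VU) M.

Lemma cap_sep (U V : set X) (UW : U `<=` U `|` V) (VW : V `<=` U `|` V) x :
  cap_res UW x = 0 -> cap_res VW x = 0 -> x = 0.
Proof.
move=> xU xV; apply: sections_ext => p Wp; have [[Up|Vp] V0p] := Wp.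
  have /(congr1 (fun s : sections M _ => s p (conj Up V0p))) := xU.
  by rewrite /=; move=> <-; exact: sec_irr.
have /(congr1 (fun s : sections M _ => s p (conj Vp V0p))) := xV.
by rewrite /=; move=> <-; exact: sec_irr.
Qed.

Lemma cap_glue (U V : set X) (IU : U `&` V `<=` U) (IV : U `&` V `<=` V)
    (UW : U `<=` U `|` V) (VW : V `<=` U `|` V) x y : open U -> open V ->
  cap_res IU x = cap_res IV y -> exists w, cap_res UW w = x /\ cap_res VW w = y.
Proof.
move=> oU oV xy.
have agree p (Ip : ((U `&` V) `&` V0) p) (Up : (U `&` V0) p) (Vp : (V `&` V0) p) :
    sec x Up = sec y Vp.
  have /(congr1 (fun s : sections M _ => s p Ip)) := xy; rewrite /= => h.
  by rewrite (sec_irr x Up (setSI IU Ip)) h; exact: sec_irr.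
have other p (Wp : ((U `|` V) `&` V0) p) (nU : ~ U p) : (V `&` V0) p.
  by case: Wp => [[//|Vp] V0p].
pose w0 p (Wp : ((U `|` V) `&` V0) p) : M p :=
  match pselect (U p) with
  | left Up => sec x (conj Up Wp.2 : (U `&` V0) p)
  | right nU => sec y (other p Wp nU)
  end.
have w0U p Wp (Up : (U `&` V0) p) : w0 p Wp = sec x Up.
  rewrite /w0; case: pselect => [Up'|[]]; [exact: sec_irr|exact: Up.1].
have w0V p Wp (Vp : (V `&` V0) p) : w0 p Wp = sec y Vp.
  rewrite /w0; case: pselect => [Up|nU]; last exact: sec_irr.
  by apply: agree; split; [split=> //; exact: Vp.1 | exact: Vp.2].
have w0res p q (Wp : ((U `|` V) `&` V0) p) (Wq : ((U `|` V) `&` V0) q)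
    (h : spec_le p q) : mres M h (w0 p Wp) = w0 q Wq.
  have [[Up|Vp] V0p] := Wp.
    have Uq := open_upset oU h Up.
    rewrite (w0U _ Wp (conj Up V0p)) (w0U _ Wq (conj Uq Wq.2)); exact: sec_res.
  have Vq := open_upset oV h Vp.
  rewrite (w0V _ Wp (conj Vp V0p)) (w0V _ Wq (conj Vq Wq.2)); exact: sec_res.
exists (Sections w0res); split; apply: sections_ext => p Up /=.
  exact: w0U.
exact: w0V.
Qed.

Lemma cap_surj (U V : set X) (UV : V `<=` U) y : flasque M -> open U -> open V ->
  exists x, cap_res UV x = y.
Proof.
move=> fl oU oV.
have [s hs] := fl _ _ (setSI UV) (openI oU oV0) (openI oV oV0) y.
by exists s; apply: sections_ext.
Qed.

End Gluing.
End ActionSections.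

Section ConePresheaf.
Variables (X : topologicalType) (A B : mv_presheaf X) (f : forall U, cmap (A U) (B U)).
Hypothesis nat_f : forall (U V : set X) (VU : V `<=` U) n x,
  f V n (prs A VU n x) = prs B VU n (f U n x).

Program Definition mv_cone : mv_presheaf X :=
  @MVPresheaf X (fun U => cone (f U)) (fun U V VU => cone_map (nat_f VU)) _ _ _ _.
Next Obligation.
move=> U V W UV VW UW n [x y]; apply/pair_equal_spec; split=> /=.
  exact: prs_comp.
by case: n x y => [|n] x y //=; exact: prs_comp.
Qed.
Next Obligation.
move=> U V UW VW n [x y] oU oV /pair_equal_spec[/= xU yU] /pair_equal_spec[/= xV yV].
apply/pair_equal_spec; split; first exact: prs_sep oU oV xU xV.
case: n y {x xU xV} yU yV => [|n] y /= yU yV; first by case: y {yU yV}.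
exact: prs_sep oU oV yU yV.
Qed.
Next Obligation.
move=> U V IU IV UW VW n [x y] [x' y'] oU oV /pair_equal_spec[/= xx yy].
have [w [wx wx']] := prs_glue UW VW oU oV xx.
suff [v [vy vy']] : exists v, shm (prs B UW) n v = y /\ shm (prs B VW) n v = y'.
  by exists (w, v); split; apply/pair_equal_spec.
case: n y y' yy {x x' xx w wx wx'} => [|n] y y' /= yy.
  by exists tt; case: y {yy}; case: y'.
have [v hv] := prs_glue UW VW oU oV yy; by exists v.
Qed.
Next Obligation.
move=> U V UV n [x y] oU oV; have [w wx] := prs_surj UV x oU oV.
suff [v vy] : exists v, shm (prs B UV) n v = y.
  by exists (w, v); apply/pair_equal_spec.
case: n y {x w wx} => [|n] y /=; first by exists tt; case: y.
have [v hv] := prs_surj UV y oU oV; by exists v.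
Qed.

End ConePresheaf.

(** * Quasi-coherence of cohomology sheaves *)

Section KernelMap.
Variables (R : comPzRingType) (D E : lmodType R) (v : {linear D -> E}).

Lemma ker_smod_subproof a x y : v x = 0 -> v y = 0 -> v (a *: x + y) = 0.
Proof. by move=> vx vy; rewrite linearP vx vy /= scaler0 addr0. Qed.

Definition ker_smod : smod D := Smod (raddf0 v) ker_smod_subproof.

Variables (C : lmodType R) (u : {linear C -> D}).

Definition ker_class (z : subm ker_smod) : homology u v :=
  hclass u (@Cycle R D E v (smval z) (smvalP z)).

Lemma ker_class_linear : linear ker_class.
Proof.
move=> a x y; rewrite [a *: ker_class x]hclassZ [RHS]hclassD.
by congr hclass; apply: cycle_ext.
Qed.

HB.instance Definition _ := GRing.isLinear.Build _ _ _ _ ker_class ker_class_linear.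

Lemma ker_class_surj (x : homology u v) : exists z, ker_class z = x.
Proof.
elim/homologyW: x => z; exists (Subm (cvalP z : ker_smod (cval z))).
by congr hclass; apply: cycle_ext.
Qed.

Lemma ker_class_eq0 z : ker_class z = 0 <-> exists c, u c = smval z.
Proof.
split=> [/hclassP[c hc]|[c hc]]; first by exists c; rewrite hc /= subr0.
by apply/hclassP; exists c; rewrite hc /= subr0.
Qed.

Hypothesis vu : forall c, v (u c) = 0.

Definition ker_lift (c : C) : subm ker_smod := Subm (vu c : ker_smod (u c)).

Lemma ker_lift_linear : linear ker_lift.
Proof. by move=> a x y; apply: subm_ext; rewrite /= linearP. Qed.

HB.instance Definition _ := GRing.isLinear.Build _ _ _ _ ker_lift ker_lift_linear.

End KernelMap.

Section HomologyBaseChange.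
Variables (R R' : comPzRingType) (phi : {rmorphism R -> R'}) (flat_phi : flat phi).
Variables (C D E : lmodType R) (u : {linear C -> D}) (v : {linear D -> E}).
Variables (C' D' E' : lmodType R') (u' : {linear C' -> D'}) (v' : {linear D' -> E'}).
Hypothesis vu : forall c, v (u c) = 0.
Variables (f : {additive D -> D'}) (F : {linear bc phi D -> D'}).
Hypothesis fZ : forall a x, f (a *: x) = phi a *: f x.
Hypothesis FE : forall b x, F (bcp phi b x) = b *: f x.
Hypothesis fker : forall x, v x = 0 -> v' (f x) = 0.
Variables (g : {additive homology u v -> homology u' v'}).
Variables (G : {linear bc phi (homology u v) -> homology u' v'}).
Hypothesis GE : forall b x, G (bcp phi b x) = b *: g x.
Hypothesis gE : forall (z : Defs.cycle v) (z' : Defs.cycle v'),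
  cval z' = f (cval z) -> g (hclass u z) = hclass u' z'.

Let Z := subm (ker_smod v).
Let Z' := subm (ker_smod v').
Let i : {linear Z -> D} := subm_incl _.
Let i' : {linear Z' -> D'} := subm_incl _.
Let p : {linear Z -> homology u v} := @ker_class _ _ _ v _ u.
Let p' : {linear Z' -> homology u' v'} := @ker_class _ _ _ v' _ u'.
Let j : {linear C -> Z} := ker_lift vu.

(** Flatness identifies the base change of the cycles [Z] with the kernel of [bcm phi v], and right
    exactness makes the base change of the homology its quotient by the image of [bcm phi u].
    Bijectivity of [G] then takes the shape of the two clauses of [cone_acyclicP]. *)
Lemma homology_bc :
  ((forall z, G z = 0 -> z = 0) /\ (forall m, exists z, G z = m)) <->
  ((forall x, bcm phi v x = 0 -> (exists c, u' c = F x) -> exists c, bcm phi u c = x) /\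
   (forall y, v' y = 0 -> exists2 x, bcm phi v x = 0 & exists c, u' c = y - F x)).
Proof.
have [T TE] : exists T : {additive bc phi Z -> Z'},
    forall b z, smval (T (bcp phi b z)) = b *: f (smval z).
  pose f0 (z : Z) : Z' := Subm (fker (smvalP z) : ker_smod v' (f (smval z))).
  have f0add : zmod_morphism f0 by move=> x y; apply: subm_ext; rewrite /= raddfB.
  pose f1 : {additive Z -> Z'} := HB.pack_for {additive Z -> Z'} f0
    (GRing.isZmodMorphism.Build _ _ _ f0add).
  have f1Z a z : f1 (a *: z) = phi a *: f1 z by apply: subm_ext; rewrite /= fZ.
  have [T TE] := bc_ext f1Z.
  by exists T => b z; rewrite /= TE.
have iT x : i' (T x) = F (bcm phi i x).
  elim/bc_ind: x => [|x y hx hy|b z]; first by rewrite !raddf0.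
    by rewrite !raddfD /= -[smval (T x)]/(i' (T x)) -[smval (T y)]/(i' (T y)) hx hy.
  by rewrite bcm_pure FE [LHS]TE.
have pT x : p' (T x) = G (bcm phi p x).
  elim/bc_ind: x => [|x y hx hy|b z]; first by rewrite !raddf0.
    rewrite (raddfD T) (raddfD p') (raddfD (bcm phi p)) (raddfD G).
    by congr (_ + _).
  rewrite bcm_pure GE.
  have -> : T (bcp phi b z) = b *: Subm (fker (smvalP z) : ker_smod v' (f (smval z))).
    by apply: subm_ext; rewrite TE.
  rewrite linearZ /=; congr (_ *: _); symmetry; exact: gE.
have p_surj := bcm_surj (phi := phi) (u := p) (@ker_class_surj _ _ _ v _ u).
have p_ker x : bcm phi p x = 0 -> exists c, bcm phi j c = x.
  apply: bc_right_exact; first exact: ker_class_surj.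
  by move=> d /ker_class_eq0[c hc]; exists c; apply: subm_ext.
have pj x : bcm phi p (bcm phi j x) = 0.
  rewrite -(bcm_comp (w := \0%R)); first exact: bcm_zero.
  by move=> n; symmetry; apply/ker_class_eq0; exists n.
have ij x : bcm phi i (bcm phi j x) = bcm phi u x by rewrite -(bcm_comp (w := u)).
have vi x : bcm phi v (bcm phi i x) = 0.
  rewrite -(bcm_comp (w := \0%R)); first exact: bcm_zero.
  by move=> n; rewrite /= (smvalP n).
have i_ker x : bcm phi v x = 0 -> exists z, bcm phi i z = x.
  apply: (flat_exact flat_phi) => d; split=> [vd|[z <-]]; last exact: (smvalP z).
  by exists (Subm (vd : ker_smod v d)).
have i_inj x : bcm phi i x = 0 -> x = 0.
  by apply: (flat_inj flat_phi) => n n0; apply: subm_ext.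
have p'0 z : p' z = 0 <-> exists c, u' c = i' z by exact: ker_class_eq0.
split=> [[inj sur]|[inj sur]]; split.
- move=> x /i_ker[z <-]; rewrite -iT => /p'0; rewrite pT => /inj /p_ker[c <-].
  by exists c; rewrite ij.
- move=> y vy; have [x xy] := sur (p' (Subm (vy : ker_smod v' y))).
  have [z zx] := p_surj x; exists (bcm phi i z); first exact: vi.
  suff /p'0[c hc] : p' (Subm (vy : ker_smod v' y) - T z) = 0.
    by exists c; rewrite hc raddfB /= -iT.
  by rewrite raddfB /= -xy -zx -pT subrr.
- move=> x; have [z <-] := p_surj x; rewrite -pT => /p'0[c hc].
  have [|b hb] := inj _ (vi z); first by exists c; rewrite hc iT.
  suff -> : z = bcm phi j b by exact: pj.
  by apply/subr0_eq/i_inj; rewrite raddfB /= ij hb subrr.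
- move=> m; have [z' <-] := @ker_class_surj _ _ _ v' _ u' m.
  have [x /i_ker[z <-] [c hc]] := sur _ (smvalP z').
  exists (bcm phi p z); rewrite -pT; symmetry; apply/subr0_eq.
  rewrite -[ker_class _ z']/(p' z') -raddfB; apply/p'0; exists c.
  by rewrite hc raddfB /= -iT.
Qed.

End HomologyBaseChange.

Section CohomologySheaves.
Variables (k : comPzRingType) (Y : ringed_fspace k) (K : scplx Y).

Definition hcoh (i : nat) : omod Y :=
  match i with
  | 0 => cohomology (zero_hom (K 0) (K 0)) (sdiff K 0)
  | j.+1 => cohomology (sdiff K j) (sdiff K j.+1)
  end.

Program Definition stc (y : Y) : cplx := @Cplx (fun n => K n y) (fun n => sdiff K n y) _.
Next Obligation. by move=> y n x; exact: sdiffK. Qed.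

Variables (y y' : Y) (h : spec_le y y').

Program Definition bst : cplx :=
  @Cplx (fun n => bc (res h) (K n y)) (fun n => bcm (res h) (sdiff K n y)) _.
Next Obligation.
move=> n x; rewrite /= -(bcm_comp (w := \0%R)); first exact: bcm_zero.
by move=> m; rewrite sdiffK.
Qed.

Program Definition bstm : cmap bst (stc y') :=
  @Cmap bst (stc y') (fun n => bcres (K n) h) _.
Next Obligation.
move=> n x; rewrite /=.
by have := lhom_bcres (mhom_local setT (sdiff K n)) (I : setT y) (I : setT y') x.
Qed.

End CohomologySheaves.

Section CohomologyQC.
Variables (k : comPzRingType) (Y : ringed_fspace k) (flat_Y : finite_space Y).
Variable (K : scplx Y).

Lemma coh_bc (C D E : omod Y) (u : mhom C D) (v : mhom D E) (y y' : Y)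
    (h : spec_le y y') : (forall p x, v p (u p x) = 0) ->
  ((forall z, bcres (cohomology u v) h z = 0 -> z = 0) /\
   (forall m, exists z, bcres (cohomology u v) h z = m)) <->
  ((forall x, bcm (res h) (v y) x = 0 -> (exists c, u y' c = bcres D h x) ->
      exists c, bcm (res h) (u y) c = x) /\
   (forall z, v y' z = 0 -> exists2 x, bcm (res h) (v y) x = 0 &
      exists c, u y' c = z - bcres D h x)).
Proof.
move=> vu.
have fk x : v y x = 0 -> v y' (mres D h x) = 0 by move=> vx; rewrite mmap_res vx raddf0.
have gk (z : Defs.cycle (v y)) (z' : Defs.cycle (v y')) : cval z' = mres D h (cval z) ->
    mres (cohomology u v) h (hclass (u y) z) = hclass (u y') z'.
  by move=> zz'; rewrite /= coh_res_class; congr hclass; apply: cycle_ext.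
have E0 := homology_bc (@flat_Y y y' h) (vu y) (mres_scale (o := D) h)
  (bcresE (M := D) h) fk.
have E1 := E0 _ (u y') (mres (cohomology u v) h) (bcres (cohomology u v) h)
  (bcresE (M := cohomology u v) h) gk.
exact: E1.
Qed.

Lemma hcoh_bc (y y' : Y) (h : spec_le y y') : acyclic (cone (bstm K h)) <->
  forall i, (forall z, bcres (hcoh K i) h z = 0 -> z = 0) /\
    (forall m, exists z, bcres (hcoh K i) h z = m).
Proof.
have key i : ((forall z, bcres (hcoh K i) h z = 0 -> z = 0) /\
    (forall m, exists z, bcres (hcoh K i) h z = m)) <->
  ((forall x : bst K h i, cdiff (bst K h) i x = 0 -> bdry (bstm K h i x) -> bdry x) /\
   (forall z : stc K y' i, cdiff (stc K y') i z = 0 ->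
     exists2 x, cdiff (bst K h) i x = 0 & bdry (z - bstm K h i x))).
  (* In degree 0 the incoming map is the zero endomorphism, whose image is the zero submodule of
     boundaries. *)
  case: i => [|i]; last by apply: coh_bc => p x; exact: sdiffK.
  apply: (iff_trans (@coh_bc _ _ _ (zero_hom (K 0%N) (K 0%N)) (sdiff K 0) y y' h _)).
    by move=> p x; exact: raddf0.
  split=> -[inj sur]; split.
  - move=> x dx bx; have [|c <-] := inj x dx; last exact: bcm_zero.
    by exists 0; rewrite raddf0.
  - move=> z dz; by have [x dx [c hc]] := sur z dz; exists x.
  - move=> x dx [c hc]; exists 0; rewrite raddf0; symmetry.
    by apply: inj => //; rewrite -[RHS]hc.
  - move=> z dz; have [x dx hx] := sur z dz; exists x => //; exists 0.
    by rewrite raddf0 -[LHS]hx.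
split=> [/cone_acyclicP[inj sur] i|H].
  by apply/key; split; [exact: inj | exact: sur].
by apply/cone_acyclicP; split=> i; have [] := (key i).1 (H i).
Qed.

Lemma hcoh_qcP : (forall i, quasi_coherent (hcoh K i)) <->
  forall (y y' : Y) (h : spec_le y y'), acyclic (cone (bstm K h)).
Proof.
split=> [qc y y' h|ac i].
  by apply/hcoh_bc => i; exact: quasi_coherent_qc (qc i) _ _ _ _.
by apply: qc_quasi_coherent => y y' h _; move: i; exact/hcoh_bc.
Qed.

End CohomologyQC.

(** * Existence of injective resolutions *)

Section ExtendHom.
Variables (B D : zmodType).

(* The graph of a homomorphism to [D] from a subgroup of [B]. *)
Definition partial_hom (S : set (B * D)%type) : Prop :=
  [/\ S (0, 0), forall b d b' d', S (b, d) -> S (b', d') -> S (b - b', d - d') &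
      forall d, S (0, d) -> d = 0].

Lemma partial_homMz S b d (m : int) : partial_hom S -> S (b, d) -> S (b *~ m, d *~ m).
Proof.
case=> S0 SB _ Sx.
have SN b' d' : S (b', d') -> S (- b', - d').
  by move=> Sy; rewrite -sub0r -[- d']sub0r; exact: SB.
have Sn (n : nat) : S (b *+ n, d *+ n).
  elim: n => [|n IHn]; first by rewrite !mulr0n.
  by rewrite !mulrS -[b *+ n]opprK -[d *+ n]opprK; apply: SB => //; exact: SN.
by case: m => n; [exact: Sn | rewrite NegzE !mulrNz; exact/SN/Sn].
Qed.

Lemma partial_hom_fun S b d d' : partial_hom S -> S (b, d) -> S (b, d') -> d = d'.
Proof.
case=> _ SB Sf Sd Sd'; apply/subr0_eq/Sf.
by have := SB _ _ _ _ Sd Sd'; rewrite subrr.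
Qed.

Hypothesis div_D : forall (d : D) (n : nat), (0 < n)%N -> exists e, e *+ n = d.

(** The integers [m] with [b *~ m] in the domain form an ideal. If its generator [n] is positive,
    the value prescribed at [b *+ n] is divided by [n]; if the ideal is zero, every value is
    consistent and [0] is taken. *)
Lemma partial_hom_value S b : partial_hom S ->
  exists d, forall (m : int) d', S (b *~ m, d') -> d' = d *~ m.
Proof.
move=> hS; have [S0 SB Sf] := hS.
pose P (n : nat) := `[< (0 < n)%N /\ exists d, S (b *+ n, d) >].
have absP m d' : S (b *~ m, d') -> m != 0 -> P `|m|%N.
  move=> Sm m0; apply/asboolP; split; first by rewrite absz_gt0.
  have [m_ge0|m_lt0] := lerP 0 m.
    by exists d'; rewrite pmulrn gez0_abs.
  exists (- d'); rewrite pmulrn ltz0_abs // mulrNz.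
  by have := SB _ _ _ _ S0 Sm; rewrite !sub0r.
have [exP|noP] := pselect (exists n, P n); last first.
  exists 0 => m d' Sm; rewrite mul0rz.
  have m0 : m = 0.
    by apply: contrapT => /eqP m0; apply: noP; exists `|m|%N; exact: absP Sm m0.
  by apply: Sf; rewrite -[0](mulr0z b) -m0.
have [n /asboolP[n_gt0 [d0 Sd0]] nmin] := ex_minnP exP.
have [d dn] := div_D d0 n_gt0; exists d => m d' Sm.
set q := (m %/ n)%Z; set r := (m %% n)%Z.
have mE : m = n%:Z * q + r by rewrite mulrC; exact: divz_eq.
have Sq : S (b *~ (n%:Z * q), d0 *~ q).
  by rewrite mulrzA -pmulrn; exact: partial_homMz.
have Sr : S (b *~ r, d' - d0 *~ q).
  have := SB _ _ _ _ Sm Sq; rewrite -mulrzBr; congr (S (_ *~ _, _)).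
  by rewrite mE addrC addKr.
have r0 : r = 0.
  apply/eqP; apply: contraT => r0; have /nmin := absP _ _ Sr r0.
  have r_ge0 : 0 <= r by rewrite modz_ge0 // eqz_nat -lt0n.
  by rewrite leqNgt -ltz_nat gez0_abs // ltz_pmod.
rewrite mE r0 addr0 mulrzA -pmulrn dn; apply: partial_hom_fun hS Sm _.
by move: Sq; rewrite mE r0 addr0.
Qed.

Lemma extend_partial_hom (S0 : set (B * D)%type) : partial_hom S0 ->
  exists h : {additive B -> D}, forall b d, S0 (b, d) -> h b = d.
Proof.
(* [S0] is adjoined inside [P] for the sake of the empty chain, whose union is empty and is not the
   graph of a partial homomorphism. *)
move=> hS0; pose P S := partial_hom (S0 `|` S).
have chain (F : set (set (B * D)%type)) : F `<=` P -> total_on F subset ->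
    P (\bigcup_(S in F) S).
  move=> FP tot; rewrite /P; set U := S0 `|` _.
  have two x y : U x -> U y -> exists2 T, partial_hom T & [/\ T x, T y & T `<=` U].
    have sub S : F S -> S0 `|` S `<=` U.
      by move=> FS z [?|?]; [left | right; exists S].
    move=> [S0x|[S FS Sx]] [S0y|[S' FS' Sy]].
    - by exists S0 => //; split=> // z; left.
    - by exists (S0 `|` S'); [exact: FP | split; [left|right|exact: sub]].
    - by exists (S0 `|` S); [exact: FP | split; [right|left|exact: sub]].
    - have [SS|SS] := tot S S' FS FS'.
        exists (S0 `|` S'); [exact: FP | split; [right; exact: SS|right=> //|exact: sub]].
      exists (S0 `|` S); [exact: FP | split; [right=> //|right; exact: SS|exact: sub]].
  have U0 : U (0, 0) by left; case: hS0.
  split=> // [b d b' d' Ux Uy|d Ud].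
    by have [T [_ TB _] [Tx Ty TU]] := two _ _ Ux Uy; exact/TU/TB.
  by have [T [_ _ Tf] [_ Td _]] := two _ _ U0 Ud; exact: Tf.
have [S [hS Smax]] := Zorn_bigcup chain; pose G := S0 `|` S.
have hG : partial_hom G := hS; have [G0 GB Gf] := hG.
have tot b : exists d, G (b, d).
  apply: contrapT => nob; have [d hd] := partial_hom_value b hG.
  (* The graph enlarged by sending [b] to [d]. It stays single-valued by the choice of [d], and
     contradicts the maximality of [S]. *)
  pose G' : set (B * D)%type :=
    [set x | exists m e c, G (c, e) /\ x = (c + b *~ m, e + d *~ m)].
  have GG' x : G x -> G' x.
    by case: x => c e Gx; exists 0, e, c; rewrite !mulr0z !addr0.
  have G'E : S0 `|` G' = G'.
    by apply/setUidPr => x S0x; apply: GG'; left.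
  have hG' : partial_hom G'.
    split=> [|c e c' e' [m [e1 [c1 [G1 [-> ->]]]]] [n [e2 [c2 [G2 [-> ->]]]]]|e].
    - exact: GG'.
    - exists (m - n), (e1 - e2), (c1 - c2); split; first exact: GB.
      by rewrite !mulrzBr !opprD (addrACA c1) (addrACA e1).
    - move=> [m [e1 [c1 [G1 [/esym/eqP]]]]]; rewrite addr_eq0 => /eqP c1E ->.
      have /hd : G (b *~ m, - e1).
        by have := GB _ _ _ _ G0 G1; rewrite !sub0r c1E opprK.
      by move=> <-; rewrite addrN.
  apply: (Smax G'); last by rewrite /P G'E.
  split=> [x Sx|G'S]; first by apply: GG'; right.
  apply: nob; exists d; right; apply: G'S; exists 1, 0, 0.
  by rewrite !mulr1z !add0r.
have [h hh] := choice tot.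
have hadd : zmod_morphism h.
  by move=> x y; apply: (partial_hom_fun hG (hh _)); exact: GB.
exists (HB.pack_for {additive B -> D} h (GRing.isZmodMorphism.Build _ _ _ hadd)).
by move=> b d Sd /=; apply: (partial_hom_fun hG (hh b)); left.
Qed.

Lemma extend_hom (A : zmodType) (i : {additive A -> B}) (g : {additive A -> D}) :
  (forall a, i a = 0 -> a = 0) ->
  exists h : {additive B -> D}, forall a, h (i a) = g a.
Proof.
move=> inj.
have hS : partial_hom [set x | exists a, x = (i a, g a)].
  split=> [|b d b' d' [a [-> ->]] [a' [-> ->]]|d [a [/esym/inj -> ->]]].
  - by exists 0; rewrite !raddf0.
  - by exists (a - a'); rewrite !raddfB.
  - by rewrite raddf0.
have [h hh] := extend_partial_hom hS.
by exists h => a; apply: hh; exists a.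
Qed.

End ExtendHom.

(** * The divisible group Q/Z and its separation property *)

Section RationalsModuloIntegers.

Let incl (x : int^o) : zmodule rat := x%:~R.
Let incl_linear : linear incl.
Proof. by move=> a x y; rewrite /incl rmorphD /= intrM mulrzl. Qed.
HB.instance Definition _ := GRing.isLinear.Build _ _ _ _ incl incl_linear.

Definition QmodZ : zmodType := coker incl.
Let cl : {additive zmodule rat -> QmodZ} := coker_map incl.

Let cl_eq0 (x : rat) : cl x = 0 <-> exists m : int, x = m%:~R.
Proof.
split=> [/coker_map_eq0[m <-]|[m ->]]; first by exists m.
by apply/coker_map_eq0; exists m.
Qed.

Lemma QmodZ_divisible (d : QmodZ) (n : nat) : (0 < n)%N -> exists e, e *+ n = d.
Proof.
move=> n_gt0; have [x <-] := coker_map_surj d.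
exists (cl ((x : rat) / n%:R)); rewrite -raddfMn /=; congr (coker_map _ _).
rewrite -[LHS]/(((x : rat) / n%:R) *+ n) -mulr_natr divfK //.
by rewrite pnatr_eq0 -lt0n.
Qed.

(** The witness is the class of [1/n]. *)
Lemma QmodZ_order (n : nat) : (1 < n)%N ->
  exists2 d : QmodZ, d != 0 & forall m : int, (n %| m)%Z -> d *~ m = 0.
Proof.
move=> n_gt1; have nz : (n%:R : rat) != 0 by rewrite pnatr_eq0 -lt0n ltnW.
exists (cl (n%:R^-1 : rat)).
  apply/eqP => /cl_eq0[m /(congr1 (fun x => x * n%:R))]; rewrite mulVf // => h.
  have /eqP : (1 : int) = m * n%:Z.
    apply: (@intr_inj rat); rewrite intrM mulr1z; exact: h.
  move=> /eqP/(congr1 absz); rewrite abszM => /esym/eqP.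
  by rewrite muln_eq1 => /andP[_ /eqP] /= nE; rewrite nE in n_gt1.
move=> m /dvdzP[q ->]; rewrite -raddfMz; apply/cl_eq0; exists q.
rewrite -[LHS]/((n%:R^-1 : rat) *~ (q * n%:Z)) -mulrzl intrM -mulrA.
by rewrite divff // mulr1.
Qed.

(** It suffices to send [x] to a nonzero [d] killed by every integer that kills [x], since the map
    on the multiples of [x] then extends. For [x] of finite order [n], the class of [1/n] is such a
    [d]. *)
Lemma QmodZ_separates (N : zmodType) (x : N) : x != 0 ->
  exists h : {additive N -> QmodZ}, h x != 0.
Proof.
move=> x0.
suff [d d0 hd] : exists2 d : QmodZ, d != 0 & forall m : int, x *~ m = 0 -> d *~ m = 0.
  have hS : partial_hom [set y | exists m : int, y = (x *~ m, d *~ m)].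
    split=> [|b e b' e' [m [-> ->]] [m' [-> ->]]|e [m [/esym/hd h ->]]] //.
    - by exists 0; rewrite !mulr0z.
    - by exists (m - m'); rewrite !mulrzBr.
  have [h hh] := extend_partial_hom QmodZ_divisible hS.
  by exists h; rewrite (hh x d) //; exists 1; rewrite !mulr1z.
pose P (n : nat) := (0 < n)%N && (x *+ n == 0).
have absP m : x *~ m = 0 -> m != 0 -> P `|m|%N.
  move=> xm m0; rewrite /P absz_gt0 m0 /= pmulrn.
  have [m_ge0|m_lt0] := lerP 0 m; first by rewrite gez0_abs // xm.
  by rewrite ltz0_abs // mulrNz xm oppr0.
have [exP|noP] := pselect (exists n, P n); last first.
  (* Here [x] has infinite order and any nonzero class is allowed; the one of [1/2] is taken. *)
  have [d d0 _] := QmodZ_order (ltnSn 1); exists d => // m xm.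
  case: (eqVneq m 0) => [-> //|m0]; case: noP; exists `|m|%N; exact: absP.
have [n /andP[n_gt0 /eqP xn] nmin] := ex_minnP exP.
have n_gt1 : (1 < n)%N.
  case: n n_gt0 xn {nmin} => [|[|n]] // _; rewrite mulr1n => x1.
  by rewrite x1 eqxx in x0.
have [d d0 hd] := QmodZ_order n_gt1; exists d => // m xm; apply: hd.
apply/dvdz_mod0P/eqP; apply: contraT => r0.
have xr : x *~ (m %% n)%Z = 0.
  have := xm; rewrite {1}(divz_eq m n) mulrzDr mulrC mulrzA -pmulrn xn.
  by rewrite mul0rz add0r.
have /nmin := absP _ xr r0.
have r_ge0 : 0 <= (m %% n)%Z by rewrite modz_ge0 // eqz_nat -lt0n.
by rewrite leqNgt -ltz_nat gez0_abs // ltz_pmod.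
Qed.

End RationalsModuloIntegers.

Definition injective_module (R : comPzRingType) (E : lmodType R) : Prop :=
  forall (A B : lmodType R) (i : {linear A -> B}) (g : {linear A -> E}),
    injective i -> exists h : {linear B -> E}, forall a, h (i a) = g a.

(* The [R]-module [Hom_Z (R, (Q/Z) ^ Hom (N, Q/Z))], which is injective and
   contains [N]. *)
Section InjectiveHull.
Variables (R : comPzRingType) (N : lmodType R).

Let I : Type := {additive N -> QmodZ}.

Record inj_hull := InjHull {
  ihv :> R -> I -> QmodZ;
  ihvB : forall r s i, ihv (r - s) i = ihv r i - ihv s i
}.

Lemma inj_hull_ext (f g : inj_hull) : (forall r i, f r i = g r i) -> f = g.
Proof.
case: f g => [f hf] [g hg] /= fg.
have {}fg : f = g by apply: funext => r; apply: funext.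
by move: hf hg; rewrite fg => hf hg; rewrite (Prop_irrelevance hf hg).
Qed.

HB.instance Definition _ := gen_eqMixin inj_hull.
HB.instance Definition _ := gen_choiceMixin inj_hull.

Lemma ihvD (f : inj_hull) r s i : f (r + s) i = f r i + f s i.
Proof.
have f0 : f 0 i = 0 by rewrite -(subrr (0 : R)) ihvB subrr.
by rewrite -{1}[s]opprK ihvB -[- s]sub0r ihvB f0 sub0r opprK.
Qed.

Program Definition ih_zero := @InjHull (fun _ _ => 0) _.
Next Obligation. by move=> *; rewrite subr0. Qed.
Program Definition ih_add (f g : inj_hull) := @InjHull (fun r i => f r i + g r i) _.
Next Obligation. by move=> f g r s i /=; rewrite !ihvB opprD addrACA. Qed.
Program Definition ih_opp (f : inj_hull) := @InjHull (fun r i => - f r i) _.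
Next Obligation. by move=> f r s i /=; rewrite ihvB opprD. Qed.
Program Definition ih_scale a (f : inj_hull) := @InjHull (fun r i => f (r * a) i) _.
Next Obligation. by move=> a f r s i /=; rewrite mulrBl ihvB. Qed.

Let addA : associative ih_add.
Proof. by move=> x y z; apply: inj_hull_ext => r i /=; rewrite addrA. Qed.
Let addC : commutative ih_add.
Proof. by move=> x y; apply: inj_hull_ext => r i /=; rewrite addrC. Qed.
Let add0 : left_id ih_zero ih_add.
Proof. by move=> x; apply: inj_hull_ext => r i /=; rewrite add0r. Qed.
Let addN : left_inverse ih_zero ih_opp ih_add.
Proof. by move=> x; apply: inj_hull_ext => r i /=; rewrite addNr. Qed.

HB.instance Definition _ := GRing.isZmodule.Build inj_hull addA addC add0 addN.

Let scaleA a b x : ih_scale a (ih_scale b x) = ih_scale (a * b) x.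
Proof. by apply: inj_hull_ext => r i /=; rewrite mulrA. Qed.
Let scale1 : left_id 1 ih_scale.
Proof. by move=> x; apply: inj_hull_ext => r i /=; rewrite mulr1. Qed.
Let scaleDr : right_distributive ih_scale +%R.
Proof. by move=> a x y; apply: inj_hull_ext. Qed.
Let scaleDl x : {morph ih_scale^~ x : a b / a + b}.
Proof.
by move=> a b; apply: inj_hull_ext => r i /=; rewrite mulrDr ihvD.
Qed.

HB.instance Definition _ := GRing.Zmodule_isLmodule.Build R inj_hull
  scaleA scale1 scaleDr scaleDl.

(** By adjunction, an [R]-linear map into [Hom_Z (R, Q/Z)] is an additive map into Q/Z, read off at
    [1], and such maps extend because Q/Z is divisible. The extension [h c] is turned back into
    [r |-> h c (r *: b)]. *)
Lemma inj_hull_injective : injective_module inj_hull.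
Proof.
move=> A B i g inj.
have /choice[h hE] : forall c : I, exists h : {additive B -> QmodZ},
    forall a, h (i a) = g a 1 c.
  move=> c; have gadd : zmod_morphism (fun a => g a 1 c).
    by move=> x y; rewrite raddfB.
  pose g1 : {additive A -> QmodZ} := HB.pack_for {additive A -> QmodZ}
    (fun a => g a 1 c) (GRing.isZmodMorphism.Build _ _ _ gadd).
  apply: (extend_hom QmodZ_divisible (i := i) g1) => a ia.
  by apply: inj; rewrite ia raddf0.
have hB b r s (c : I) : h c ((r - s) *: b) = h c (r *: b) - h c (s *: b).
  by rewrite scalerBl raddfB.
have lin : linear (fun b => InjHull (hB b)).
  move=> a x y; apply: inj_hull_ext => r c /=.
  by rewrite scalerDr scalerA raddfD.
exists (HB.pack_for {linear B -> inj_hull} (fun b => InjHull (hB b))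
  (GRing.isLinear.Build _ _ _ _ _ lin)) => a /=.
apply: inj_hull_ext => r c /=; rewrite -linearZ hE linearZ /=.
by rewrite mul1r.
Qed.

Let embB n r s (c : I) : c ((r - s) *: n) = c (r *: n) - c (s *: n).
Proof. by rewrite scalerBl raddfB. Qed.

Definition inj_hull_fun (n : N) : inj_hull := InjHull (embB n).

Lemma inj_hull_linear : linear inj_hull_fun.
Proof.
move=> a x y; apply: inj_hull_ext => r c /=.
by rewrite scalerDr scalerA raddfD.
Qed.

HB.instance Definition _ := GRing.isLinear.Build _ _ _ _ inj_hull_fun inj_hull_linear.
Definition inj_hull_emb : {linear N -> inj_hull} := inj_hull_fun.

Lemma inj_hull_emb_inj n : inj_hull_emb n = 0 -> n = 0.
Proof.
move=> n0; apply/eqP; apply: contraT => /QmodZ_separates[c /eqP[]].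
have := congr1 (fun f : inj_hull => f 1 c) n0.
by rewrite /= scale1r.
Qed.

End InjectiveHull.

Section InjectiveSheaves.
Variables (k : comPzRingType) (X : ringed_fspace k).

(** A morphism from [B] to [god setT E] is a family of linear maps from [B x] to [E x], its diagonal
    components, and each of them is extended separately. *)
Lemma god_injective (E : forall x : X, lmodType (stalk x)) :
  (forall x, injective_module (E x)) -> injective_omod (god setT E).
Proof.
move=> Einj A B i g inj.
pose gx (x : X) (a : A x) : E x := g x a x I (spec_le_refl (p:=x)).
have gxlin x : linear (gx x).
  move=> r a b; rewrite /gx linearP /=.
  by rewrite -[LHS]/(res _ r *: gx x a + gx x b) res_id.
have Hx x : exists h : {linear B x -> E x}, forall a, h (i x a) = gx x a.
  exact: (Einj x _ _ (i x) (HB.pack_for {linear A x -> E x} (gx x)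
    (GRing.isLinear.Build _ _ _ _ _ (gxlin x))) (inj x)).
pose h x := sval (cid (Hx x)); have hE x a : h x (i x a) = gx x a := svalP (cid (Hx x)) a.
exists (god_emb setT h) => p a; apply: god_ext => r Tr pr.
rewrite -[LHS]/(h r (mres B pr (i p a))) -mmap_res hE /gx mmap_res /= /god_res_fun.
exact: god_congr.
Qed.

Definition inj_sheaf (M : omod X) : omod X := god setT (fun x => inj_hull (M x)).

Definition inj_sheaf_emb (M : omod X) : mhom M (inj_sheaf M) :=
  god_emb setT (fun x => inj_hull_emb (M x)).

Lemma inj_sheaf_emb_inj M p m : inj_sheaf_emb M p m = 0 -> m = 0.
Proof.
move=> m0; apply: inj_hull_emb_inj.
have := congr1 (fun s : inj_sheaf M p => s p I (spec_le_refl (p:=p))) m0.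
by rewrite -[LHS]/(inj_hull_emb (M p) (mres M _ m)) mres_id => ->.
Qed.

Lemma exists_injective_resolution (M : omod X) : inhabited (injective_resolution M).
Proof.
split; apply: (@InjRes _ _ M (fun n => inj_sheaf (syz inj_sheaf_emb n M))
  (rdiff inj_sheaf_emb M) (inj_sheaf_emb M)).
- by move=> n; apply: god_injective => x; exact: inj_hull_injective.
- move=> p x y xy; apply/subr0_eq/inj_sheaf_emb_inj.
  by rewrite raddfB /= xy subrr.
- by move=> p x; apply: rdiff_eq0 => *; exact: inj_sheaf_emb_inj.
- by move=> n p x; apply: rdiff_exact => *; exact: inj_sheaf_emb_inj.
Qed.

End InjectiveSheaves.

(** * Comparison of resolutions *)

Record scmap (k : comPzRingType) (X : ringed_fspace k) (K L : scplx X) := Scmap {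
  scfun :> forall n, mhom (K n) (L n);
  scfun_diff : forall n p x, scfun n.+1 p (sdiff K n p x) = sdiff L n p (scfun n p x)
}.

Lemma acyclic_bij (A B : cplx) (f : cmap A B) :
  (forall n x, f n x = 0 -> x = 0) -> (forall n y, exists x, f n x = y) ->
  acyclic A <-> acyclic B.
Proof.
move=> inj sur; split=> ac n x dx.
  have [y yx] := sur n x; rewrite -yx; apply: bdry_map; apply: ac; apply: inj.
  by rewrite cfun_diff yx dx.
have : bdry (f n x) by apply: ac; rewrite -cfun_diff dx raddf0.
case: n x dx => [|n] x dx /=; first exact: inj.
move=> [y hy]; have [z zy] := sur n y; exists z; apply/subr0_eq/inj.
by rewrite raddfB /= cfun_diff zy hy subrr.
Qed.

Lemma cone_map_bij (A B A' B' : cplx) (f : cmap A B) (f' : cmap A' B')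
    (i : cmap A A') (j : cmap B B') :
  (forall n x, f' n (i n x) = j n (f n x)) ->
  (forall n x, i n x = 0 -> x = 0) -> (forall n y, exists x, i n x = y) ->
  (forall n x, j n x = 0 -> x = 0) -> (forall n y, exists x, j n x = y) ->
  acyclic (cone f) <-> acyclic (cone f').
Proof.
move=> comm ii is_ ji js; apply: (acyclic_bij (f := cone_map comm)).
  move=> n [x y] /pair_equal_spec[/= /ii -> yy]; apply/pair_equal_spec; split=> //.
  by case: n y {x} yy => [|n] y /=; [case: y | exact: ji].
move=> n [x y]; have [x' hx] := is_ n x.
suff [y' hy] : exists y', shm j n y' = y by exists (x', y'); apply/pair_equal_spec.
case: n y {x x' hx} => [|n] y /=; first by exists tt; case: y.
exact: js.
Qed.

Section QuasiIsomorphism.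
Variables (k : comPzRingType) (X : ringed_fspace k).

Lemma qc_on_iso (M N : omod X) (u : local_hom setT M N) :
  (forall p Tp x, u p Tp x = 0 -> x = 0) -> (forall p Tp y, exists x, u p Tp x = y) ->
  qc_on setT M -> qc_on setT N.
Proof.
move=> inj sur qc p q h _; have [qi qs] := qc p q h I; split=> [z|m].
  have [y <-] := bcm_surj (sur p I) z; rewrite -(lhom_bcres u I I) => /inj /qi ->.
  exact: raddf0.
have [n <-] := sur q I m; have [z <-] := qs n.
by exists (bcm (res h) (u p I) z); rewrite (lhom_bcres u I I).
Qed.

Lemma local_hom_inv (M N : omod X) (u : local_hom setT M N) :
  (forall p Tp x, u p Tp x = 0 -> x = 0) -> (forall p Tp y, exists x, u p Tp x = y) ->
  exists v : local_hom setT N M,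
    (forall p Tp x, v p Tp x = 0 -> x = 0) /\ (forall p Tp y, exists x, v p Tp x = y).
Proof.
move=> inj sur.
have H p Tp : exists v : {linear N p -> M p}, forall x, v (u p Tp x) = x.
  by apply: (lin_factor (g := idfun)) => [|x /inj]; first exact: sur.
pose v p Tp := sval (cid (H p Tp)).
have vE p Tp x : v p Tp (u p Tp x) = x := svalP (cid (H p Tp)) x.
have vres p q (Tp : setT p) (Tq : setT q) (l : spec_le p q) m :
    v q Tq (mres N l m) = mres M l (v p Tp m).
  by have [x <-] := sur p Tp m; rewrite -(lhom_res u Tp Tq) !vE.
exists (LocalHom vres); split=> p Tp y /=; last by exists (u p Tp y); exact: vE.
by have [x <-] := sur p Tp y; rewrite vE => ->; rewrite raddf0.
Qed.

Lemma cohomology_iso (C D E C' D' E' : omod X) (u : mhom C D) (v : mhom D E)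
    (u' : mhom C' D') (v' : mhom D' E') (d : mhom D D') :
  (forall p x, v p x = 0 -> v' p (d p x) = 0) ->
  (forall p c, exists c', u' p c' = d p (u p c)) ->
  (forall p x, v p x = 0 -> (exists c', u' p c' = d p x) -> exists c, u p c = x) ->
  (forall p y, v' p y = 0 -> exists2 x, v p x = 0 & exists c', u' p c' = y - d p x) ->
  exists h : local_hom setT (cohomology u v) (cohomology u' v'),
    (forall p Tp x, h p Tp x = 0 -> x = 0) /\ (forall p Tp y, exists x, h p Tp x = y).
Proof.
move=> dv du inj sur.
pose dz p (z : Defs.cycle (v p)) : Defs.cycle (v' p) := Cycle (dv p _ (cvalP z)).
have H p : exists h : {linear cohomology u v p -> cohomology u' v' p},
    forall z, h (hclass (u p) z) = hclass (u' p) (dz p z).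
  pose g (z : subm (ker_smod (v p))) : homology (u' p) (v' p) :=
    hclass (u' p) (dz p (Cycle (smvalP z))).
  have glin : linear g.
    move=> a x y; rewrite /g [a *: hclass _ _]hclassZ [RHS]hclassD.
    by congr hclass; apply: cycle_ext; rewrite /= linearP.
  pose gl : {linear subm (ker_smod (v p)) -> homology (u' p) (v' p)} :=
    HB.pack_for {linear subm (ker_smod (v p)) -> homology (u' p) (v' p)} g
      (GRing.isLinear.Build _ _ _ _ _ glin).
  have [h hE] : exists h : {linear homology (u p) (v p) -> homology (u' p) (v' p)},
      forall z, h (ker_class (u p) z) = gl z.
    apply: lin_factor; first exact: ker_class_surj.
    move=> z /ker_class_eq0[c hc]; have [c' hc'] := du p c.
    by apply/hclassP; exists c'; rewrite hc' hc /= subr0.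
  exists h => z; have := hE (Subm (cvalP z : ker_smod (v p) (cval z))).
  rewrite /= /g /ker_class => e.
  have zE : z = Cycle (cvalP z) by apply: cycle_ext.
  have -> : hclass (u p) z = hclass (u p) (Cycle (cvalP z)) by rewrite -zE.
  by rewrite e; congr hclass; apply: cycle_ext.
pose h p (_ : setT p) := sval (cid (H p)).
have hE p Tp z : h p Tp (hclass (u p) z) = hclass (u' p) (dz p z) :=
  svalP (cid (H p)) z.
have hres p q (Tp : setT p) (Tq : setT q) (l : spec_le p q) m :
    h q Tq (mres (cohomology u v) l m) = mres (cohomology u' v') l (h p Tp m).
  elim/homologyW: m => z; rewrite hE /= !coh_res_class hE.
  by congr hclass; apply: cycle_ext; rewrite /= mmap_res.
exists (LocalHom hres); split=> p Tp.
  elim/homologyW=> z /=; rewrite hE => /hclassP[c' hc'].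
  apply/hclassP; have [|c hc] := inj p (cval z) (cvalP z).
    by exists c'; rewrite hc' /= subr0.
  by exists c; rewrite hc /= subr0.
elim/homologyW=> y; have [x vx [c' hc']] := sur p (cval y) (cvalP y).
exists (hclass (u p) (Cycle vx)); rewrite /= hE.
by symmetry; apply/hclassP; exists c'.
Qed.

Variables (K L : scplx X) (f : scmap K L).

Program Definition stcm (p : X) : cmap (stc K p) (stc L p) :=
  @Cmap (stc K p) (stc L p) (fun n => f n p) _.
Next Obligation. by move=> p n x; exact: scfun_diff. Qed.

Hypothesis qis : forall p, acyclic (cone (stcm p)).

Lemma hcoh_iso i : exists h : local_hom setT (hcoh K i) (hcoh L i),
  (forall p Tp x, h p Tp x = 0 -> x = 0) /\ (forall p Tp y, exists x, h p Tp x = y).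
Proof.
case: i => [|i]; apply: (@cohomology_iso _ _ _ _ _ _ _ _ _ _ (f _)).
- by move=> p x dx; rewrite -scfun_diff dx raddf0.
- by move=> p c; exists 0; rewrite !raddf0.
- move=> p x dx [c hc]; exists 0; rewrite raddf0; symmetry.
  have /cone_acyclicP[inj _] := @qis p; by apply: (inj 0%N).
- move=> p y dy; have /cone_acyclicP[_ sur] := @qis p.
  have [x dx hx] := sur 0%N y dy; exists x => //; exists 0.
  by rewrite raddf0 -[LHS]hx.
- by move=> p x dx; rewrite -scfun_diff dx raddf0.
- by move=> p c; exists (f i p c); rewrite scfun_diff.
- by move=> p x dx hx; have /cone_acyclicP[inj _] := @qis p; apply: (inj i.+1).
- by move=> p y dy; have /cone_acyclicP[_ sur] := @qis p; apply: (sur i.+1).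
Qed.

Lemma hcoh_qis_qc i : qc_on setT (hcoh K i) <-> qc_on setT (hcoh L i).
Proof.
have [h [hi hs]] := hcoh_iso i; have [h' [hi' hs']] := local_hom_inv hi hs.
by split; [exact: qc_on_iso hi hs | exact: qc_on_iso hi' hs'].
Qed.

End QuasiIsomorphism.

Lemma acyclic_zero (C : cplx) : (forall n (x : C n), x = 0) -> acyclic C.
Proof. by move=> C0 n x _; rewrite (C0 n x); exact: bdry0. Qed.

Section Representatives.
Variables (k : comPzRingType) (X : ringed_fspace k).

(* Equivalent points [p <= q <= p] may be distinct; [reps] selects one point in
   each class. *)
Definition rep (p : X) : X := xget p [set q | spec_le p q /\ spec_le q p].

Lemma repP p : spec_le p (rep p) /\ spec_le (rep p) p.
Proof.
suff ex : exists q, [set q | spec_le p q /\ spec_le q p] q by exact: (xgetPex p ex).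
by exists p; split; exact: spec_le_refl.
Qed.

Lemma rep_eq p q : spec_le p q -> spec_le q p -> rep p = rep q.
Proof.
move=> pq qp; rewrite /rep.
have -> : [set r | spec_le p r /\ spec_le r p] = [set r | spec_le q r /\ spec_le r q].
  by apply/seteqP; split=> r [h1 h2]; split; eapply spec_le_trans; eauto.
rewrite /xget; case: pselect => // -[].
by exists q; apply/asboolP; split; exact: spec_le_refl.
Qed.

Definition reps : set X := [set r | rep r = r].

Lemma reps_rep p : reps (rep p).
Proof. by have [h1 h2] := repP p; exact: (esym (rep_eq h1 h2)). Qed.

Lemma reps_eq r p : reps r -> spec_le p r -> spec_le r p -> r = rep p.
Proof. by move=> rr pr rp; rewrite -{1}rr; exact: rep_eq. Qed.

(** The component at [rep p] determines [m], by restricting back from [rep p] to the equivalent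
    point [p]. *)
Lemma gemb_inj (M : omod X) p m : gemb reps M p m = 0 -> m = 0.
Proof.
move=> m0; have [h1 h2] := repP p.
have := congr1 (fun s : godm reps M p => s (rep p) (reps_rep p) h1) m0.
rewrite /= /god_emb_fun /= => m1.
by rewrite -(mres_id (spec_le_refl (p:=p)) m) -(mres_comp h1 h2) m1 raddf0.
Qed.

End Representatives.

Section GodementResolution.
Variables (k : comPzRingType) (X : ringed_fspace k).
Let e := gemb (reps (X := X)).

Program Definition gr (M : omod X) : scplx X :=
  @Scplx k X (fun n => godm (reps (X := X)) (syz e n M)) (rdiff e M) _.
Next Obligation.
by move=> M n p x; apply/rdiff_exact; [exact: gemb_inj | exists x].
Qed.

Lemma gr_flasque M n : flasque (gr M n).
Proof. exact: god_flasque. Qed.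

End GodementResolution.

(** [A] is the structure sheaf of [V] extended by zero. A section [t] over [V] is a morphism from
    [A] to [J]; injectivity extends it to the structure sheaf of [X], and the image of [1] is a
    global section extending [t]. *)
Lemma injective_flasque (k : comPzRingType) (X : ringed_fspace k) (J : omod X) :
  injective_omod J -> flasque J.
Proof.
move=> inj U V VU oU oV t.
pose O := structure_sheaf X.
have SL p a (x y : O p) : V p \/ x = 0 -> V p \/ y = 0 -> V p \/ a *: x + y = 0.
  move=> [Vp|->]; first by left.
  by move=> [Vp|->]; [left | right; rewrite scaler0 addr0].
pose S p : smod (O p) := Smod (or_intror erefl : V p \/ (0 : O p) = 0) (@SL p).
have Sres p q (h : spec_le p q) (x : O p) : S p x -> S q (mres O h x).
  by case=> [Vp|->]; [left; exact: h | right; exact: raddf0].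
pose A := subsheaf Sres.
pose g0 p (x : A p) : J p :=
  match pselect (V p) with left Vp => (smval x : stalk p) *: t p Vp | right _ => 0 end.
have glin p : linear (@g0 p).
  move=> a x y; rewrite /g0; case: pselect => [Vp|_]; last by rewrite scaler0 addr0.
  by rewrite /= scalerDl scalerA.
pose g1 p : {linear A p -> J p} := HB.pack_for {linear A p -> J p} (@g0 p)
  (GRing.isLinear.Build _ _ _ _ _ (glin p)).
have gres p q (h : spec_le p q) (x : A p) : g1 q (mres A h x) = mres J h (g1 p x).
  rewrite -[LHS]/(g0 q (mres A h x)) -[g1 p x]/(g0 p x) /g0.
  case: pselect => [Vq|nVq]; case: pselect => [Vp|nVp].
  - by rewrite mres_scale (sec_res _ _ Vq).
  - have [//|x0] := smvalP x.
    suff e : smval (mres A h x) = 0 by rewrite e scale0r raddf0.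
    by rewrite /= x0; exact: raddf0.
  - by case: nVq; exact: h.
  - by rewrite raddf0.
have [|h hE] := inj A O (subsheaf_incl Sres) (Mhom gres).
  by move=> p x y; exact: subm_ext.
have sres p q (Up : U p) (Uq : U q) (l : spec_le p q) :
    mres J l (h p (1 : stalk p)) = h q (1 : stalk q).
  by rewrite -mmap_res /= /regular_res rmorph1.
exists (Sections sres) => p Vp /=.
have S1 : S p (1 : stalk p) by left.
rewrite -[1]/(subsheaf_incl Sres p (Subm S1)) hE /= /g0.
by case: pselect => // Vp'; rewrite /= scale1r; exact: sec_irr.
Qed.

(** * Sections and direct images of quasi-isomorphisms between flasque complexes *)

Section SectionComplexes.
Variables (k : comPzRingType) (X : ringed_fspace k).

Section Complex.
Variables (V : set X) (R : comPzRingType) (a : action V R).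

Definition ssm (M N : omod X) (u : mhom M N) : {linear asec a M -> asec a N} :=
  amap (@subsetT _ V) a (mhom_local setT u).

Program Definition secc (K : scplx X) : cplx :=
  @Cplx (fun n => asec a (K n)) (fun n => ssm (sdiff K n)) _.
Next Obligation. by move=> K n s; apply: sections_ext => p Vp /=; exact: sdiffK. Qed.

Program Definition secm (K L : scplx X) (f : scmap K L) : cmap (secc K) (secc L) :=
  @Cmap (secc K) (secc L) (fun n => ssm (f n)) _.
Next Obligation. by move=> K L f n s; apply: sections_ext => p Vp /=; exact: scfun_diff. Qed.

End Complex.

Program Definition secr (V V' : set X) (VV : V' `<=` V) (R R' : comPzRingType)
    (a : action V R) (a' : action V' R') (K : scplx X) : cmap (secc a K) (secc a' K) :=
  @Cmap (secc a K) (secc a' K) (fun n => asr VV a a' (K n)) _.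
Next Obligation. by move=> *; apply: sections_ext. Qed.

Section Presheaf.
Variables (V0 : set X) (R : comPzRingType) (a : action V0 R) (oV0 : open V0).
Variables (K : scplx X) (flK : forall n, flasque (K n)).

Program Definition cap_resc (U V : set X) (VU : V `<=` U) :
    cmap (secc (act_sub a (@subIsetr _ U V0)) K) (secc (act_sub a (@subIsetr _ V V0)) K) :=
  @Cmap _ _ (fun n => cap_res a (K n) VU) _.
Next Obligation. by move=> *; apply: sections_ext. Qed.

Program Definition secp : mv_presheaf X :=
  @MVPresheaf X (fun U => secc (act_sub a (@subIsetr _ U V0)) K) cap_resc _ _ _ _.
Next Obligation. by move=> *; apply: sections_ext => p Wp /=; exact: sec_irr. Qed.
Next Obligation. by move=> U V UW VW n x _ _; exact: cap_sep. Qed.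
Next Obligation. by move=> U V IU IV UW VW n x y; exact: cap_glue. Qed.
Next Obligation. by move=> U V UV n y oU oV; exact: cap_surj. Qed.

End Presheaf.

Lemma eval_inj (M : omod X) (V : set X) (p : X) (Vp : V p) (s : sections M V) :
  V `<=` minopen p -> s p Vp = 0 -> s = 0.
Proof.
move=> VP s0; apply: sections_ext => q Vq.
by rewrite -(sec_res s Vp Vq (VP q Vq)) s0 raddf0.
Qed.

Lemma eval_surj (M : omod X) (V : set X) (p : X) (Vp : V p) (m : M p) :
  V `<=` minopen p -> exists s : sections M V, s p Vp = m.
Proof.
move=> VP; have sres q r (Vq : V q) (Vr : V r) (h : spec_le q r) :
    mres M h (mres M (VP q Vq : spec_le p q) m) = mres M (VP r Vr : spec_le p r) m.
  exact: mres_comp.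
by exists (Sections sres); exact: mres_id.
Qed.

Section Evaluation.
Variables (V : set X) (R : comPzRingType) (a : action V R) (K : scplx X).
Variables (p : X) (Vp : V p).

Definition eval_fun (M : omod X) (s : asec a M) : M p := sec s Vp.

Lemma eval_additive M : zmod_morphism (@eval_fun M).
Proof. by []. Qed.

HB.instance Definition _ M :=
  GRing.isZmodMorphism.Build _ _ (@eval_fun M) (@eval_additive M).

Program Definition evalc : cmap (secc a K) (stc K p) :=
  @Cmap (secc a K) (stc K p) (fun n => @eval_fun (K n)) _.
Next Obligation. by []. Qed.

End Evaluation.

Program Definition act_base : action [set: X] k :=
  @Action k X setT k (fun p _ => scal p) _.
Next Obligation. by move=> *; exact: res_scal. Qed.

(** For flasque complexes the cones over open sets form a Mayer-Vietoris presheaf, and over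
    [minopen p] evaluation at [p] identifies the cone with the one on stalks. *)
Lemma section_qis (K L : scplx X) (f : scmap K L) :
  (forall n, flasque (K n)) -> (forall n, flasque (L n)) ->
  (forall p, acyclic (cone (stcm f p))) ->
  forall (U : set X), open U ->
  acyclic (cone (secm (act_sub act_base (@subIsetr _ U setT)) f)).
Proof.
move=> flK flL qis U oU.
have oT : open [set: X] := openT.
pose F (V : set X) : cmap (secp act_base oT flK V) (secp act_base oT flL V) :=
  secm (act_sub act_base (@subIsetr _ V setT)) f.
have natF (V W : set X) (WV : W `<=` V) n x :
    F W n (prs (secp act_base oT flK) WV n x) =
    prs (secp act_base oT flL) WV n (F V n x).
  by apply: sections_ext.
apply: (mv_presheaf_acyclic (pts_finite X) (F := mv_cone natF)) => //.
  have triv n (M : scplx X) (x : secc (act_sub act_base (@subIsetr _ set0 setT)) M n) : x = 0.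
    by apply: sections_ext => p [].
  apply: acyclic_zero => n [x y]; apply/pair_equal_spec; split; first exact: triv.
  by case: n y {x} => [|n] y /=; [case: y | exact: triv].
move=> p.
have Vp : (minopen p `&` setT) p by split=> //; exact: spec_le_refl.
have sub : minopen p `&` setT `<=` minopen p by move=> ? [].
apply: (cone_map_bij (f' := stcm f p) (i := evalc _ K Vp)
  (j := evalc _ L Vp) _ _ _ _ _).2 (qis p).
- by [].
- by move=> n x x0; exact: eval_inj sub x0.
- by move=> n y; exact: (eval_surj Vp y sub).
- by move=> n x x0; exact: eval_inj sub x0.
- by move=> n y; exact: (eval_surj Vp y sub).
Qed.

End SectionComplexes.

Section PushComplexes.
Variables (k : comPzRingType) (X Y : ringed_fspace k) (f : fmorphism X Y).

Program Definition pushc (K : scplx X) : scplx Y :=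
  @Scplx k Y (fun n => push f (K n)) (fun n => push_hom f (sdiff K n)) _.
Next Obligation. by move=> *; apply: sections_ext => p Vp /=; exact: sdiffK. Qed.

Program Definition pushm (K L : scplx X) (u : scmap K L) : scmap (pushc K) (pushc L) :=
  @Scmap k Y (pushc K) (pushc L) (fun n => push_hom f (u n)) _.
Next Obligation. by move=> *; apply: sections_ext => p Vp /=; exact: scfun_diff. Qed.

Section ToPush.
Variables (V : set X) (R : comPzRingType) (a : action V R) (y : Y).
Hypothesis UV : f @^-1` minopen y `<=` V.

Program Definition to_push_fun (M : omod X) (s : asec a M) : push_stalk f M y :=
  @Sections k X M (f @^-1` minopen y) (fun p Up => sec s (UV Up)) _.
Next Obligation. by move=> M s p q Up Uq h; exact: sec_res. Qed.

Lemma to_push_additive M : zmod_morphism (@to_push_fun M).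
Proof. by move=> s t; apply: sections_ext. Qed.

HB.instance Definition _ M :=
  GRing.isZmodMorphism.Build _ _ (@to_push_fun M) (@to_push_additive M).

Program Definition to_push (K : scplx X) : cmap (secc a K) (stc (pushc K) y) :=
  @Cmap (secc a K) (stc (pushc K) y) (fun n => @to_push_fun (K n)) _.
Next Obligation. by move=> *; apply: sections_ext. Qed.

Hypothesis VU : V `<=` f @^-1` minopen y.

Lemma to_push_inj M s : @to_push_fun M s = 0 -> s = 0.
Proof.
move=> s0; apply: sections_ext => p Vp.
have := congr1 (fun t : push_stalk f M y => sec t (VU Vp)) s0.
by rewrite /= => <-; exact: sec_irr.
Qed.

Lemma to_push_surj M t : exists s, @to_push_fun M s = t.
Proof.
have sres p q (Vp : V p) (Vq : V q) (h : spec_le p q) :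
    mres M h (sec t (VU Vp)) = sec t (VU Vq) by exact: sec_res.
exists (Sections sres : asec a M); apply: sections_ext => p Up /=; exact: sec_irr.
Qed.

End ToPush.

Lemma push_qis (K L : scplx X) (u : scmap K L) :
  (forall n, flasque (K n)) -> (forall n, flasque (L n)) ->
  (forall p, acyclic (cone (stcm u p))) ->
  forall y, acyclic (cone (stcm (pushm u) y)).
Proof.
move=> flK flL qis y.
have oU : open (f @^-1` minopen y).
  by have /continuousP := @fmap_continuous _ _ _ f; apply; exact/open_minopen/pts_finite.
have := section_qis flK flL qis oU.
set U := f @^-1` _; set a := act_sub _ _ => ac.
have UT : U `<=` U `&` setT by move=> ?.
have TU : U `&` setT `<=` U by move=> ? [].
apply: (cone_map_bij (f' := stcm (pushm u) y) (i := to_push a UT K)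
  (j := to_push a UT L) _ _ _ _ _).1 ac.
- by move=> n x; apply: sections_ext.
- by move=> n x; exact: to_push_inj.
- by move=> n x; exact: to_push_surj.
- by move=> n x; exact: to_push_inj.
- by move=> n x; exact: to_push_surj.
Qed.

End PushComplexes.

Program Definition mhom_of_local (k : comPzRingType) (X : ringed_fspace k)
    (A B : omod X) (u : local_hom setT A B) : mhom A B :=
  @Mhom k X A B (fun p => u p (I : setT p)) _.
Next Obligation. by move=> *; exact: lhom_res. Qed.

(** * Comparison of the Godement resolution with an injective one *)

Section Lifting.
Variables (k : comPzRingType) (X : ringed_fspace k) (M : omod X).
Variable J : injective_resolution M.

Program Definition ires_cplx : scplx X := @Scplx k X J (idiff J) _.
Next Obligation. by move=> n p x; apply/idiff_exact; exists x. Qed.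

Let e := gemb (reps (X := X)).

(** The data carried by the recursion: a map from the [n]-th cosyzygy into the cycles of [J n].
    Injectivity of [J n] extends it to [gr M n], and the extension followed by the differential
    descends to the next cosyzygy. *)
Let state n := {g : mhom (syz e n M) (J n) | forall p m, idiff J n p (g p m) = 0}.

Let step n (g : state n) : exists phi : mhom (gr M n) (J n),
  (forall p m, phi p (e (syz e n M) p m) = sval g p m) /\
  exists g' : state n.+1, forall p b,
    sval g' p (qtm (e (syz e n M)) p b) = idiff J n p (phi p b).
Proof.
have [|phi phiE] := @ires_injective _ _ M J n _ _ (e (syz e n M)) (sval g).
  by move=> p x y xy; apply/subr0_eq/gemb_inj; rewrite raddfB /= xy subrr.
exists phi; split=> //.
have [|h hE] := @qt_desc _ _ _ _ (e (syz e n M)) setT _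
    (mhom_local setT (mhom_comp (idiff J n) phi)).
  by move=> p _ a /=; rewrite phiE; exact: (svalP g).
have h0 p m : idiff J n.+1 p (mhom_of_local h p m) = 0.
  have [b <-] := qtm_surj m; rewrite [mhom_of_local _ _ _]hE.
  by apply/idiff_exact; exists (phi p b).
by exists (exist _ (mhom_of_local h) h0) => p b; exact: hE.
Qed.

(** Transparent, so that [states 0] computes to the augmentation of [J] when the two resolutions are
    compared in degree 0. *)
Let state0 : state 0.
Proof. by exists (iaug J) => p m; apply/iaug_exact; exists m. Defined.

Let phi n (g : state n) := sval (cid (step g)).
Let next n (g : state n) := sval (cid (svalP (cid (step g))).2).

Let states := fix states n : state n :=
  match n with 0 => state0 | m.+1 => next (states m) end.

Let lift n : mhom (gr M n) (J n) := phi (states n).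

Let lift_emb n p m : lift n p (e (syz e n M) p m) = sval (states n) p m.
Proof. exact: (svalP (cid (step (states n)))).1. Qed.

Let lift_next n p b :
  sval (states n.+1) p (qtm (e (syz e n M)) p b) = idiff J n p (lift n p b).
Proof. exact: (svalP (cid (svalP (cid (step (states n)))).2)). Qed.

Let lift_diff n p x :
  lift n.+1 p (sdiff (gr M) n p x) = sdiff ires_cplx n p (lift n p x).
Proof. by rewrite -[RHS]lift_next -lift_emb. Qed.

Definition godement_lift : scmap (gr M) ires_cplx := @Scmap k X (gr M) ires_cplx lift lift_diff.

(** Both complexes resolve [M]: they are exact in positive degrees, and in degree 0 the lift matches
    the two augmentations. *)
Lemma godement_lift_qis p : acyclic (cone (stcm godement_lift p)).
Proof.
apply/cone_acyclicP; split=> [[|n] x dx bx|[|n] y dy].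
- have [m mx] := (rdiff_eq0 (@gemb_inj _ X) _).1 dx.
  suff m0 : m = 0 by rewrite -mx m0; exact: raddf0.
  apply: (@iaug_injective _ _ _ J p); rewrite raddf0.
  transitivity (lift 0%N p (e (syz e 0%N M) p m)); first by rewrite lift_emb.
  by rewrite -[RHS]bx -mx.
- exact: (rdiff_exact (@gemb_inj _ X) _).1 dx.
- have [m my] := (@iaug_exact _ _ _ J p y).1 dy; exists (e M p m).
    by apply/(rdiff_eq0 (@gemb_inj _ X)); exists m.
  apply/eqP; rewrite subr_eq0 -my; apply/eqP; symmetry; exact: (lift_emb (n := 0%N)).
- have [z hz] := (@idiff_exact _ _ _ J n p y).1 dy; exists 0; first exact: raddf0.
  by exists z; rewrite raddf0 subr0.
Qed.

Lemma ires_flasque n : flasque (ires_cplx n).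
Proof. exact/injective_flasque/ires_injective. Qed.

End Lifting.

(** Both resolutions are flasque, so the direct image of the comparison map is still a
    quasi-isomorphism. A condition on all injective resolutions becomes one on a single complex,
    functorial in [M]. *)
Lemma derived_push_qcP (k : comPzRingType) (X Y : ringed_fspace k)
    (f : fmorphism X Y) (M : omod X) : finite_space Y ->
  derived_push_qc f M <->
  forall (y y' : Y) (h : spec_le y y'), acyclic (cone (bstm (pushc f (gr M)) h)).
Proof.
move=> flat_Y.
have key (J : injective_resolution M) : (forall i, quasi_coherent (higher_direct_image f J i)) <->
    forall (y y' : Y) (h : spec_le y y'), acyclic (cone (bstm (pushc f (gr M)) h)).
  have E i : higher_direct_image f J i = hcoh (pushc f (ires_cplx J)) i by case: i.
  have qis := @push_qis _ _ _ f _ _ (godement_lift J) (@gr_flasque _ _ M)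
    (@ires_flasque _ _ _ J) (@godement_lift_qis _ _ _ J).
  apply: (iff_trans _ (hcoh_qcP flat_Y (pushc f (gr M)))); split=> qc i.
    apply: qc_quasi_coherent; apply/(hcoh_qis_qc qis); rewrite -E.
    exact: quasi_coherent_qc.
  rewrite E; apply: qc_quasi_coherent; apply/(hcoh_qis_qc qis).
  exact: quasi_coherent_qc.
split=> [qc|ac J]; last exact/key.
by have [J] := exists_injective_resolution M; apply/(key J); exact: qc.
Qed.

(** * Base change of sections *)

(** The complexes are defined on all of [X] but the maps on [W] only, because the presentations that
    induce them live on a minimal open set. *)
Record lscmap (k : comPzRingType) (X : ringed_fspace k) (W : set X) (K L : scplx X) :=
  Lscmap {
  lsfun :> forall n, local_hom W (K n) (L n);
  lsfun_diff : forall n p (Wp : W p) x,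
    lsfun n.+1 p Wp (sdiff K n p x) = sdiff L n p (lsfun n p Wp x)
}.

Section BaseChangeComplex.
Variables (k : comPzRingType) (X : ringed_fspace k).
Variables (V V' : set X) (VV : V' `<=` V) (R R' : comPzRingType).
Variables (phi : {rmorphism R -> R'}) (a : action V R) (a' : action V' R').
Hypothesis compat : forall p (Vp : V' p) r, a' p Vp (phi r) = a p (VV Vp) r.

Program Definition bcc (K : scplx X) : cplx :=
  @Cplx (fun n => bc phi (asec a (K n))) (fun n => bcm phi (ssm a (sdiff K n))) _.
Next Obligation.
move=> K n x; rewrite /= -(bcm_comp (w := \0%R)); first exact: bcm_zero.
by move=> s; apply: sections_ext => p Vp /=; rewrite sdiffK.
Qed.

Definition bcr_fun (M : omod X) : {linear bc phi (asec a M) -> asec a' M} :=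
  sval (cid (bc_ext (asr_scale (M := M) compat))).

Lemma bcr_funE (M : omod X) b s : bcr_fun M (bcp phi b s) = b *: asr VV a a' M s.
Proof. exact: (svalP (cid (bc_ext (asr_scale (M := M) compat)))). Qed.

Lemma bcr_fun_nat (W : set X) (VW : V `<=` W) (VW' : V' `<=` W) (M N : omod X)
    (u : local_hom W M N) z :
  bcr_fun N (bcm phi (amap VW a u) z) = amap VW' a' u (bcr_fun M z).
Proof.
elim/bc_ind: z => [|x y hx hy|b s]; first by rewrite !raddf0.
  by rewrite !raddfD /= hx hy.
rewrite bcm_pure !bcr_funE linearZ /=; congr (_ *: _).
by apply: sections_ext => p Vp /=; congr (u p _ _); exact: Prop_irrelevance.
Qed.

Program Definition bcr (K : scplx X) : cmap (bcc K) (secc a' K) :=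
  @Cmap (bcc K) (secc a' K) (fun n => bcr_fun (K n)) _.
Next Obligation. by move=> K n x; exact: bcr_fun_nat. Qed.

(* The cone of [R' (x)_R Gamma(V, K) -> Gamma(V', K)]. *)
Definition bcone (K : scplx X) : cplx := cone (bcr K).

Variables (W : set X) (VW : V `<=` W).

Let VW' : V' `<=` W := subset_trans VV VW.

Section Map.
Variables (K L : scplx X) (u : lscmap W K L).

Program Definition bccm : cmap (bcc K) (bcc L) :=
  @Cmap (bcc K) (bcc L) (fun n => bcm phi (amap VW a (u n))) _.
Next Obligation.
move=> n x; rewrite /= -(bcm_comp (w := amap VW a (u n.+1) \o ssm a (sdiff K n))) //.
by apply: bcm_comp => s; apply: sections_ext => p Vp /=; exact: lsfun_diff.
Qed.

Program Definition seccm : cmap (secc a' K) (secc a' L) :=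
  @Cmap (secc a' K) (secc a' L) (fun n => amap VW' a' (u n)) _.
Next Obligation. by move=> n x; apply: sections_ext => p Vp /=; exact: lsfun_diff. Qed.

Lemma bcone_comm n x : bcr L n (bccm n x) = seccm n (bcr K n x).
Proof. exact: bcr_fun_nat. Qed.

Definition bconem : cmap (bcone K) (bcone L) := cone_map bcone_comm.

End Map.

Lemma bconem_comp (K L P : scplx X) (u : lscmap W K L) (v : lscmap W L P)
    (w : lscmap W K P) :
  (forall n p Wp x, w n p Wp x = v n p Wp (u n p Wp x)) ->
  forall n z, bconem w n z = bconem v n (bconem u n z).
Proof.
move=> h n [x y]; apply/pair_equal_spec; split=> /=.
  by apply: bcm_comp => s; apply: sections_ext => p Vp /=; exact: h.
by case: n y {x} => [|n] y //=; apply: sections_ext => p Vp /=; exact: h.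
Qed.

Lemma bconem_add (K L : scplx X) (u v w : lscmap W K L) :
  (forall n p Wp x, w n p Wp x = u n p Wp x + v n p Wp x) ->
  forall n z, bconem w n z = bconem u n z + bconem v n z.
Proof.
move=> h n [x y]; apply/pair_equal_spec; split=> /=.
  by apply: bcm_add => s; apply: sections_ext => p Vp /=; exact: h.
by case: n y {x} => [|n] y //=; apply: sections_ext => p Vp /=; exact: h.
Qed.

Lemma bconem_zero (K L : scplx X) (w : lscmap W K L) :
  (forall n p Wp x, w n p Wp x = 0) -> forall n z, bconem w n z = 0.
Proof.
move=> h n z; apply: (addrI (bconem w n z)); rewrite addr0 -(@bconem_add _ _ w w w) //.
by move=> m p Wp x; rewrite !h addr0.
Qed.

Hypothesis flat_phi : flat phi.

(** Flatness of [phi] takes care of the tensored component of the cone. The hypothesis ranges over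
    [B] and [S] because it is applied to [V] with [R] and to [V'] with [R']. *)
Lemma bconem_exact (K L P : scplx X) (u : lscmap W K L) (v : lscmap W L P) :
  (forall n (B : set X) (BW : B `<=` W) (S : comPzRingType) (b : action B S),
     upset B ->
     [/\ forall s, amap BW b (u n) s = 0 -> s = 0,
         forall s, amap BW b (v n) s = 0 <-> exists t, amap BW b (u n) t = s &
         forall s, exists t, amap BW b (v n) t = s]) ->
  upset V -> upset V' ->
  [/\ forall n z, bconem u n z = 0 -> z = 0,
      forall n z, bconem v n z = 0 <-> exists w, bconem u n w = z &
      forall n z, exists w, bconem v n w = z].
Proof.
move=> ex upV upV'; split=> n.
- move=> [x y] /pair_equal_spec[/= x0 y0]; apply/pair_equal_spec; split.
    by apply: (flat_inj flat_phi) x0; have [] := ex n _ VW _ a upV.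
  case: n y {x x0} y0 => [|n] y /=; first by case: y.
  by have [h _ _] := ex n _ VW' _ a' upV'; exact: h.
- move=> [x y]; have [_ h1 _] := ex n _ VW _ a upV; split.
    move=> /pair_equal_spec[/= x0 y0].
    have [w hw] := flat_exact flat_phi h1 x0.
    suff [t ht] : exists t, shm (seccm u) n t = y by exists (w, t); apply/pair_equal_spec.
    case: n y {x x0 h1 w hw} y0 => [|n] y /=; first by exists tt; case: y.
    by have [_ h _] := ex n _ VW' _ a' upV'; move/h.
  move=> [[w t] /pair_equal_spec[/= <- <-]]; apply/pair_equal_spec; split=> /=.
    rewrite -(bcm_comp (w := \0%R)); first exact: bcm_zero.
    by move=> s; symmetry; apply/h1; exists s.
  case: n t {x y h1 w} => [|n] t //=.
  by have [_ h _] := ex n _ VW' _ a' upV'; apply/h; exists t.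
- move=> [x y]; have [_ _ h1] := ex n _ VW _ a upV.
  have [w hw] := bcm_surj (phi := phi) h1 x.
  suff [t ht] : exists t, shm (seccm v) n t = y by exists (w, t); apply/pair_equal_spec.
  case: n y {x h1 w hw} => [|n] y /=; first by exists tt; case: y.
  by have [_ _ h] := ex n _ VW' _ a' upV'; exact: h.
Qed.

Lemma bcone_trivial (K : scplx X) n :
  (forall p (x : K n p), x = 0) -> (forall m, n = m.+1 -> forall p (x : K m p), x = 0) ->
  forall z : bcone K n, z = 0.
Proof.
move=> Kn Km [x y]; apply/pair_equal_spec; split.
  elim/bc_ind: x => [//|_ _ -> ->|b s]; first by rewrite addr0.
  suff -> : s = 0 by exact: bcp0.
  by apply: sections_ext => p Vp; exact: Kn.
case: n Km y {Kn x} => [|n] Km y /=; first by case: y.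
by apply: sections_ext => p Vp; exact: (Km n).
Qed.

End BaseChangeComplex.

(** * Functoriality and exactness of the Godement resolution *)

Section GodementFunctor.
Variables (k : comPzRingType) (X : ringed_fspace k) (W : set X) (Wup : upset W).
Let e := gemb (reps (X := X)).

Section Map.
Variables (M N : omod X) (u : local_hom W M N).

Lemma lcomp_res (A B C : omod X) (f : local_hom W A B) (g : local_hom W B C)
    (p q : X) (Wp : W p) (Wq : W q) (h : spec_le p q) m :
  (g q Wq \o f q Wq)%FUN (mres A h m) = mres C h ((g p Wp \o f p Wp)%FUN m).
Proof. by rewrite /= (lhom_res f Wp) (lhom_res g Wp). Qed.

Definition lcomp (A B C : omod X) (g : local_hom W B C) (f : local_hom W A B) :
  local_hom W A C := LocalHom (@lcomp_res A B C f g).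

Lemma qmap_subproof p Wp a :
  lcomp (mhom_local W (qtm (e N))) (god_map (reps (X := X)) Wup u) p Wp (e M p a) = 0.
Proof.
transitivity (qtm (e N) p (god_map (reps (X := X)) Wup u p Wp (e M p a))); first by [].
by rewrite god_map_emb; apply/qtm_eq0; exists (u p Wp a).
Qed.

Definition qmap : local_hom W (qt (e M)) (qt (e N)) :=
  sval (cid (qt_desc qmap_subproof)).

Lemma qmapE p Wp b : qmap p Wp (qtm (e M) p b) =
  qtm (e N) p (god_map (reps (X := X)) Wup u p Wp b).
Proof. exact: (svalP (cid (qt_desc qmap_subproof)) p Wp b). Qed.

End Map.

Fixpoint syz_map n (M N : omod X) (u : local_hom W M N) :
    local_hom W (syz e n M) (syz e n N) :=
  match n with
  | 0 => u
  | m.+1 => qmap (syz_map m u)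
  end.

Lemma syz_mapS n (M N : omod X) (u : local_hom W M N) :
  syz_map n.+1 u = qmap (syz_map n u).
Proof. by []. Qed.

Lemma gr_map_diff (M N : omod X) (u : local_hom W M N) n p Wp x :
  god_map (reps (X := X)) Wup (syz_map n.+1 u) p Wp (sdiff (gr M) n p x) =
  sdiff (gr N) n p (god_map (reps (X := X)) Wup (syz_map n u) p Wp x).
Proof.
transitivity (god_map (reps (X := X)) Wup (syz_map n.+1 u) p Wp
  (e (syz e n.+1 M) p (qtm (e (syz e n M)) p x))); first by [].
by rewrite god_map_emb [syz_map n.+1 u]/(qmap _) qmapE.
Qed.

Definition gr_map (M N : omod X) (u : local_hom W M N) : lscmap W (gr M) (gr N) :=
  @Lscmap k X W (gr M) (gr N)
    (fun n => god_map (reps (X := X)) Wup (syz_map n u)) (gr_map_diff u).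

Lemma syz_map_comp (M N P : omod X) (u : local_hom W M N) (v : local_hom W N P)
    (w : local_hom W M P) : (forall p Wp x, w p Wp x = v p Wp (u p Wp x)) ->
  forall n p Wp x, syz_map n w p Wp x = syz_map n v p Wp (syz_map n u p Wp x).
Proof.
move=> h; elim=> [//|n IHn] p Wp x; have [b <-] := qtm_surj x.
rewrite !syz_mapS !qmapE; congr (qtm _ _ _).
apply: god_ext => r Tr pr; exact: IHn.
Qed.

Lemma syz_map_add (M N : omod X) (u v w : local_hom W M N) :
  (forall p Wp x, w p Wp x = u p Wp x + v p Wp x) ->
  forall n p Wp x, syz_map n w p Wp x = syz_map n u p Wp x + syz_map n v p Wp x.
Proof.
move=> h; elim=> [//|n IHn] p Wp x; have [b <-] := qtm_surj x.
rewrite !syz_mapS !qmapE -raddfD; congr (qtm _ _ _).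
apply: god_ext => r Tr pr; exact: IHn.
Qed.

Lemma gr_map_comp (M N P : omod X) (u : local_hom W M N) (v : local_hom W N P)
    (w : local_hom W M P) : (forall p Wp x, w p Wp x = v p Wp (u p Wp x)) ->
  forall n p Wp x, gr_map w n p Wp x = gr_map v n p Wp (gr_map u n p Wp x).
Proof. by move=> h n p Wp x; apply: god_ext => r Tr pr; exact: syz_map_comp. Qed.

Lemma gr_map_add (M N : omod X) (u v w : local_hom W M N) :
  (forall p Wp x, w p Wp x = u p Wp x + v p Wp x) ->
  forall n p Wp x, gr_map w n p Wp x = gr_map u n p Wp x + gr_map v n p Wp x.
Proof. by move=> h n p Wp x; apply: god_ext => r Tr pr; exact: syz_map_add. Qed.

Lemma gr_map_zero (M N : omod X) (w : local_hom W M N) :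
  (forall p Wp x, w p Wp x = 0) -> forall n p Wp x, gr_map w n p Wp x = 0.
Proof.
move=> h n p Wp x; apply: (addrI (gr_map w n p Wp x)); rewrite addr0 -(@gr_map_add _ _ w w w) //.
by move=> q Wq y; rewrite !h addr0.
Qed.

Definition short_exact (M N P : omod X) (u : local_hom W M N) (v : local_hom W N P) :=
  forall p Wp, [/\ forall x, u p Wp x = 0 -> x = 0,
    forall x, v p Wp x = 0 <-> exists y, u p Wp y = x &
    forall x, exists y, v p Wp y = x].

Lemma god_short_exact (M N P : omod X) (u : local_hom W M N) (v : local_hom W N P)
    (T : set X) : short_exact u v ->
  short_exact (god_map T Wup u) (god_map T Wup v).
Proof.
move=> ex p Wp; split=> [s s0|s|s].
- apply: god_ext => r Tr pr; have [h _ _] := ex r (Wup pr Wp); apply: h.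
  exact: (congr1 (fun t : godm T N p => t r Tr pr) s0).
- split=> [s0|[t <-]]; last first.
    apply: god_ext => r Tr pr; have [_ h _] := ex r (Wup pr Wp).
    by apply/h; exists (t r Tr pr).
  have H r (Tr : T r) (pr : spec_le p r) : exists y, u r (Wup pr Wp) y = s r Tr pr.
    have [_ h _] := ex r (Wup pr Wp); apply/h.
    exact: (congr1 (fun t : godm T P p => t r Tr pr) s0).
  exists (fun r Tr pr => sval (cid (H r Tr pr))); apply: god_ext => r Tr pr.
  exact: (svalP (cid (H r Tr pr))).
- have H r (Tr : T r) (pr : spec_le p r) : exists y, v r (Wup pr Wp) y = s r Tr pr.
    by have [_ _ h] := ex r (Wup pr Wp); exact: h.
  exists (fun r Tr pr => sval (cid (H r Tr pr))); apply: god_ext => r Tr pr.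
  exact: (svalP (cid (H r Tr pr))).
Qed.

(** The nine lemma, for the given sequence, the sequence of its Godement modules and that of the
    cokernels of the embeddings. *)
Lemma qmap_short_exact (M N P : omod X) (u : local_hom W M N) (v : local_hom W N P) :
  short_exact u v -> short_exact (qmap u) (qmap v).
Proof.
move=> ex p Wp; have [gi ge gs] := god_short_exact (reps (X := X)) ex Wp.
have [ui ue us] := ex p Wp.
have eE A B (w : local_hom W A B) a :
    god_map (reps (X := X)) Wup w p Wp (e A p a) = e B p (w p Wp a).
  exact: god_map_emb.
split=> x.
- have [b <-] := qtm_surj x; rewrite qmapE => /qtm_eq0[n hn].
  have /ue[m hm] : v p Wp n = 0.
    apply: (@gemb_inj _ X); rewrite -eE hn; apply/ge; by exists b.
  apply/qtm_eq0; exists m; apply/subr0_eq/gi.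
  by rewrite raddfB /= -[god_map_fun _ _ _ _]/(god_map (reps (X := X)) Wup u p Wp (e M p m)) eE hm hn subrr.
- split=> [|[y <-]]; last first.
    have [b <-] := qtm_surj y; rewrite !qmapE; apply/qtm_eq0; exists 0.
    rewrite raddf0; symmetry; apply/ge; by exists b.
  have [b <-] := qtm_surj x; rewrite qmapE => /qtm_eq0[n hn].
  have [m hm] := us n.
  have /ge[c hc] : god_map (reps (X := X)) Wup v p Wp (b - e N p m) = 0.
    by rewrite raddfB /= -[god_map_fun _ _ _ (e N p m)]/(god_map (reps (X := X)) Wup v p Wp (e N p m))
      eE hm hn subrr.
  exists (qtm (e M) p c); rewrite qmapE hc raddfB /=.
  have /qtm_eq0 h : exists a, e N p a = e N p m by exists m.
  by rewrite -[coker_map _ (e N p m)]/(qtm (e N) p (e N p m)) h subr0.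
- have [b <-] := qtm_surj x; have [c <-] := gs b.
  by exists (qtm (e N) p c); rewrite qmapE.
Qed.

Lemma syz_short_exact (M N P : omod X) (u : local_hom W M N) (v : local_hom W N P) n :
  short_exact u v -> short_exact (syz_map n u) (syz_map n v).
Proof. by move=> ex; elim: n => //= n; exact: qmap_short_exact. Qed.

(** Over an upward closed [B] the sections of a Godement module are a plain product of stalks, so
    surjectivity survives the passage to sections. *)
Lemma god_sections_exact (M N P : omod X) (u : local_hom W M N) (v : local_hom W N P)
    (T B : set X) (BW : B `<=` W) (S : comPzRingType) (b : action B S) :
  short_exact u v -> upset B ->
  [/\ forall s, amap BW b (god_map T Wup u) s = 0 -> s = 0,
      forall s, amap BW b (god_map T Wup v) s = 0 <->
        exists t, amap BW b (god_map T Wup u) t = s &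
      forall s, exists t, amap BW b (god_map T Wup v) t = s].
Proof.
move=> ex upB; have gex := god_short_exact T ex; split=> s.
- move=> s0; apply: sections_ext => p Bp; have [h _ _] := gex p (BW p Bp).
  by apply: h; exact: (congr1 (fun t : sections _ B => t p Bp) s0).
- split=> [s0|[t <-]]; last first.
    apply: sections_ext => p Bp; have [_ h _] := gex p (BW p Bp).
    by apply/h; exists (sec t Bp).
  have H r (Tr : T r) (Br : B r) : exists y, u r (BW r Br) y =
      sec s Br r Tr (spec_le_refl (p:=r)).
    have [_ h _] := ex r (BW r Br); apply/h.
    rewrite (Prop_irrelevance (BW r Br) (Wup (spec_le_refl (p:=r)) (BW r Br))).
    exact: (congr1 (fun t : sections (godm T P) B => t r Br r Tr (spec_le_refl (p:=r))) s0).
  exists (god_sec upB (fun r Tr Br => sval (cid (H r Tr Br))) : asec b (godm T M)).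
  apply: god_sec_ext => // r Tr Br; rewrite /= /god_map_fun.
  rewrite (Prop_irrelevance (Wup _ _) (BW r Br)).
  rewrite (Prop_irrelevance (upB r r _ _) Br).
  exact: (svalP (cid (H r Tr Br))).
- have H r (Tr : T r) (Br : B r) : exists y, v r (BW r Br) y =
      sec s Br r Tr (spec_le_refl (p:=r)).
    by have [_ _ h] := ex r (BW r Br); exact: h.
  exists (god_sec upB (fun r Tr Br => sval (cid (H r Tr Br))) : asec b (godm T N)).
  apply: god_sec_ext => // r Tr Br; rewrite /= /god_map_fun.
  rewrite (Prop_irrelevance (Wup _ _) (BW r Br)).
  rewrite (Prop_irrelevance (upB r r _ _) Br).
  exact: (svalP (cid (H r Tr Br))).
Qed.

End GodementFunctor.

(** * Finite length of the Godement resolution *)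

Section Vanishing.
Variables (k : comPzRingType) (X : ringed_fspace k).
Let finX := pts_finite X.

(** At a representative [r] strictly above [p], the set [minopen r] is smaller and the previous
    cosyzygy is zero by induction. Only the component at [rep p] is left; restricted to [p], it is
    an element whose embedding is the given family, so the cokernel is zero at [p]. *)
Lemma syz_vanish (M : omod X) n : forall p, (card finX (minopen p) <= n)%N ->
  forall x : syz (gemb (reps (X := X))) n M p, x = 0.
Proof.
elim: n => [|n IHn] p hp x.
  suff : (0 < card finX (minopen p))%N by rewrite ltnNge hp.
  rewrite -has_count; apply/hasP; exists p; first exact: mem_points.
  by apply/asboolP; exact: spec_le_refl.
have [t <-] := qtm_surj x; apply/qtm_eq0.
have [h1 h2] := repP p.
exists (mres _ h2 (t (rep p) (reps_rep p) h1)); apply: god_ext => r Tr pr.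
rewrite /= /god_emb_fun /=.
have [rp|nrp] := pselect (spec_le r p).
  have E := reps_eq Tr pr rp.
  move: Tr pr {rp}; rewrite E => Tr pr.
  rewrite (mres_comp h2 pr (spec_le_refl (p:=rep p))) mres_id.
  exact: god_congr.
have hr : (card finX (minopen r) <= n)%N.
  by rewrite -ltnS; apply: leq_trans hp; exact: card_minopen.
by rewrite (IHn r hr (t r Tr pr)) (IHn r hr (mres _ _ _)).
Qed.

Lemma gr_vanish (M : omod X) n p (x : gr M n p) : (size (points finX) <= n)%N -> x = 0.
Proof.
move=> hn; apply: god_ext => r Tr pr; apply: syz_vanish.
by apply: leq_trans hn; exact: count_size.
Qed.

End Vanishing.

(* [u S] plays the role of the truncation to the coordinates in [S] of a direct
   sum indexed by [I]; every section is supported on a finite set of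
   coordinates. *)
Section Finitary.
Variables (k : comPzRingType) (X : ringed_fspace k) (W : set X) (Wup : upset W).
Variable I : Type.
Let finX := pts_finite X.

Definition finitary (A : Type) (u : set {classic I} -> A -> A) (x : A) :=
  exists s : seq {classic I}, forall S : set {classic I}, (forall i, i \in s -> S i) -> u S x = x.

(** Finiteness of [X] enters here: the lists of the separate points are concatenated. *)
Lemma finitary_all (A : X -> Type) (u : forall p, set {classic I} -> A p -> A p)
    (D : X -> Prop) (x : forall p, D p -> A p) :
  (forall p Dp, finitary (u p) (x p Dp)) ->
  exists s : seq {classic I}, forall S : set {classic I}, (forall i, i \in s -> S i) ->
    forall p Dp, u p S (x p Dp) = x p Dp.
Proof.
move=> fin.
have H p : exists s : seq {classic I}, forall S : set {classic I},
    (forall i, i \in s -> S i) -> forall Dp, u p S (x p Dp) = x p Dp.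
  have [Dp|nDp] := pselect (D p); last by exists [::] => S _ Dp.
  have [s hs] := fin p Dp; exists s => S /hs E Dp'.
  by rewrite (Prop_irrelevance Dp' Dp).
have [s hs] := choice H.
exists (flatten [seq s p | p <- points finX]) => S hS p Dp; apply: hs => i is_.
by apply: hS; apply/flatten_mapP; exists p; first exact: mem_points.
Qed.

Definition finitary_hom (M : omod X) (u : set {classic I} -> local_hom W M M) :=
  forall p Wp, forall x, finitary (fun S => u S p Wp) x.

Lemma finitary_god (T : set X) (M : omod X) u : @finitary_hom M u ->
  finitary_hom (fun S => god_map T Wup (u S)).
Proof.
move=> fin p Wp x.
have [|s hs] := @finitary_all (fun r => T r -> spec_le p r -> M r)
  (fun r S y Tr pr => u S r (Wup pr Wp) (y Tr pr)) (fun _ => True) (fun r _ => x r);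
  last by exists s => S /hs E; apply: god_ext => r Tr pr;
          exact: (congr1 (fun f => f Tr pr) (E r Logic.I)).
move=> r _.
have [[Tr pr]|no] := pselect (T r /\ spec_le p r); last first.
  by exists [::] => S _; apply: funext => Tr; apply: funext => pr; case: no.
have [s hs] := fin r (Wup pr Wp) (x r Tr pr); exists s => S /hs E.
apply: funext => Tr'; apply: funext => pr'.
by rewrite (Prop_irrelevance Tr' Tr) (Prop_irrelevance pr' pr).
Qed.

Lemma finitary_syz n (M : omod X) u : @finitary_hom M u ->
  finitary_hom (fun S => syz_map Wup n (u S)).
Proof.
move=> fin; elim: n => [//|n IHn] p Wp x; have [b <-] := qtm_surj x.
have [s hs] := @finitary_god (reps (X := X)) _ _ IHn p Wp b.
by exists s => S /hs E; rewrite syz_mapS qmapE E.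
Qed.

Lemma finitary_gr n (M : omod X) u : @finitary_hom M u ->
  finitary_hom (fun S => gr_map Wup (u S) n).
Proof. by move=> fin; apply: finitary_god; exact: finitary_syz. Qed.

Lemma finitary_asec (V : set X) (VW : V `<=` W) (R : comPzRingType) (a : action V R)
    (M : omod X) u (x : asec a M) :
  @finitary_hom M u -> finitary (fun S => amap VW a (u S)) x.
Proof.
move=> fin.
have [|s hs] := @finitary_all (fun p => V p -> M p)
  (fun p S y Vp => u S p (VW p Vp) (y Vp)) (fun _ => True) (fun p _ => sec x (p := p));
  last by exists s => S /hs E; apply: sections_ext => p Vp;
          exact: (congr1 (fun f => f Vp) (E p Logic.I)).
move=> p _; have [Vp|no] := pselect (V p); last first.
  by exists [::] => S _; apply: funext => Vp; case: no.
have [s hs] := fin p (VW p Vp) (sec x Vp); exists s => S /hs E.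
by apply: funext => Vp'; rewrite (Prop_irrelevance Vp' Vp).
Qed.

Lemma finitary_bc (R R' : comPzRingType) (phi : {rmorphism R -> R'}) (N : lmodType R)
    (u : set {classic I} -> {linear N -> N}) :
  (forall x, finitary u x) -> forall z, finitary (fun S => bcm phi (u S)) z.
Proof.
move=> fin; elim/bc_ind => [|x y [s hs] [t ht]|b n].
- by exists [::] => S _; rewrite raddf0.
- exists (s ++ t) => S hS; rewrite raddfD /= hs ?ht // => i it.
    by apply: hS; rewrite mem_cat it orbT.
  by apply: hS; rewrite mem_cat it.
- by have [s hs] := fin n; exists s => S /hs E; rewrite bcm_pure E.
Qed.

End Finitary.

(** * Free modules of arbitrary rank *)

Section FreeAcyclic.
Variables (k : comPzRingType) (X : ringed_fspace k) (W : set X) (Wup : upset W).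
Variables (V V' : set X) (VV : V' `<=` V) (VW : V `<=` W) (R R' : comPzRingType).
Variables (phi : {rmorphism R -> R'}) (a : action V R) (a' : action V' R').
Hypothesis compat : forall p (Vp : V' p) r, a' p Vp (phi r) = a p (VV Vp) r.
Variable I : Type.

Local Notation L := (free_sheaf X I).
Local Notation Om := (structure_sheaf X).

Section Truncation.
Variable S : set {classic I}.

Lemma trunc_subproof (A : comPzRingType) (f : finsupp I A) :
  finite_set [set i | (if `[< S i >] then f i else 0) != 0].
Proof.
apply: sub_finite_set (fsfin f) => i /=.
by case: asboolP => //; rewrite eqxx.
Qed.

Definition trunc_fun (p : X) (f : L p) : L p := Finsupp (trunc_subproof f).

Lemma trunc_linear p : linear (@trunc_fun p).
Proof.
move=> r f g; apply: finsupp_ext => i /=.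
by case: asboolP => // _; rewrite mulr0 addr0.
Qed.

HB.instance Definition _ p := GRing.isLinear.Build _ _ _ _ (@trunc_fun p) (@trunc_linear p).

Program Definition trunc : local_hom W L L := @LocalHom k X W L L (fun p _ => @trunc_fun p) _.
Next Obligation.
move=> p q Wp Wq h f; apply: finsupp_ext => i /=.
by case: asboolP => //; rewrite rmorph0.
Qed.

End Truncation.

Definition inj_fun (i : I) (p : X) (x : Om p) : L p :=
  (x : stalk p) *: fs_delta (stalk p) i.

Lemma inj_linear i p : linear (@inj_fun i p).
Proof. by move=> r x y; rewrite /inj_fun scalerDl scalerA. Qed.

HB.instance Definition _ i p := GRing.isLinear.Build _ _ _ _ (@inj_fun i p) (@inj_linear i p).

Program Definition inj_hom (i : I) : local_hom W Om L :=
  @LocalHom k X W Om L (fun p _ => @inj_fun i p) _.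
Next Obligation. by move=> i p q Wp Wq h x; rewrite [RHS]fs_map_delta. Qed.

Definition proj_fun (i : I) (p : X) (f : L p) : Om p := fsval f i.

Lemma proj_linear i p : linear (@proj_fun i p).
Proof. by []. Qed.

HB.instance Definition _ i p := GRing.isLinear.Build _ _ _ _ (@proj_fun i p) (@proj_linear i p).

Program Definition proj_hom (i : I) : local_hom W L Om :=
  @LocalHom k X W L Om (fun p _ => @proj_fun i p) _.
Next Obligation. by []. Qed.

Lemma trunc_finitary : finitary_hom trunc.
Proof.
move=> p Wp f; have [s _ hs] := fs_support f; exists s => S hS.
apply: finsupp_ext => i /=; case: asboolP => // nS; apply/esym/eqP.
by apply: contraT => /hs /hS.
Qed.

Local Notation T M := (bcone compat (gr M)).
Local Notation Tm u := (bconem compat VW (gr_map Wup u)).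

(** A cocycle is fixed by the truncation to some finite list of coordinates. Splitting off one
    coordinate writes that truncation as a shorter one plus a composite through [T Om], which
    contributes a boundary. Additivity of [T] on morphisms thus replaces commutation with infinite
    sums. *)
Lemma bcone_free_acyclic : acyclic (T Om) -> acyclic (T L).
Proof.
move=> acO n z dz.
have [s hs] : finitary (fun S => Tm (trunc S) n) z.
  case: z {dz} => x y.
  have [s hs] := finitary_bc (phi := phi)
    (fun x => finitary_asec VW x (finitary_gr Wup (n := n) trunc_finitary)) x.
  have [t ht] : finitary (fun S => shm (seccm VV a' VW (gr_map Wup (trunc S))) n) y.
    case: n y {x s hs} => [|n] y /=; first by exists [::] => S _; case: y.
    exact: (finitary_asec (subset_trans VV VW) (y : asec a' _) (finitary_gr Wup (n := n) trunc_finitary)).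
  exists (s ++ t) => S hS; apply/pair_equal_spec; split=> /=.
    by apply: hs => i it; apply: hS; rewrite mem_cat it.
  by apply: ht => i it; apply: hS; rewrite mem_cat it orbT.
have {hs} : Tm (trunc [set` s]) n z = z by apply: hs.
elim: s z dz => [|i s IHs] z dz tz.
  rewrite -tz bconem_zero; first exact: bdry0.
  move=> m p Wp x; apply: gr_map_zero => q Wq f; apply: finsupp_ext => j /=.
  by case: asboolP.
have [i_s|i_s] := boolP (i \in s).
  apply: IHs => //; rewrite -[RHS]tz; congr (Tm (trunc _) n z).
  apply/seteqP; split=> j /=; rewrite inE; first by move=> ->; rewrite orbT.
  by case/orP => [/eqP ->|].
have tE y : Tm (trunc [set` i :: s]) n y =
    Tm (trunc [set` s]) n y + Tm (inj_hom i) n (Tm (proj_hom i) n y).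
  have c : forall n p Wp x, gr_map Wup (lcomp (inj_hom i) (proj_hom i)) n p Wp x =
      gr_map Wup (inj_hom i) n p Wp (gr_map Wup (proj_hom i) n p Wp x).
    exact: gr_map_comp.
  rewrite -(bconem_comp VW c).
  apply: bconem_add => m p Wp x; apply: gr_map_add => q Wq f.
  apply: finsupp_ext => j /=; rewrite inE.
  case: (asboolP (j = i)) => [->|ji].
    by rewrite mulr1 eqxx /=; case: asboolP => [|]; rewrite ?(negbTE i_s) //; case: asboolP; rewrite ?add0r.
  rewrite mulr0 addr0; have -> : ((j : {classic I}) == i) = false by apply/eqP.
  by [].
rewrite -tz tE; apply: bdryD; last first.
  apply/bdry_map/acO; rewrite -cfun_diff dz; exact: raddf0.
apply: IHs; first by rewrite -cfun_diff dz; exact: raddf0.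
(* Truncation is idempotent, so the remaining summand is fixed by the truncation to [s], as the
   induction hypothesis asks. *)
have c : forall n p Wp x, gr_map Wup (trunc [set` s]) n p Wp x =
    gr_map Wup (trunc [set` s]) n p Wp (gr_map Wup (trunc [set` s]) n p Wp x).
  apply: gr_map_comp => q Wq f.
  by apply: finsupp_ext => j /=; case: asboolP.
by rewrite -(bconem_comp VW c).
Qed.

End FreeAcyclic.

Section KernelSheaf.
Variables (k : comPzRingType) (X : ringed_fspace k) (flat_X : finite_space X).
Variables (W : set X) (Wup : upset W) (L M : omod X) (b : local_hom W L M).

Lemma kernel_subproof p r (x y : L p) :
  (forall Wp : W p, b p Wp x = 0) /\ (~ W p -> x = 0) ->
  (forall Wp : W p, b p Wp y = 0) /\ (~ W p -> y = 0) ->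
  (forall Wp : W p, b p Wp (r *: x + y) = 0) /\ (~ W p -> r *: x + y = 0).
Proof.
move=> [bx x0] [b_y y0]; split=> Wp; last by rewrite x0 // y0 // scaler0 addr0.
by rewrite linearP bx b_y /= scaler0 addr0.
Qed.

Lemma kernel0_subproof p :
  (forall Wp : W p, b p Wp (0 : L p) = 0) /\ (~ W p -> (0 : L p) = 0).
Proof. by split=> // Wp; rewrite raddf0. Qed.

Definition kernel_smod p : smod (L p) := Smod (kernel0_subproof p) (@kernel_subproof p).

Lemma kernel_smod_res p q (h : spec_le p q) x :
  kernel_smod p x -> kernel_smod q (mres L h x).
Proof.
move=> [bx x0]; split=> [Wq|nWq]; last first.
  by rewrite x0 ?raddf0 // => Wp; apply: nWq; exact: Wup h Wp.
have [Wp|nWp] := pselect (W p); last by rewrite x0 // !raddf0.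
by rewrite (lhom_res b Wp) bx raddf0.
Qed.

(* The kernel of [b], extended by zero outside [W]. *)
Definition kernel_sheaf : omod X := subsheaf kernel_smod_res.

Definition kernel_incl : local_hom W kernel_sheaf L :=
  mhom_local W (subsheaf_incl kernel_smod_res).

Lemma kernel_inclE p Wp x : b p Wp x = 0 <-> exists z, kernel_incl p Wp z = x.
Proof.
split=> [bx|[z <-]]; last exact: (smvalP z).1.
suff Sx : kernel_smod p x by exists (Subm Sx).
by split=> [Wp'|//]; rewrite (Prop_irrelevance Wp' Wp).
Qed.

Lemma kernel_incl_inj p Wp z : kernel_incl p Wp z = 0 -> z = 0.
Proof. by move=> z0; apply: subm_ext. Qed.

Lemma kernel_short_exact : (forall p Wp y, exists x, b p Wp x = y) ->
  short_exact kernel_incl b.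
Proof.
move=> sur p Wp; split; [exact: kernel_incl_inj | exact: kernel_inclE | exact: sur].
Qed.

(** Flat restrictions make the kernel commute with base change from [p] to [q], so the criterion
    passes to it from [L] and [M]. *)
Lemma kernel_qc : qc_on W L -> qc_on W M -> qc_on W kernel_sheaf.
Proof.
move=> qL qM p q h Wp; have Wq := Wup h Wp.
have [Li Ls] := qL p q h Wp; have [Mi _] := qM p q h Wp; split=> [z z0|m].
  apply: (flat_inj (@flat_X _ _ h) (@kernel_incl_inj p Wp)); apply: Li.
  by rewrite -(lhom_bcres kernel_incl Wp Wq) z0 raddf0.
have [z zm] := Ls (kernel_incl q Wq m).
have [w wz] : exists w, bcm (res h) (kernel_incl p Wp) w = z.
  apply: (flat_exact (@flat_X _ _ h) (@kernel_inclE p Wp)); apply: Mi.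
  by rewrite -(lhom_bcres b Wp Wq) zm; apply/kernel_inclE; exists m.
exists w; apply: subm_ext.
suff: kernel_incl q Wq (bcres kernel_sheaf h w) = kernel_incl q Wq m by [].
by rewrite (lhom_bcres kernel_incl Wp Wq) wz zm.
Qed.

End KernelSheaf.

Section BaseChangeQC.
Variables (k : comPzRingType) (X : ringed_fspace k) (flat_X : finite_space X) (x : X).
Local Notation W := (minopen x).
Variables (V V' : set X) (VV : V' `<=` V) (VW : V `<=` W) (R R' : comPzRingType).
Variables (phi : {rmorphism R -> R'}) (a : action V R) (a' : action V' R').
Hypothesis compat : forall p (Vp : V' p) r, a' p Vp (phi r) = a p (VV Vp) r.
Hypotheses (upV : upset V) (upV' : upset V') (flat_phi : flat phi).

Local Notation T M := (bcone compat (gr M)).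

(* Descending induction on the degree: [T M] vanishes in high degrees, and a
   presentation [0 -> K -> O^(I) -> M -> 0] on [W] relates [T M] in degree [n]
   to [T K] in degree [n + 1]. *)
Lemma bcone_qc_acyclic : acyclic (T (structure_sheaf X)) ->
  forall M, qc_on W M -> acyclic (T M).
Proof.
move=> acO; have Wup : upset W by move=> p q pq xp; exact: spec_le_trans xp pq.
(* One more than the vanishing bound for [gr M], because the cone in degree [n] also contains
   sections of [gr M] in degree [n - 1]. *)
pose N := (size (points (pts_finite X))).+1.
suff H m : forall n, (N <= n + m)%N -> forall M, qc_on W M -> exact_at (T M) n.
  by move=> M qM n; apply: (H N n) => //; exact: leq_addl.
elim: m => [|m IHm] n hn M qM.
  rewrite addn0 in hn => z _.
  suff -> : z = 0 by exact: bdry0.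
  apply: bcone_trivial => [p y|m nm p y].
    exact: (gr_vanish y (ltnW hn)).
  by apply: (gr_vanish y); rewrite nm in hn.
pose b := gen_hom M x.
have bsur p Wp y : exists z, b p Wp z = y.
  by apply: gen_hom_surj; have [_ h] := qM x p Wp (spec_le_refl (p:=x)).
have ses := kernel_short_exact Wup bsur.
have [inj ex sur] :
    [/\ forall n z, bconem compat VW (gr_map Wup (kernel_incl Wup b)) n z = 0 -> z = 0,
      forall n z, bconem compat VW (gr_map Wup b) n z = 0 <->
        exists w, bconem compat VW (gr_map Wup (kernel_incl Wup b)) n w = z &
      forall n z, exists w, bconem compat VW (gr_map Wup b) n w = z].
  apply: bconem_exact => // j B BW S c upB.
  by apply: god_sections_exact => //; exact: syz_short_exact.
apply: (ses_exact_at inj sur ex).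
  exact: bcone_free_acyclic acO _.
apply: IHm; first by rewrite addSnnS.
by apply: kernel_qc => //; exact: qc_on_free.
Qed.

End BaseChangeQC.

(** * Products and graphs *)

Section ProductSquares.
Variables (k : comPzRingType).

Section Left.
Variables (A B C : comPzRingType) (pA : {rmorphism k -> A}) (pB : {rmorphism k -> B}).
Variables (pC : {rmorphism k -> C}) (f : {rmorphism A -> B}).
Hypothesis fp : forall c, f (pA c) = pB c.

Lemma tensor_alg_ind (D E : comPzRingType) (pD : {rmorphism k -> D})
    (pE : {rmorphism k -> E}) (P : tensor_alg pD pE -> Prop) :
  (forall x y, P x -> P y -> P (x + y)) -> P 0 ->
  (forall d e, P (tpure pD pE d e)) -> forall x, P x.
Proof.
move=> PD P0 Pp x; rewrite (tensorE x).
elim: (repr x) => [|z s IHs]; first by rewrite big_nil; exact: P0.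
by rewrite big_cons; apply: PD; [exact: Pp | exact: IHs].
Qed.

Lemma tensor_alg_lift (D E : comPzRingType) (pD : {rmorphism k -> D})
    (pE : {rmorphism k -> E}) (P : zmodType) (g : D -> E -> P) :
  balanced (fun c d => pD c * d) (fun c e => pE c * e) g ->
  exists h : {additive tensor_alg pD pE -> P}, forall d e, h (tpure pD pE d e) = g d e.
Proof.
move=> hg; have add : zmod_morphism (tlift g : tensor_alg pD pE -> P).
  by move=> x y; rewrite tliftD // tliftN.
exists (HB.pack_for {additive tensor_alg pD pE -> P} (tlift g : tensor_alg pD pE -> P)
  (GRing.isZmodMorphism.Build _ _ _ add)) => d e /=.
exact: tlift_pure.
Qed.

(** This is [B (x)_k C = B (x)_A (A (x)_k C)]: a pure tensor of [b] and [c] is the product of the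
    images of [b] and of [tpure pA pC 1 c]. *)
Lemma pushout_left (psi : {rmorphism tensor_alg pA pC -> tensor_alg pB pC}) :
  (forall x c, psi (tpure _ _ x c) = tpure _ _ (f x) c) ->
  pushout_square f (tensor_inl pA pC) (tensor_inl pB pC) psi.
Proof.
move=> psiE; split=> [x|P PD P0 Pp|P g gDl gDr gZ].
- by rewrite /= /tensor_inl_fun psiE.
- apply: tensor_alg_ind => // b c.
  have := Pp b (tpure pA pC 1 c).
  by rewrite psiE /= /tensor_inl_fun rmorph1 tpureM mulr1 mul1r.
have balp := @balanced_tpure k A C pA pC.
have [balDl balDr balZ] := balp.
have [h hE] : exists h : {additive tensor_alg pB pC -> P},
    forall b c, h (tpure pB pC b c) = g b (tpure pA pC 1 c).
  apply: tensor_alg_lift; split=> [b b' c|b c c'|r b c].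
  - exact: gDl.
  - by rewrite balDr gDr.
  - rewrite -fp gZ /= /tensor_inl_fun tpureM mulr1 mul1r -[in LHS](mulr1 (pA r)).
    by rewrite balZ.
exists h => b s; have g0 : g b 0 = 0 by apply: (addrI (g b 0)); rewrite -gDr !addr0.
elim/tensor_alg_ind: s => [x y hx hy||x c].
- by rewrite rmorphD mulrDr raddfD hx hy gDr.
- by rewrite rmorph0 mulr0 raddf0 g0.
- rewrite psiE /= /tensor_inl_fun tpureM mul1r hE mulrC gZ /= /tensor_inl_fun.
  by rewrite tpureM mulr1 mul1r.
Qed.

End Left.

Section Right.
Variables (A B C : comPzRingType) (pA : {rmorphism k -> A}) (pB : {rmorphism k -> B}).
Variables (pC : {rmorphism k -> C}) (f : {rmorphism A -> B}).
Hypothesis fp : forall c, f (pA c) = pB c.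

Lemma pushout_right (psi : {rmorphism tensor_alg pC pA -> tensor_alg pC pB}) :
  (forall c x, psi (tpure _ _ c x) = tpure _ _ c (f x)) ->
  pushout_square f (tensor_inr pC pA) (tensor_inr pC pB) psi.
Proof.
move=> psiE; split=> [x|P PD P0 Pp|P g gDl gDr gZ].
- by rewrite /= /tensor_inr_fun psiE.
- apply: tensor_alg_ind => // c b.
  have := Pp b (tpure pC pA c 1).
  by rewrite psiE /= /tensor_inr_fun rmorph1 tpureM mulr1 mul1r.
have [balDl balDr balZ] := @balanced_tpure k C A pC pA.
have [h hE] : exists h : {additive tensor_alg pC pB -> P},
    forall c b, h (tpure pC pB c b) = g b (tpure pC pA c 1).
  apply: tensor_alg_lift; split=> [c c' b|c b b'|r c b].
  - by rewrite balDl gDr.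
  - exact: gDl.
  - by rewrite -fp gZ /= /tensor_inr_fun tpureM mulr1 mul1r balZ mulr1.
exists h => b s; have g0 : g b 0 = 0 by apply: (addrI (g b 0)); rewrite -gDr !addr0.
elim/tensor_alg_ind: s => [x y hx hy||c x].
- by rewrite rmorphD mulrDr raddfD hx hy gDr.
- by rewrite rmorph0 mulr0 raddf0 g0.
- rewrite psiE /= /tensor_inr_fun tpureM mul1r hE mulrC gZ /= /tensor_inr_fun.
  by rewrite tpureM mulr1 mul1r.
Qed.

End Right.
End ProductSquares.

Section ProductFlat.
Variables (k : comPzRingType) (X Y : ringed_fspace k).
Hypotheses (flat_X : finite_space X) (flat_Y : finite_space Y).

Lemma prod_leE (z z' : fprod X Y) : spec_le z z' <-> spec_le z.1 z'.1 /\ spec_le z.2 z'.2.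
Proof.
split=> [h|[h1 h2]]; first by split; [exact: prod_le1 h | exact: prod_le2 h].
move=> U oU Uz.
have : nbhs z U by apply: open_nbhs_nbhs.
case=> -[P Q] [/= nP nQ] PQ; apply: PQ; split=> /=.
  by move: nP; rewrite nbhsE => -[P' [oP P'z] P'P]; exact: (P'P _ (h1 _ oP P'z)).
by move: nQ; rewrite nbhsE => -[Q' [oQ Q'z] Q'Q]; exact: (Q'Q _ (h2 _ oQ Q'z)).
Qed.

(** The restriction factors through the point [(x', y)], and each half is a base change of a
    restriction of [X] or of [Y]. *)
Lemma fprod_finite_space : finite_space (fprod X Y).
Proof.
move=> [x y] [x' y'] h; have /prod_leE[/= hx hy] := h.
have h1 : @spec_le (fprod X Y) (x, y) (x', y).
  by apply/prod_leE; split=> //; exact: spec_le_refl.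
have h2 : @spec_le (fprod X Y) (x', y) (x', y').
  by apply/prod_leE; split=> //; exact: spec_le_refl.
apply: (flat_comp (phi := res h1) (psi := res h2)).
- by move=> a; rewrite (res_comp h1 h2 h).
- apply: (flat_pushout (phi := res hx) (alpha := tensor_inl (scal x) (scal y))
    (beta := tensor_inl (scal x') (scal y))) (@flat_X _ _ hx).
  apply: pushout_left; first exact: res_scal.
  move=> a c; rewrite [LHS]prod_res_pure; congr (tpure _ _ _ _).
    congr (res _ a); exact: Prop_irrelevance.
  exact: res_id.
- apply: (flat_pushout (phi := res hy) (alpha := tensor_inr (scal x') (scal y))
    (beta := tensor_inr (scal x') (scal y'))) (@flat_Y _ _ hy).
  apply: pushout_right; first exact: res_scal.
  move=> a c; rewrite [LHS]prod_res_pure; congr (tpure _ _ _ _).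
    exact: res_id.
  congr (res _ c); exact: Prop_irrelevance.
Qed.

End ProductFlat.

Section PushAction.
Variables (k : comPzRingType) (X Y : ringed_fspace k) (f : fmorphism X Y).

Program Definition act_push (y : Y) : action (f @^-1` minopen y) (stalk y) :=
  @Action k X (f @^-1` minopen y) (stalk y)
    (fun p Vp => (fsharp f p \o res (Vp : spec_le y (f p)))%FUN) _.
Next Obligation.
move=> y p q Vp Vq h b /=.
have h' : spec_le (f p) (f q) by exact: continuous_spec_le (@fmap_continuous _ _ _ f) h.
by rewrite -(fsharp_res h h') (res_comp _ _ Vq).
Qed.

Variables (y y' : Y) (h : spec_le y y') (flat_h : flat (res h)).
Variables (V V' : set X) (VV : V' `<=` V).
Variables (a : action V (stalk y)) (a' : action V' (stalk y')).
Hypothesis compat : forall p (Vp : V' p) r, a' p Vp (res h r) = a p (VV Vp) r.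
Hypotheses (UV : f @^-1` minopen y `<=` V) (VU : V `<=` f @^-1` minopen y).
Hypotheses (UV' : f @^-1` minopen y' `<=` V') (VU' : V' `<=` f @^-1` minopen y').
Hypothesis aE : forall p (Vp : V p) (Up : (f @^-1` minopen y) p) b,
  a p Vp b = act_push y p Up b.
Hypothesis aE' : forall p (Vp : V' p) (Up : (f @^-1` minopen y') p) b,
  a' p Vp b = act_push y' p Up b.

Lemma to_push_linear (M : omod X) : linear (to_push_fun UV (a := a) (M := M)).
Proof.
move=> r s t; apply: sections_ext => p Up /=.
by rewrite (aE (UV Up) Up).
Qed.

HB.instance Definition _ (M : omod X) :=
  GRing.isLinear.Build _ _ _ _ (to_push_fun UV (a := a) (M := M)) (@to_push_linear M).

(** The stalk of [f_* K] at [y] consists of sections over [f^-1 U_y]. The set [V] is kept apart from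
    it, with inclusions both ways, because it also occurs as an intersection with [setT]. *)
Lemma bcone_push (K : scplx X) :
  acyclic (bcone compat K) <-> acyclic (cone (bstm (pushc f K) h)).
Proof.
pose g n : {linear asec a (K n) -> push_stalk f (K n) y} := to_push_fun UV (a := a) (M := K n).
have gd n x : bcm (res h) (g n.+1) (cdiff (bcc (res h) a K) n x) =
    cdiff (bst (pushc f K) h) n (bcm (res h) (g n) x).
  elim/bc_ind: x => [|x z hx hz|b s]; first by rewrite !raddf0.
    by rewrite !raddfD /= hx hz.
  rewrite /= !bcm_pure; congr (bcp _ _ _); exact: sections_ext.
pose i : cmap (bcc (res h) a K) (bst (pushc f K) h) :=
  @Cmap (bcc (res h) a K) (bst (pushc f K) h) (fun n => bcm (res h) (g n)) gd.
apply: (cone_map_bij (i := i) (j := to_push a' UV' K)).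
- move=> n; elim/bc_ind => [|x z hx hz|b s]; first by rewrite !raddf0.
    by rewrite !raddfD /= hx hz.
  rewrite /= bcm_pure bcresE bcr_funE.
  apply: sections_ext => p Up /=.
  by rewrite (aE' (UV' Up) Up) /=; congr (_ *: _); exact: sec_irr.
- by move=> n; apply: (flat_inj flat_h) => s; exact: to_push_inj.
- by move=> n z; apply: bcm_surj => t; exact: to_push_surj.
- by move=> n s; exact: to_push_inj.
- by move=> n t; exact: to_push_surj.
Qed.

End PushAction.

(** * Change of coefficient ring and of open set *)

Section PushoutCone.
Variables (k : comPzRingType) (X : ringed_fspace k).
Variables (A B S T : comPzRingType) (phi : {rmorphism A -> B}).
Variables (alpha : {rmorphism A -> S}) (beta : {rmorphism B -> T}).
Variables (psi : {rmorphism S -> T}) (po : pushout_square phi alpha beta psi).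
Variables (V V' : set X) (VV : V' `<=` V) (a : action V A) (a' : action V' B).
Variables (U U' : set X) (UU : U' `<=` U) (b : action U S) (b' : action U' T).
Hypothesis compat : forall p (Vp : V' p) r, a' p Vp (phi r) = a p (VV Vp) r.
Hypothesis compatb : forall p (Up : U' p) r, b' p Up (psi r) = b p (UU Up) r.
Hypotheses (UV : U `<=` V) (VU : V `<=` U) (UV' : U' `<=` V') (VU' : V' `<=` U').
Hypothesis ab : forall p (Up : U p) r, b p Up (alpha r) = a p (UV Up) r.
Hypothesis ab' : forall p (Up : U' p) r, b' p Up (beta r) = a' p (UV' Up) r.

(** Since [T (x)_S N = B (x)_A N], sections over the same pair of open sets have isomorphic cones
    for either pair of rings. This is the passage from [O_x (x)_k O_y] to [O_y]. *)
Lemma bcone_pushout (K : scplx X) :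
  acyclic (bcone compat K) <-> acyclic (bcone compatb K).
Proof.
have G_ n : exists (G : {additive bc phi (asec a (K n)) -> bc psi (asec b (K n))})
    (F : {additive bc psi (asec b (K n)) -> bc phi (asec a (K n))}),
    [/\ forall c m, G (bcp phi c m) = bcp psi (beta c) (asr UV a b (K n) m),
        cancel G F & cancel F G].
  apply: (pushout_bc po (j := asr VU b a (K n))).
  - by move=> r s; apply: sections_ext => p Up /=; rewrite ab.
  - by move=> s; apply: sections_ext => p Vp /=; exact: sec_irr.
  - by move=> s; apply: sections_ext => p Up /=; exact: sec_irr.
pose G n := sval (cid (G_ n)).
have GP n := svalP (cid (G_ n)).
have GE n c m : G n (bcp phi c m) = bcp psi (beta c) (asr UV a b (K n) m).
  by have [F [h _ _]] := GP n; exact: h.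
have Gi n x : G n x = 0 -> x = 0.
  by have [F [_ GF _]] := GP n => Gx; rewrite -[x]GF; move: Gx; rewrite /G => ->; rewrite raddf0.
have Gs n y : exists x, G n x = y by have [F [_ _ FG]] := GP n; exists (F y); exact: FG.
have Gd n x : G n.+1 (cdiff (bcc phi a K) n x) = cdiff (bcc psi b K) n (G n x).
  elim/bc_ind: x => [|x z hx hz|c s]; first by rewrite !raddf0.
    by rewrite !raddfD /= hx hz.
  rewrite GE /= !bcm_pure GE; congr (bcp _ _ _); exact: sections_ext.
apply: (cone_map_bij (i := @Cmap (bcc phi a K) (bcc psi b K) G Gd)
  (j := secr UV' a' b' K)).
- move=> n; elim/bc_ind => [|x z hx hz|c s]; first by rewrite !raddf0.
    by rewrite !raddfD /= hx hz.
  rewrite /= GE !bcr_funE; apply: sections_ext => p Up /=; rewrite ab'.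
  by congr (_ *: _); exact: sec_irr.
- exact: Gi.
- exact: Gs.
- move=> n s s0; apply: sections_ext => p Vp.
  have := congr1 (fun t : sections (K n) U' => sec t (VU' Vp)) s0.
  by rewrite /= => <-; exact: sec_irr.
- move=> n t; exists (asr VU' b' a' (K n) t); apply: sections_ext => p Up /=.
  exact: sec_irr.
Qed.

End PushoutCone.

Section BaseChangePresheaf.
Variables (k : comPzRingType) (X : ringed_fspace k).
Variables (V0 V0' : set X) (VV : V0' `<=` V0) (oV0 : open V0) (oV0' : open V0').
Variables (R R' : comPzRingType) (phi : {rmorphism R -> R'}) (flat_phi : flat phi).
Variables (a : action V0 R) (a' : action V0' R').
Hypothesis compat : forall p (Vp : V0' p) r, a' p Vp (phi r) = a p (VV Vp) r.
Variables (K : scplx X) (flK : forall n, flasque (K n)).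

Local Notation A U := (act_sub a (@subIsetr _ U V0)).
Local Notation A' U := (act_sub a' (@subIsetr _ U V0')).

Program Definition bc_cap_res (U V : set X) (VU : V `<=` U) :
    cmap (bcc phi (A U) K) (bcc phi (A V) K) :=
  @Cmap (bcc phi (A U) K) (bcc phi (A V) K) (fun n => bcm phi (cap_res a (K n) VU)) _.
Next Obligation.
move=> U V VU n x /=.
elim/bc_ind: x => [|x z hx hz|c s]; first by rewrite !raddf0.
  by rewrite !raddfD /= hx hz.
by rewrite !bcm_pure /= ?bcm_pure; congr (bcp _ _ _); exact: sections_ext.
Qed.

Program Definition bc_presheaf : mv_presheaf X :=
  @MVPresheaf X (fun U => bcc phi (A U) K) bc_cap_res _ _ _ _.
Next Obligation.
move=> U V W UV VW UW n x; rewrite /= -(bcm_comp (w := cap_res a (K n) UW)) //.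
by move=> s; apply: sections_ext => p Wp /=; exact: sec_irr.
Qed.
Next Obligation.
move=> U V UW VW n x oU oV.
by apply: (bc_sep flat_phi) => w; exact: cap_sep.
Qed.
Next Obligation.
move=> U V IU IV UW VW n x y oU oV.
apply: (bc_glue flat_phi) => [w|s t]; last exact: cap_glue.
by apply: sections_ext => p Ip /=; exact: sec_irr.
Qed.
Next Obligation.
move=> U V UV n y oU oV; apply: bcm_surj => t; exact: cap_surj.
Qed.

Lemma cap_sub (U : set X) : U `&` V0' `<=` U `&` V0.
Proof. by move=> p [Up Vp]; split=> //; exact: VV. Qed.

Lemma cap_compat (U : set X) p (Wp : (U `&` V0') p) r :
  A' U p Wp (phi r) = A U p (cap_sub Wp) r.
Proof.
rewrite /= compat; congr (a p _ r); exact: Prop_irrelevance.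
Qed.

(** Flatness keeps the base change of the sections a Mayer-Vietoris presheaf, so the cones form one
    too and the induction over open sets applies. *)
Lemma bcone_presheaf_acyclic :
  (forall x, acyclic (bcone (@cap_compat (minopen x)) K)) ->
  forall U, open U -> acyclic (bcone (@cap_compat U) K).
Proof.
move=> acp U oU.
pose F (W : set X) : cmap (bc_presheaf W) (secp a' oV0' flK W) :=
  bcr (@cap_compat W) K.
have natF (W W' : set X) (WW : W' `<=` W) n x :
    F W' n (prs bc_presheaf WW n x) = prs (secp a' oV0' flK) WW n (F W n x).
  elim/bc_ind: x => [|x z hx hz|c s]; first by rewrite !raddf0.
    by rewrite !raddfD /= hx hz.
  rewrite /= bcm_pure !bcr_funE; apply: sections_ext => p Wp /=.
  by congr (_ *: _); [congr (a' p _ c); exact: Prop_irrelevance | exact: sec_irr].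
apply: (mv_presheaf_acyclic (pts_finite X) (F := mv_cone natF)) => //.
apply: acyclic_zero => n [x y]; apply/pair_equal_spec; split.
  elim/bc_ind: x => [//|_ _ -> ->|c s]; first by rewrite addr0.
  suff -> : s = 0 by exact: bcp0.
  by apply: sections_ext => p [].
by case: n y {x} => [|n] y /=; [case: y | apply: sections_ext => p []].
Qed.

End BaseChangePresheaf.

Theorem theorem5p5 (k : comPzRingType) (X Y : ringed_fspace k)
    (f : fmorphism X Y) (hX : finite_space X) (hY : finite_space Y)
    (hf : schematic f) (M : omod X) (hM : quasi_coherent M) :
  derived_push_qc (graph f) M /\ derived_push_qc f M.
Proof.
have hXY : finite_space (fprod X Y) := fprod_finite_space hX hY.
have qM := quasi_coherent_qc hM.
have oV (Z : ringed_fspace k) (g : fmorphism X Z) z : open (g @^-1` minopen z).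
  by have /continuousP := @fmap_continuous _ _ _ g; apply; exact/open_minopen/pts_finite.
have sub (Z : ringed_fspace k) (g : fmorphism X Z) (z z' : Z) (h : spec_le z z') :
    g @^-1` minopen z' `<=` g @^-1` minopen z.
  by move=> p; exact: spec_le_trans h.
have compat (Z : ringed_fspace k) (g : fmorphism X Z) (z z' : Z) (h : spec_le z z')
    p (Vp : (g @^-1` minopen z') p) r :
    act_push g z' p Vp (res h r) = act_push g z p (sub Z g z z' h p Vp) r.
  by rewrite /= (res_comp h Vp (sub Z g z z' h p Vp)).
have bconeP (Z : ringed_fspace k) (hZ : finite_space Z) (g : fmorphism X Z)
    (z z' : Z) (h : spec_le z z') (N : omod X) :
    acyclic (bcone (compat Z g z z' h) (gr N)) <->
    acyclic (cone (bstm (pushc g (gr N)) h)).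
  have fl : flat (res h) := @hZ _ _ h.
  apply: bcone_push => //.
    by move=> p Vp Up b; rewrite (Prop_irrelevance Vp Up).
  by move=> p Vp Up b; rewrite (Prop_irrelevance Vp Up).
(* The inverse image of [minopen z] under the graph lies in [minopen z.1], on which [M] has a
   presentation. The schematic hypothesis supplies the case of the structure sheaf. *)
have acG (z z' : fprod X Y) (h : spec_le z z') : acyclic (bcone (compat _ (graph f) z z' h) (gr M)).
  apply: (@bcone_qc_acyclic _ _ hX z.1).
  - by move=> p /prod_leE[].
  - by move=> p q pq; apply: open_upset pq; exact: oV.
  - by move=> p q pq; apply: open_upset pq; exact: oV.
  - exact: hXY.
  - by apply/bconeP => //; move: z z' h; exact/(derived_push_qcP (graph f) _ hXY).
  - by move=> p q h' _; exact: qM.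
split.
  by apply/(derived_push_qcP _ _ hXY) => z z' h; apply/bconeP.
apply/(derived_push_qcP _ _ hY) => y y' h.
have fl : flat (res h) := @hY _ _ h.
(* With [x] fixed, the part of [f^-1 U_y] in [minopen x] is the inverse image of [minopen (x, y)]
   under the graph, and the restriction from [(x, y)] to [(x, y')] is the pushout of [res h]. The
   cone over [O_y] is thus one of those in [acG]. *)
have key x : acyclic (bcone (cap_compat (compat Y f y y' h) (U := minopen x)) (gr M)).
  have h' : @spec_le (fprod X Y) (x, y) (x, y').
    by apply/prod_leE; split=> //; exact: spec_le_refl.
  have po : pushout_square (res h) (tensor_inr (scal x) (scal y))
      (tensor_inr (scal x) (scal y')) (res h').
    apply: pushout_right; first exact: res_scal.
    move=> c b; rewrite [LHS]prod_res_pure; congr (tpure _ _ _ _).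
      exact: res_id.
    congr (res _ b); exact: Prop_irrelevance.
  have inrE z p (Up : (graph f @^-1` minopen (x, z)) p) (Vp : (f @^-1` minopen z) p) r :
      act_push (graph f) (x, z) p Up (tensor_inr (scal x) (scal z) r) = act_push f z p Vp r.
    transitivity (graph_sharp f p (prod_res Up (tpure (scal x) (scal z) 1 r))); first by [].
    rewrite prod_res_pure graph_sharp_pure rmorph1 mul1r.
    congr (fsharp f p (res _ r)); exact: Prop_irrelevance.
  have UV z : graph f @^-1` minopen (x, z) `<=` minopen x `&` (f @^-1` minopen z).
    by move=> p /prod_leE.
  have VU z : minopen x `&` (f @^-1` minopen z) `<=` graph f @^-1` minopen (x, z).
    by move=> p xp; apply/prod_leE.
  have ab z p (Up : (graph f @^-1` minopen (x, z)) p) r :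
      act_push (graph f) (x, z) p Up (tensor_inr (scal x) (scal z) r) =
      act_sub (act_push f z) (@subIsetr _ (minopen x) (f @^-1` minopen z)) p (UV z p Up) r.
    exact: inrE.
  have P := bcone_pushout po (cap_compat (compat Y f y y' h) (U := minopen x))
    (compat _ (graph f) _ _ h') (VU y) (VU y') (ab y) (ab y').
  exact/P/acG.
(* The open set [setT] recovers [f^-1 U_y] itself. *)
have acT := bcone_presheaf_acyclic (oV Y f y) (oV Y f y') fl (@gr_flasque _ _ M) key openT.
have UT z : f @^-1` minopen z `<=` setT `&` (f @^-1` minopen z) by [].
have TU z : setT `&` (f @^-1` minopen z) `<=` f @^-1` minopen z by move=> p [].
have aE z p (Vp : (setT `&` (f @^-1` minopen z)) p) (Up : (f @^-1` minopen z) p) r :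
    act_sub (act_push f z) (@subIsetr _ setT (f @^-1` minopen z)) p Vp r =
    act_push f z p Up r.
  by rewrite /=; congr (fsharp f p (res _ r)); exact: Prop_irrelevance.
have P := bcone_push fl (cap_compat (compat Y f y y' h) (U := setT))
  (UT y) (TU y) (UT y') (TU y') (aE y) (aE y').
exact/P/acT.
Qed.
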